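(* Let $\alpha>0$ be fixed. Then there exists an exponent $p^\star=p^\star(\alpha)$ such that for every $p>p^\star(\alpha)$ the problem $-\Delta u=|x|^\alpha|u|^{p-1}u$ in $B$, $u=0$ on $\partial B$, admits at least $\lceil\alpha/2\rceil$ distinct positive nonradial solutions.
   Context: $B$ is the open unit disc of $\mathbb R^2$; $\lceil\cdot\rceil$ is the ceiling function. *)

(* Defs.v *)
From Stdlib Require Import Reals Lra ZArith.
Open Scope R_scope.

Definition inB (x y : R) : Prop := x ^ 2 + y ^ 2 < 1.
Definition inBbar (x y : R) : Prop := x ^ 2 + y ^ 2 <= 1.
Definition onBoundary (x y : R) : Prop := x ^ 2 + y ^ 2 = 1.

Definition cont2_on (D : R -> R -> Prop) (f : R -> R -> R) : Prop :=
  forall x y, D x y -> forall eps, 0 < eps -> exists delta, 0 < delta /\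
    forall x' y', D x' y' -> (x' - x) ^ 2 + (y' - y) ^ 2 < delta ^ 2 ->
      Rabs (f x' y' - f x y) < eps.

Definition weight (alpha x y : R) : R :=
  let r := sqrt (x ^ 2 + y ^ 2) in
  if Req_EM_T r 0 then 0 else Rpower r alpha.

Definition nonlin (p u : R) : R :=
  if Req_EM_T u 0 then 0 else Rpower (Rabs u) (p - 1) * u.

Definition henon_solution (alpha p : R) (u : R -> R -> R) : Prop :=
  cont2_on inBbar u /\
  (forall x y, onBoundary x y -> u x y = 0) /\
  exists ux uy uxx uxy uyx uyy : R -> R -> R,
    cont2_on inB ux /\ cont2_on inB uy /\
    cont2_on inB uxx /\ cont2_on inB uxy /\
    cont2_on inB uyx /\ cont2_on inB uyy /\
    forall x y, inB x y ->
      derivable_pt_lim (fun t => u t y) x (ux x y) /\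
      derivable_pt_lim (fun t => u x t) y (uy x y) /\
      derivable_pt_lim (fun t => ux t y) x (uxx x y) /\
      derivable_pt_lim (fun t => ux x t) y (uxy x y) /\
      derivable_pt_lim (fun t => uy t y) x (uyx x y) /\
      derivable_pt_lim (fun t => uy x t) y (uyy x y) /\
      - (uxx x y + uyy x y) = weight alpha x y * nonlin p (u x y).

Definition positive_in_B (u : R -> R -> R) : Prop :=
  forall x y, inB x y -> 0 < u x y.

Definition radial (u : R -> R -> R) : Prop :=
  exists f : R -> R, forall x y, inB x y -> u x y = f (x ^ 2 + y ^ 2).

Definition rotation_equiv (u v : R -> R -> R) : Prop :=
  exists theta : R, forall x y, inB x y ->
    u x y = v (x * cos theta - y * sin theta) (x * sin theta + y * cos theta).

(* ceiling of a real, as a natural number (for nonnegative arguments). *)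
Definition ceil_nat (x : R) : nat := Z.to_nat (- Int_part (- x)).

(* Main.v *)
(* For [n < alpha/2 + 1] the substitution [u(z) = kappa v(z^n)] turns a solution [v] of the
   equation with exponent [a = (alpha + 2)/n - 2 > 0] into one with exponent [alpha].  So it
   suffices to find, for every [a > 0] and large [p], one positive nonradial solution [v] that
   decreases under the reflections fixing the origin and moving points away from the positive
   [x]-axis: nonradial functions in this cone have no rotational period, hence the [v(z^n)] are
   not rotation equivalent for distinct [n].

   Let [G] be the Dirichlet Green operator of the disc and [|w|] the norm of [L^(p+1)(|x|^a dx)].
   Along the iteration [w -> G(|x|^a w^p) / |w|^p] the norm increases, by symmetry of [G] and
   Hoelder's inequality; a limit point is 2-periodic by the equality case, hence a fixed point by
   the maximum principle, and the cone is preserved.  With [m = (p + 1)/2], starting from a bump of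
   squared radius comparable to [exp(-m)] centred at [(1/2, 0)] forces norm at least [m/(4 pi e) (1 + o(1))],
   whereas a radial solution (normalised to be a fixed point) has norm at most
   [m/(4 pi e (1 + a/4)) (1 + o(1))]. *)

(* Only continuous functions are integrated, and only in the Riemann sense. The Green function
   [ln (DD / rho2) / (4 PI)] is therefore replaced by [ln ((DD + e) / (rho2 + e)) / (4 PI)], and the
   potential with its first two derivatives is the limit [e -> 0], with explicit rates. Adding the
   same [e] to both terms keeps symmetry, positivity and the zero boundary values at every stage.

   The factor [1 + a/4] arises as follows. A radial fixed point of norm [A] satisfies
   [u^2 <= A / (4 PI) * ln (1/t)] with [t = |x|^2], so its energy is controlled by the integral of
   [(ln (1/t))^m t^(a/2)]. One writes [t^(a/2) = t^(1 + a/4) t^(a/4 - 1)]: the second factor is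
   integrable, and the first lowers the maximum of [(ln (1/t))^m] to [(m / (e (1 + a/4)))^m]. The
   bump sits where the weight is bounded below, so for it the weight costs only a constant to the
   power [1/m], which tends to 1. The scale [D = exp (- m)] maximises [ln (1/D) D^(1/m)].

   The admissible [n] are exactly [1, ..., ceil (alpha/2)], since [n < alpha/2 + 1] means
   [n - 1 < alpha/2]; this is the count in the theorem. *)
Require Import Defs.
From Stdlib Require Import Reals Lra Lia ZArith List Classical ClassicalEpsilon FunctionalExtensionality.
From Coquelicot Require Import Coquelicot.
From Stdlib Require Import ssreflect.
Open Scope R_scope.
Unset SsrOldRewriteGoalsOrder.
Open Scope general_if_scope.

(** * Integrals over the square *)

Notation pt := (prod R R).

Definition cont {T : UniformSpace} (f : T -> R) : Prop := forall z, continuous f z.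

Lemma cont_const (T : UniformSpace) (c : R) : cont (fun _ : T => c).
Proof. move=> z; exact: continuous_const. Qed.

Lemma cont_plus (T : UniformSpace) (f g : T -> R) :
  cont f -> cont g -> cont (fun z => f z + g z).
Proof. move=> hf hg z; exact: (continuous_plus (V := R_NormedModule) f g z (hf z) (hg z)). Qed.

Lemma cont_opp (T : UniformSpace) (f : T -> R) : cont f -> cont (fun z => - f z).
Proof. move=> hf z; exact: (continuous_opp (V := R_NormedModule) f z (hf z)). Qed.

Lemma cont_minus (T : UniformSpace) (f g : T -> R) :
  cont f -> cont g -> cont (fun z => f z - g z).
Proof. move=> hf hg; apply: cont_plus => //; exact: cont_opp. Qed.

Lemma cont_mult (T : UniformSpace) (f g : T -> R) :
  cont f -> cont g -> cont (fun z => f z * g z).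
Proof. move=> hf hg z; exact: (continuous_mult (K := R_AbsRing) f g z (hf z) (hg z)). Qed.

Lemma cont_comp (T U : UniformSpace) (f : T -> U) (g : U -> R) :
  (forall z, continuous f z) -> cont g -> cont (fun z => g (f z)).
Proof. move=> hf hg z; exact: continuous_comp. Qed.

Lemma cont_comp_pos (T : UniformSpace) (f : T -> R) (g : R -> R) :
  cont f -> (forall z, 0 < f z) -> (forall t, 0 < t -> continuous g t) ->
  cont (fun z => g (f z)).
Proof. move=> hf hp hg z; apply: continuous_comp; first exact: hf. exact: hg. Qed.

Lemma cont_ln (T : UniformSpace) (f : T -> R) :
  cont f -> (forall z, 0 < f z) -> cont (fun z => ln (f z)).
Proof. move=> hf hp; apply: cont_comp_pos => //; exact: continuous_ln. Qed.

Lemma cont_inv (T : UniformSpace) (f : T -> R) :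
  cont f -> (forall z, 0 < f z) -> cont (fun z => / f z).
Proof.
move=> hf hp; apply: cont_comp_pos => // t ht.
apply: continuous_Rinv; lra.
Qed.

Lemma cont_div (T : UniformSpace) (f g : T -> R) :
  cont f -> cont g -> (forall z, 0 < g z) -> cont (fun z => f z / g z).
Proof. move=> hf hg hp; apply: cont_mult => //; exact: cont_inv. Qed.

Lemma cont_exp (T : UniformSpace) (f : T -> R) : cont f -> cont (fun z => exp (f z)).
Proof. move=> hf; apply: cont_comp => //; exact: continuous_exp. Qed.

Lemma cont_Rpower (T : UniformSpace) (f : T -> R) (a : R) :
  cont f -> (forall z, 0 < f z) -> cont (fun z => Rpower (f z) a).
Proof.
move=> hf hp; rewrite /Rpower; apply: cont_exp; apply: cont_mult; first exact: cont_const.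
exact: cont_ln.
Qed.

Lemma cont_Rabs (T : UniformSpace) (f : T -> R) : cont f -> cont (fun z => Rabs (f z)).
Proof. move=> hf; apply: cont_comp => //; exact: continuous_Rabs. Qed.

Lemma cont_sqrt (T : UniformSpace) (f : T -> R) : cont f -> cont (fun z => sqrt (f z)).
Proof. move=> hf; apply: cont_comp => //; exact: continuous_sqrt. Qed.

Lemma cont_Rmax (T : UniformSpace) (f g : T -> R) :
  cont f -> cont g -> cont (fun z => Rmax (f z) (g z)).
Proof.
move=> hf hg z.
apply: (continuous_ext (fun z => (f z + g z + Rabs (f z - g z)) * / 2)).
  move=> t /=; rewrite /Rmax; case: Rle_dec => h; rewrite /Rabs; case: Rcase_abs => h'; lra.
apply: cont_mult; last exact: cont_const.
apply: cont_plus; first exact: cont_plus.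
apply: cont_Rabs; exact: cont_minus.
Qed.

Lemma cont_pow (T : UniformSpace) (f : T -> R) (n : nat) : cont f -> cont (fun z => f z ^ n).
Proof.
move=> hf; elim: n => [|n IH] /=; first exact: cont_const.
exact: cont_mult.
Qed.

Lemma cont_id : cont (fun t : R => t).
Proof. move=> z; exact: continuous_id. Qed.

Lemma continuous_pair (T U V : UniformSpace) (f : T -> U) (g : T -> V) (z : T) :
  continuous f z -> continuous g z -> continuous (fun t => (f t, g t)) z.
Proof.
move=> hf hg P [eps HP].
have h1 : locally z (fun t => ball (f z) eps (f t)) by apply: hf; exists eps.
have h2 : locally z (fun t => ball (g z) eps (g t)) by apply: hg; exists eps.
apply: filter_imp (filter_and _ _ h1 h2) => t [a b]; apply: HP; split; assumption.
Qed.

Ltac cproj :=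
  first
  [ exact: continuous_id | exact: continuous_const
  | apply: continuous_pair; cproj
  | exact: continuous_fst | exact: continuous_snd
  | apply: (continuous_comp _ fst); [cproj | exact: continuous_fst]
  | apply: (continuous_comp _ snd); [cproj | exact: continuous_snd] ].

Ltac cstep :=
  match goal with
  | |- cont (fun _ => ?c) => exact: cont_const
  | H : cont ?f |- cont ?f => exact: H
  (* Unification can leave eta-contracted goals such as [cont (Rminus x)]; these three cases expand
     them. *)
  | |- cont (Rminus ?x) => apply: (cont_minus _ (fun _ => x) (fun t => t))
  | |- cont (Rplus ?x) => apply: (cont_plus _ (fun _ => x) (fun t => t))
  | |- cont (Rmult ?x) => apply: (cont_mult _ (fun _ => x) (fun t => t))
  | |- cont (fun _ => _ + _) => apply: cont_plus
  | |- cont (fun _ => _ - _) => apply: cont_minus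
  | |- cont (fun _ => - _) => apply: cont_opp
  | |- cont (fun _ => _ * _) => apply: cont_mult
  | |- cont (fun _ => _ ^ _) => apply: cont_pow
  | |- cont (fun _ => Rabs _) => apply: cont_Rabs
  | |- cont (fun _ => Rmax _ _) => apply: cont_Rmax
  | |- cont (fun _ => sqrt _) => apply: cont_sqrt
  | |- cont (fun _ => exp _) => apply: cont_exp
  | |- cont (fun _ => ln _) => apply: cont_ln
  | |- cont (fun _ => / _) => apply: cont_inv
  | |- cont (fun _ => _ / _) => apply: cont_div
  | |- cont (fun _ => Rpower _ _) => apply: cont_Rpower
  | |- cont (fun z => (_, _)) => fail 1
  | H : cont ?g |- cont (fun z => ?g (@?f z)) => apply: (cont_comp _ _ f g) => //; move=> ?; cproj
  | |- cont _ => let z := fresh "z" in move=> z; cproj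
  end.
Ltac ctac := repeat cstep.

Lemma ex_RInt_cont (f : R -> R) (a b : R) : cont f -> ex_RInt f a b.
Proof. move=> hf; apply: ex_RInt_continuous => z _; exact: hf. Qed.

Lemma RInt_ext_le (f g : R -> R) (a b : R) : a <= b -> (forall x, a < x < b -> f x = g x) ->
  RInt f a b = RInt g a b.
Proof. move=> hab h; apply: RInt_ext => x; rewrite Rmin_left // Rmax_right //; exact: h. Qed.

Lemma RInt_FTC (F f : R -> R) (a b : R) : a <= b ->
  (forall x, a <= x <= b -> is_derive F x (f x)) -> (forall x, a <= x <= b -> continuous f x) ->
  RInt f a b = F b - F a.
Proof.
move=> hab h1 h2; apply: is_RInt_unique.
by apply: (is_RInt_derive (V := R_CompleteNormedModule) F f) => x; rewrite Rmin_left // Rmax_right //; auto.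
Qed.

Lemma RInt_split (f : R -> R) (a b c : R) : cont f -> RInt f a c = RInt f a b + RInt f b c.
Proof.
by move=> hf; rewrite -(RInt_Chasles (V := R_CompleteNormedModule) f a b c); try exact: ex_RInt_cont.
Qed.

Lemma MVT_le (f f' : R -> R) (a b : R) : a <= b -> (forall x, a <= x <= b -> is_derive f x (f' x)) ->
  exists c, a <= c <= b /\ f b - f a = f' c * (b - a).
Proof.
move=> hab h; have := MVT_gen f a b f'; rewrite Rmin_left // Rmax_right //; apply=> x hx.
  apply: h; lra.
apply: derivable_continuous_pt; apply: ex_derive_Reals_0; eexists; exact: h.
Qed.

Lemma cont_slice (T : UniformSpace) (k : T * R -> R) (t : T) : cont k -> cont (fun y => k (t, y)).
Proof. move=> hk; ctac. Qed.

Lemma cont_slice2 (T : UniformSpace) (k : T * pt -> R) (t : T) : cont k -> cont (fun y => k (t, y)).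
Proof. move=> hk; ctac. Qed.

Lemma RInt_minusR (f g : R -> R) (a b : R) : ex_RInt f a b -> ex_RInt g a b ->
  RInt (fun t => f t - g t) a b = RInt f a b - RInt g a b.
Proof. move=> hf hg; exact: (RInt_minus (V := R_CompleteNormedModule) f g a b hf hg). Qed.

Lemma RInt_plusR (f g : R -> R) (a b : R) : ex_RInt f a b -> ex_RInt g a b ->
  RInt (fun t => f t + g t) a b = RInt f a b + RInt g a b.
Proof. move=> hf hg; exact: (RInt_plus (V := R_CompleteNormedModule) f g a b hf hg). Qed.

Lemma RInt_scalR (f : R -> R) (a b c : R) : ex_RInt f a b ->
  RInt (fun t => c * f t) a b = c * RInt f a b.
Proof. move=> hf; exact: (RInt_scal (V := R_CompleteNormedModule) f a b c hf). Qed.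

(* Tube lemma: compactness of [a, b] makes continuity in the parameter uniform. *)
Lemma near_unif (T : UniformSpace) (k : T * R -> R) (a b : R) (t0 : T) (eps : posreal) :
  cont k ->
  locally t0 (fun t => forall y, a <= y <= b -> Rabs (k (t, y) - k (t0, y)) < eps).
Proof.
move=> hk.
have h : forall y : R, exists d : posreal, forall t y', ball t0 d t -> Rabs (y' - y) < d ->
    Rabs (k (t, y') - k (t0, y)) < pos_div_2 eps.
  move=> y.
  have := hk (t0, y); rewrite /continuous => /filterlim_locally /(_ (pos_div_2 eps)) [d hd].
  exists d => t y' ht hy.
  apply: hd; split => //.
pose del y := proj1_sig (constructive_indefinite_description _ (h y)).
have hdel : forall y t y', ball t0 (del y) t -> Rabs (y' - y) < del y ->
    Rabs (k (t, y') - k (t0, y)) < pos_div_2 eps.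
  move=> y; rewrite /del; case: constructive_indefinite_description => d hd //=.
case: (compactness_value_1d a b del) => d hd.
exists d => t ht y hy.
have [x [hx [h1 h2]]] := NNPP _ (hd y hy).
have e1 := hdel x t y (ball_le _ _ _ h2 _ ht) h1.
have e2 := hdel x t0 y (ball_center _ _) h1.
have -> : k (t, y) - k (t0, y) = (k (t, y) - k (t0, x)) - (k (t0, y) - k (t0, x)) by ring.
apply: Rle_lt_trans (Rabs_triang _ _) _; rewrite Rabs_Ropp.
simpl in e1, e2 |- *; lra.
Qed.

Lemma cont_RInt (T : UniformSpace) (k : T * R -> R) (a b : R) :
  a <= b -> cont k -> cont (fun t => RInt (fun y => k (t, y)) a b).
Proof.
move=> hab hk t0; apply/filterlim_locally => eps.
have hp : 0 < eps / (b - a + 1) by apply: Rdiv_lt_0_compat; [exact: cond_pos | lra].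
apply: filter_imp (near_unif T k a b t0 (mkposreal _ hp) hk) => t ht.
have ei : forall t, ex_RInt (fun y => k (t, y)) a b.
  by move=> s; apply: ex_RInt_cont; apply: cont_slice.
change (Rabs (RInt (fun y => k (t, y)) a b - RInt (fun y => k (t0, y)) a b) < eps).
have -> : RInt (fun y => k (t, y)) a b - RInt (fun y => k (t0, y)) a b =
   RInt (fun y => k (t, y) - k (t0, y)) a b.
  symmetry; exact: (RInt_minus (V := R_CompleteNormedModule) (fun y => k (t, y)) (fun y => k (t0, y)) a b (ei t) (ei t0)).
apply: (Rle_lt_trans _ ((b - a) * (eps / (b - a + 1)))).
  apply: abs_RInt_le_const => //.
    exact: (ex_RInt_minus (V := R_CompleteNormedModule) (fun y => k (t, y)) (fun y => k (t0, y)) a b (ei t) (ei t0)).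
  move=> y hy; apply: Rlt_le; exact: ht.
have he := cond_pos eps.
apply: (Rmult_lt_reg_r (b - a + 1)); first lra.
have -> : (b - a) * (eps / (b - a + 1)) * (b - a + 1) = (b - a) * eps by field; lra.
nra.
Qed.

(** With the upper bound [b] replaced by a variable [t], both sides vanish at [t = a] and have the
    same derivative, so their difference [F] is constant. *)
Lemma Fubini_RInt (k : pt -> R) (a b c d : R) :
  a <= b -> c <= d -> cont k ->
  RInt (fun x => RInt (fun y => k (x, y)) c d) a b =
  RInt (fun y => RInt (fun x => k (x, y)) a b) c d.
Proof.
move=> hab hcd hk.
have hk' : cont (fun z : pt => k (snd z, fst z)) by ctac.
have hin : cont (fun x => RInt (fun y => k (x, y)) c d) by apply: cont_RInt.
case: (Req_dec a b) => [<-|hne].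
  rewrite RInt_point (RInt_ext _ (fun _ => 0)).
    by move=> y _; rewrite RInt_point.
  by rewrite RInt_const /scal /= /mult /= Rmult_0_r.
pose F t := RInt (fun x => RInt (fun y => k (x, y)) c d) a t
   - RInt (fun y => RInt (fun x => k (x, y)) a t) c d.
have D1 : forall t, is_derive (fun t => RInt (fun x => RInt (fun y => k (x, y)) c d) a t) t
    (RInt (fun y => k (t, y)) c d).
  move=> t; apply: (is_derive_RInt (fun x => RInt (fun y => k (x, y)) c d) _ a).
    apply: filter_forall => s; apply: RInt_correct; exact: ex_RInt_cont.
  exact: hin.
have sl : forall y, cont (fun x => k (x, y)) by move=> y; ctac.
have Dk : forall v u, is_derive (fun z => RInt (fun x => k (x, v)) a z) u (k (u, v)).
  move=> v u; apply: (is_derive_RInt (fun x => k (x, v)) _ a).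
    apply: filter_forall => s; apply: RInt_correct; exact: ex_RInt_cont.
  exact: sl.
have D2 : forall t, a <= t -> is_derive (fun t => RInt (fun y => RInt (fun x => k (x, y)) a t) c d) t
    (RInt (fun y => k (t, y)) c d).
  move=> t hat.
  have -> : RInt (fun y => k (t, y)) c d =
     RInt (fun y => Derive (fun u => RInt (fun x => k (x, y)) a u) t) c d.
    apply: RInt_ext => y _; symmetry; apply: is_derive_unique; exact: Dk.
  apply: (is_derive_RInt_param (fun u y => RInt (fun x => k (x, y)) a u)).
  - apply: filter_forall => u y _; exists (k (u, y)); exact: Dk.
  - move=> y _; apply/continuity_2d_pt_filterlim.
    rewrite (is_derive_unique _ _ _ (Dk y t)).
    apply: (filterlim_ext k).
      move=> [u v] /=; symmetry; apply: is_derive_unique; exact: Dk.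
    exact: hk.
  (* Integrability is required on a full neighbourhood of [t], which for [t = a] contains [u < a];
     there the bounds are swapped first, because [cont_RInt] wants them in order. *)
  - apply: filter_forall => u.
    case: (Rle_dec a u) => hau.
      by apply: ex_RInt_cont; apply: (cont_RInt _ (fun z : pt => k (snd z, fst z)) a u).
    apply: (ex_RInt_ext (fun y => - RInt (fun x => k (x, y)) u a)).
      move=> y _.
      exact: (opp_RInt_swap (V := R_CompleteNormedModule) (fun x => k (x, y)) u a (ex_RInt_cont _ _ _ (sl y))).
    apply: ex_RInt_cont; apply: cont_opp.
    apply: (cont_RInt _ (fun z : pt => k (snd z, fst z)) u a) => //; lra.
have : F a = F b.
  apply: (eq_is_derive F); last lra.
  move=> t ht.
  have -> : zero = minus (RInt (fun y => k (t, y)) c d) (RInt (fun y => k (t, y)) c d).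
    by rewrite /minus plus_opp_r.
  apply: (is_derive_minus (V := R_NormedModule)); first exact: D1.
  apply: D2; lra.
rewrite /F RInt_point.
rewrite (RInt_ext (fun y => RInt (fun x => k (x, y)) a a) (fun _ => 0)).
  by move=> y _; rewrite RInt_point.
rewrite RInt_const /scal /= /mult /= /zero /=; lra.
Qed.

(* Functions on the disc are extended by [0] to the square [-1, 1]^2, so that iterated one-dimensional integrals suffice. *)
Definition I2 (F : pt -> R) : R := RInt (fun x => RInt (fun y => F (x, y)) (-1) 1) (-1) 1.

Definition inQ (z : pt) : Prop := -1 <= fst z <= 1 /\ -1 <= snd z <= 1.

Lemma cont_inner (F : pt -> R) : cont F -> cont (fun x => RInt (fun y => F (x, y)) (-1) 1).
Proof. move=> h; apply: cont_RInt => //; lra. Qed.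

Lemma I2_ext (F G : pt -> R) : (forall z, inQ z -> F z = G z) -> I2 F = I2 G.
Proof.
move=> h; rewrite /I2; apply: RInt_ext_le => [|x hx]; first lra.
apply: RInt_ext_le => [|y hy]; first lra.
apply: h; split => /=; lra.
Qed.

Lemma I2_plus (F G : pt -> R) : cont F -> cont G -> I2 (fun z => F z + G z) = I2 F + I2 G.
Proof.
move=> hF hG; rewrite /I2.
rewrite (RInt_ext _ (fun x => plus (RInt (fun y => F (x, y)) (-1) 1) (RInt (fun y => G (x, y)) (-1) 1))).
  move=> x _; apply: (RInt_plus (V := R_CompleteNormedModule) (fun y => F (x, y)) (fun y => G (x, y)));
  apply: ex_RInt_cont; exact: cont_slice.
apply: (RInt_plus (V := R_CompleteNormedModule)); apply: ex_RInt_cont; exact: cont_inner.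
Qed.

Lemma I2_scal (F : pt -> R) (c : R) : cont F -> I2 (fun z => c * F z) = c * I2 F.
Proof.
move=> hF; rewrite /I2.
rewrite (RInt_ext _ (fun x => scal c (RInt (fun y => F (x, y)) (-1) 1))).
  move=> x _; apply: (RInt_scal (V := R_CompleteNormedModule) (fun y => F (x, y))).
  apply: ex_RInt_cont; exact: cont_slice.
apply: (RInt_scal (V := R_CompleteNormedModule)); apply: ex_RInt_cont; exact: cont_inner.
Qed.

Lemma I2_minus (F G : pt -> R) : cont F -> cont G -> I2 (fun z => F z - G z) = I2 F - I2 G.
Proof.
move=> hF hG.
have -> : I2 F - I2 G = I2 F + (-1) * I2 G by ring.
rewrite -I2_scal // -I2_plus //; first by ctac.
apply: I2_ext => z _; ring.
Qed.

Lemma I2_const (c : R) : I2 (fun _ => c) = 4 * c.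
Proof. rewrite /I2 !RInt_const /scal /= /mult /=; ring. Qed.

Lemma I2_le (F G : pt -> R) : cont F -> cont G -> (forall z, inQ z -> F z <= G z) -> I2 F <= I2 G.
Proof.
move=> hF hG h; rewrite /I2; apply: RInt_le; first lra.
- by apply: ex_RInt_cont; apply: cont_inner.
- by apply: ex_RInt_cont; apply: cont_inner.
move=> x hx; apply: RInt_le; first lra.
- by apply: ex_RInt_cont; apply: cont_slice.
- by apply: ex_RInt_cont; apply: cont_slice.
move=> y hy; apply: h; split => /=; lra.
Qed.

Lemma I2_ge0 (F : pt -> R) : cont F -> (forall z, inQ z -> 0 <= F z) -> 0 <= I2 F.
Proof.
move=> hF h; have -> : 0 = I2 (fun _ => 0) by rewrite I2_const; ring.
apply: I2_le => //; exact: cont_const.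
Qed.

Lemma I2_abs_le (F G : pt -> R) : cont F -> cont G ->
  (forall z, inQ z -> Rabs (F z) <= G z) -> Rabs (I2 F) <= I2 G.
Proof.
move=> hF hG h; apply: Rabs_le; split.
  have -> : - I2 G = I2 (fun z => (-1) * G z) by rewrite I2_scal //; ring.
  apply: I2_le => //; first by ctac.
  move=> z hz; have := h z hz => /Rabs_le_between; lra.
apply: I2_le => // z hz; have := h z hz => /Rabs_le_between; lra.
Qed.

Lemma I2_abs_const (F : pt -> R) (c : R) : cont F -> (forall z, inQ z -> Rabs (F z) <= c) ->
  Rabs (I2 F) <= 4 * c.
Proof. move=> hF h; rewrite -I2_const; apply: I2_abs_le => //; exact: cont_const. Qed.

Lemma cont_I2 (T : UniformSpace) (k : T * pt -> R) : cont k -> cont (fun t => I2 (fun y => k (t, y))).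
Proof.
move=> hk; rewrite /I2.
apply: (cont_RInt T (fun z : T * R => RInt (fun y => k (fst z, (snd z, y))) (-1) 1)); first lra.
apply: (cont_RInt _ (fun z : (T * R) * R => k (fst (fst z), (snd (fst z), snd z)))); first lra.
ctac.
Qed.

Lemma I2_RInt_swap (k : R * pt -> R) (a b : R) : a <= b -> cont k ->
  I2 (fun y => RInt (fun s => k (s, y)) a b) = RInt (fun s => I2 (fun y => k (s, y))) a b.
Proof.
move=> hab hk; rewrite /I2.
rewrite -(Fubini_RInt (fun z : pt => RInt (fun y2 => k (snd z, (fst z, y2))) (-1) 1) (-1) 1 a b) //; try lra.
  apply: (cont_RInt _ (fun z : pt * R => k (snd (fst z), (fst (fst z), snd z)))); first lra.
  ctac.
apply: RInt_ext => y1 _.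
rewrite -(Fubini_RInt (fun z : pt => k (snd z, (y1, fst z))) (-1) 1 a b) //; try lra.
ctac.
Qed.

Lemma I2_swap (k : pt * pt -> R) : cont k ->
  I2 (fun x => I2 (fun y => k (x, y))) = I2 (fun y => I2 (fun x => k (x, y))).
Proof.
move=> hk; rewrite {1}/I2.
have e1 : forall x1, RInt (fun x2 => I2 (fun y => k ((x1, x2), y))) (-1) 1 =
   I2 (fun y => RInt (fun x2 => k ((x1, x2), y)) (-1) 1).
  move=> x1; symmetry.
  apply: (I2_RInt_swap (fun z : R * pt => k ((x1, fst z), snd z))); first lra; ctac.
rewrite (RInt_ext _ _ _ _ (fun x _ => e1 x)).
symmetry.
apply: (I2_RInt_swap (fun z : R * pt => RInt (fun x2 => k ((fst z, x2), snd z)) (-1) 1)); first lra.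
apply: (cont_RInt _ (fun z : (R * pt) * R => k ((fst (fst z), snd z), snd (fst z)))); first lra.
ctac.
Qed.

(** Near [s0] the integral is a constant plus the integral over [[s0 - 1, s]] of [I2] of [dk], by
    the fundamental theorem in [s] and an exchange of integrals. Differentiation under the integral
    sign is then the fundamental theorem again. *)
Lemma is_derive_I2 (k dk : R * pt -> R) (s0 : R) : cont k -> cont dk ->
  (forall s y, is_derive (fun s => k (s, y)) s (dk (s, y))) ->
  is_derive (fun s => I2 (fun y => k (s, y))) s0 (I2 (fun y => dk (s0, y))).
Proof.
move=> hk hdk hd.
have hI : cont (fun s => I2 (fun y => dk (s, y))) by apply: cont_I2.
pose a := s0 - 1.
apply: (is_derive_ext_loc (fun s => I2 (fun y => k (a, y)) + RInt (fun r => I2 (fun y => dk (r, y))) a s)).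
  have p1 : 0 < 1 by lra.
  exists (mkposreal 1 p1) => s; rewrite /ball /= /AbsRing_ball /abs /minus /plus /opp /= => /Rabs_lt_between hs.
  have has : a <= s by rewrite /a; lra.
  rewrite -I2_RInt_swap // -I2_plus.
  - by apply: cont_slice2.
  - apply: (cont_RInt _ (fun z : pt * R => dk (snd z, fst z))) => //; ctac.
  apply: I2_ext => y _.
  rewrite (RInt_FTC (fun s => k (s, y))) //; last by ring.
  move=> x _; suff : cont (fun s => dk (s, y)) by apply. ctac.
have -> : I2 (fun y => dk (s0, y)) = plus zero (I2 (fun y => dk (s0, y))) by rewrite plus_zero_l.
apply: (is_derive_plus (V := R_NormedModule)); first exact: is_derive_const.
apply: (is_derive_RInt (fun r => I2 (fun y => dk (r, y))) _ a); last exact: hI.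
apply: filter_forall => s; apply: RInt_correct; exact: ex_RInt_cont.
Qed.

Lemma RInt_pos_at (f : R -> R) (a b x : R) : a < b -> cont f ->
  (forall y, a <= y <= b -> 0 <= f y) -> a < x < b -> 0 < f x -> 0 < RInt f a b.
Proof.
move=> hab hf h0 hx hp.
have := hf x => /filterlim_locally /(_ (mkposreal _ hp)) [d hd].
pose c := Rmax a (x - d/2); pose e := Rmin b (x + d/2).
have dp := cond_pos d.
have h1 : a <= c /\ x - d/2 <= c /\ c < x.
  rewrite /c; split; [exact: Rmax_l | split; [exact: Rmax_r|]]; apply: Rmax_lub_lt; lra.
have h2 : e <= b /\ e <= x + d/2 /\ x < e.
  rewrite /e; split; [exact: Rmin_l | split; [exact: Rmin_r|]]; apply: Rmin_glb_lt; lra.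
rewrite (RInt_split f a c b) // (RInt_split f c e b) //.
have ge0 : forall u v, a <= u <= v -> v <= b -> 0 <= RInt f u v.
  move=> u v h3 h4; apply: RInt_ge_0; [lra | exact: ex_RInt_cont | move=> y hy; apply: h0; lra].
have q1 := ge0 a c ltac:(lra) ltac:(lra); have q2 := ge0 e b ltac:(lra) ltac:(lra).
have q3 : 0 < RInt f c e.
  apply: RInt_gt_0; first lra; last by move=> y _; exact: hf.
  move=> y hy; have := hd y; rewrite /ball /= /AbsRing_ball /abs /minus /plus /opp /= => hh.
  have : Rabs (y + - x) < d by apply: Rabs_def1; lra.
  move=> /hh /Rabs_lt_between; lra.
lra.
Qed.

Lemma I2_pos_at (F : pt -> R) (z : pt) : cont F -> (forall z, inQ z -> 0 <= F z) ->
  -1 < fst z < 1 -> -1 < snd z < 1 -> 0 < F z -> 0 < I2 F.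
Proof.
move=> hF h0 h1 h2 hp; rewrite /I2.
apply: (RInt_pos_at _ _ _ (fst z)) => //; try lra.
- exact: cont_inner.
- move=> x hx; apply: RInt_ge_0; try lra; first by apply: ex_RInt_cont; exact: cont_slice.
  move=> y hy; apply: h0; split => /=; lra.
apply: (RInt_pos_at _ _ _ (snd z)) => //; try lra.
- exact: cont_slice.
- move=> y hy; apply: h0; split => /=; lra.
by case: z h1 h2 hp.
Qed.

(** * Integrals of singular kernels *)

Lemma exp_le (x y : R) : x <= y -> exp x <= exp y.
Proof. case=> [h|->]; [apply: Rlt_le; exact: exp_increasing | exact: Rle_refl]. Qed.

Lemma Rpower_pos (x a : R) : 0 < Rpower x a.
Proof. exact: exp_pos. Qed.

Lemma is_derive_Rpower (a t : R) : 0 < t -> is_derive (fun t => Rpower t a) t (a * Rpower t (a - 1)).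
Proof. move=> ht; apply/is_derive_Reals; exact: derivable_pt_lim_power. Qed.

Lemma Rpower_decr (x y a : R) : 0 < x -> x <= y -> 0 <= a -> Rpower y (- a) <= Rpower x (- a).
Proof.
move=> hx hxy ha; rewrite !Rpower_Ropp; apply: Rinv_le_contravar; first exact: Rpower_pos.
exact: Rle_Rpower_l.
Qed.

Lemma Rpower_inv_sqr (x a : R) : 0 < x -> Rpower (x * x) a = Rpower x (2 * a).
Proof.
by move=> hx; rewrite -Rpower_mult_distr // -Rpower_plus; congr Rpower; ring.
Qed.

(** On each side of [x] the primitive is the power [eta] divided by [eta], and the base never
    exceeds 3; each side gives at most [3 / eta]. The bound does not depend on the regularisation
    [d]. *)
Lemma sing1 (x d eta : R) : -1 <= x <= 1 -> 0 < d <= 1 -> 0 < eta <= 1 ->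
  RInt (fun t => Rpower (Rabs (x - t) + d) (- (1 - eta))) (-1) 1 <= 6 / eta.
Proof.
move=> hx hd he.
have hc : cont (fun t => Rpower (Rabs (x - t) + d) (- (1 - eta))).
  ctac. move=> t; have := Rabs_pos (x - t); lra.
have P3 : forall s, 0 < s <= 3 -> Rpower s eta <= 3.
  move=> s hs; apply: (Rle_trans _ (Rpower 3 eta)); first by apply: Rle_Rpower_l; lra.
  rewrite -{2}(Rpower_1 3); first lra. apply: Rle_Rpower; lra.
have ct : forall (f : R -> R) t, cont f -> 0 < f t -> continuous (fun t => Rpower (f t) (eta - 1)) t.
  move=> f t cf hf; apply: (continuous_comp f (fun s => Rpower s (eta - 1))); first exact: cf.
  apply: (ex_derive_continuous (V := R_NormedModule)); eexists; exact: is_derive_Rpower.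
have dv : forall (f : R -> R) (c t : R), is_derive f t c -> 0 < f t ->
    is_derive (fun t => c * / eta * Rpower (f t) eta) t (c * c * Rpower (f t) (eta - 1)).
  move=> f c t hf hp; evar_last.
    apply: is_derive_scal; apply: (is_derive_comp (fun s => Rpower s eta) f); [exact: is_derive_Rpower | exact: hf].
  rewrite /scal /= /mult /=; field; lra.
have fin : forall A B, 0 < A -> B <= 3 -> / eta * B - / eta * A <= 3 / eta.
  move=> A B hA hB; have ie : 0 < / eta by apply: Rinv_0_lt_compat; lra.
  rewrite /Rdiv; nra.
rewrite (RInt_split _ (-1) x 1 hc).
have -> : 6 / eta = 3 / eta + 3 / eta by field; lra.
apply: Rplus_le_compat.
- rewrite (RInt_ext_le _ (fun t => -1 * -1 * Rpower (x - t + d) (eta - 1))); first lra.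
    move=> t ht; rewrite Rabs_right; first lra.
    have -> : - (1 - eta) = eta - 1 by ring. ring.
  rewrite (RInt_FTC (fun t => -1 * / eta * Rpower (x - t + d) eta)); first lra.
  + move=> t ht; apply: (dv (fun t => x - t + d)); last lra. auto_derive => //; ring.
  + move=> t ht; apply: (continuous_mult (K := R_AbsRing)); first exact: continuous_const.
    apply: (ct (fun t => x - t + d)); [ctac | lra].
  have := fin _ _ (Rpower_pos (x - x + d) eta) (P3 (x - -1 + d) ltac:(lra)); lra.
- rewrite (RInt_ext_le _ (fun t => 1 * 1 * Rpower (t - x + d) (eta - 1))); first lra.
    move=> t ht; rewrite Rabs_left; first lra.
    have -> : - (1 - eta) = eta - 1 by ring. rewrite !Rmult_1_l; congr Rpower; ring.
  rewrite (RInt_FTC (fun t => 1 * / eta * Rpower (t - x + d) eta)); first lra.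
  + move=> t ht; apply: (dv (fun t => t - x + d)); last lra. auto_derive => //; ring.
  + move=> t ht; apply: (continuous_mult (K := R_AbsRing)); first exact: continuous_const.
    apply: (ct (fun t => t - x + d)); [ctac | lra].
  have := fin _ _ (Rpower_pos (x - x + d) eta) (P3 (1 - x + d) ltac:(lra)); lra.
Qed.

Definition q2 (z : pt) : R := fst z ^ 2 + snd z ^ 2.
Definition rho2 (x y : pt) : R := (fst x - fst y) ^ 2 + (snd x - snd y) ^ 2.
(* [DD x y = |x|^2 |x* - y|^2], where [x*] is the image of [x] under inversion in the unit circle. *)
Definition DD (x y : pt) : R := 1 - 2 * (fst x * fst y + snd x * snd y) + q2 x * q2 y.

Lemma q2_ge0 (z : pt) : 0 <= q2 z. Proof. rewrite /q2; nra. Qed.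
Lemma rho2_ge0 (x y : pt) : 0 <= rho2 x y. Proof. rewrite /rho2; apply: Rplus_le_le_0_compat; exact: pow2_ge_0. Qed.
Lemma DDrho (x y : pt) : DD x y = rho2 x y + (1 - q2 x) * (1 - q2 y).
Proof. rewrite /DD /rho2 /q2; ring. Qed.
Lemma DD_ge0 (x y : pt) : 0 <= DD x y.
Proof.
have -> : DD x y = (1 - (fst x * fst y + snd x * snd y)) ^ 2 + (fst x * snd y - snd x * fst y) ^ 2.
  rewrite /DD /q2; ring.
apply: Rplus_le_le_0_compat; exact: pow2_ge_0.
Qed.
Lemma rho2_sym x y : rho2 x y = rho2 y x. Proof. rewrite /rho2; ring. Qed.
Lemma DD_sym x y : DD x y = DD y x. Proof. rewrite /DD; ring. Qed.

Lemma q2_inQ z : q2 z <= 1 -> inQ z.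
Proof. rewrite /q2 /inQ => h; have h1 := pow2_ge_0 (fst z); have h2 := pow2_ge_0 (snd z); repeat split; nra. Qed.

(** From [s^2 + d^2 >= (s + d)^2 / 2]; the factor 2 absorbs [2^((1 - eta) / 2)]. *)
Lemma sing_factor (x t d eta : R) : 0 < d -> 0 < eta <= 1 ->
  Rpower ((x - t) ^ 2 + d ^ 2) (- (1 - eta) / 2) <= 2 * Rpower (Rabs (x - t) + d) (- (1 - eta)).
Proof.
move=> hd he.
set s := Rabs (x - t).
have hs : 0 <= s by exact: Rabs_pos.
have -> : (x - t) ^ 2 = s ^ 2 by rewrite /s pow2_abs.
have h1 : / 2 * ((s + d) * (s + d)) <= s ^ 2 + d ^ 2 by have := pow2_ge_0 (s - d); lra.
have h0 : 0 < / 2 * ((s + d) * (s + d)) by nra.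
have -> : - (1 - eta) / 2 = - ((1 - eta) / 2) by field.
apply: Rle_trans.
  apply: Rpower_decr h1 _ => //; lra.
rewrite -Rpower_mult_distr; [lra|nra|].
rewrite Rpower_inv_sqr; first lra.
have -> : 2 * - ((1 - eta) / 2) = - (1 - eta) by field.
apply: Rmult_le_compat_r; first by apply: Rlt_le; exact: Rpower_pos.
have -> : Rpower (/ 2) (- ((1 - eta) / 2)) = Rpower 2 ((1 - eta) / 2).
  by rewrite /Rpower ln_Rinv; [lra|congr exp; ring].
rewrite -{3}(Rpower_1 2); first lra. apply: Rle_Rpower; lra.
Qed.

Lemma cont_rho2e (x : pt) (e a : R) : 0 < e -> cont (fun y => Rpower (rho2 x y + e) a).
Proof.
move=> he; rewrite /rho2; ctac => y; have := rho2_ge0 x y; rewrite /rho2; lra.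
Qed.

Definition Csing (eta : R) : R := (12 / eta) * (12 / eta).

Lemma Csing_pos eta : 0 < eta -> 0 < Csing eta.
Proof. move=> h; rewrite /Csing; have : 0 < 12 / eta by apply: Rdiv_lt_0_compat; lra. nra. Qed.

(** Sharing [e] equally between the coordinates gives [rho2 + e = A + B], with [A] and [B] each
    depending on one coordinate of [y]. Since [(A + B)^2 >= A B], the integrand is at most a product
    of two one-dimensional singular functions. Uniformity in [e] is what makes the bound survive the
    limit [e -> 0]. *)
Lemma sing_bound (x : pt) (e eta : R) : inQ x -> 0 < e <= 1 -> 0 < eta <= 1 ->
  I2 (fun y => Rpower (rho2 x y + e) (- (1 - eta))) <= Csing eta.
Proof.
move=> [hx1 hx2] he het.
pose d := sqrt (e / 2).
have hd : 0 < d by apply: sqrt_lt_R0; lra.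
have hd2 : d * d = e / 2 by apply: sqrt_sqrt; lra.
have hd1 : d <= 1 by nra.
pose g (x t : R) := 2 * Rpower (Rabs (x - t) + d) (- (1 - eta)).
have hg : forall x, cont (g x).
  move=> z; rewrite /g; ctac. move=> t; have := Rabs_pos (z - t); lra.
have hgp : forall x t, 0 < g x t by move=> u t; rewrite /g; have := Rpower_pos (Rabs (u - t) + d) (- (1 - eta)); lra.
have hI : forall x, -1 <= x <= 1 -> RInt (g x) (-1) 1 <= 12 / eta.
  move=> u hu; rewrite /g.
  rewrite (RInt_scal (V := R_CompleteNormedModule) (fun t => Rpower (Rabs (u - t) + d) (- (1 - eta))) (-1) 1 2).
    apply: ex_RInt_cont; ctac => t; have := Rabs_pos (u - t); lra.
  have := sing1 u d eta hu (conj hd hd1) het.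
  rewrite /scal /= /mult /=; lra.
have h0 : forall x, 0 <= RInt (g x) (-1) 1.
  move=> u; apply: RInt_ge_0; first lra; first exact: ex_RInt_cont.
  move=> t _; apply: Rlt_le; exact: hgp.
apply: (Rle_trans _ (I2 (fun y => g (fst x) (fst y) * g (snd x) (snd y)))).
  apply: I2_le.
  - apply: cont_rho2e; lra.
  - have h1 := hg (fst x); have h2 := hg (snd x).
    apply: cont_mult; [apply: (cont_comp _ _ fst) | apply: (cont_comp _ _ snd)] => // z; cproj.
  move=> y _.
  set A := (fst x - fst y) ^ 2 + d ^ 2; set B := (snd x - snd y) ^ 2 + d ^ 2.
  have hA : 0 < A by rewrite /A; have := pow2_ge_0 (fst x - fst y); nra.
  have hB : 0 < B by rewrite /B; have := pow2_ge_0 (snd x - snd y); nra.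
  have hAB : rho2 x y + e = A + B by rewrite /A /B /rho2; lra.
  have hdec : Rpower (A + B) (- (1 - eta)) <= Rpower A (- (1 - eta) / 2) * Rpower B (- (1 - eta) / 2).
    rewrite Rpower_mult_distr //.
    have -> : Rpower (A + B) (- (1 - eta)) = Rpower ((A + B) * (A + B)) (- (1 - eta) / 2).
      rewrite Rpower_inv_sqr; [lra|congr Rpower; field].
    have -> : - (1 - eta) / 2 = - ((1 - eta) / 2) by field.
    apply: Rpower_decr; [nra | nra | lra].
  rewrite hAB; apply: Rle_trans hdec _.
  apply: Rmult_le_compat; try (apply: Rlt_le; exact: Rpower_pos); exact: sing_factor.
rewrite /I2 /=.
rewrite (RInt_ext _ (fun t => scal (RInt (g (snd x)) (-1) 1) (g (fst x) t))).
  move=> t _.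
  rewrite (RInt_scal (V := R_CompleteNormedModule) (g (snd x)) (-1) 1 (g (fst x) t)); first exact: ex_RInt_cont.
  rewrite /scal /= /mult /=; ring.
rewrite (RInt_scal (V := R_CompleteNormedModule)); first exact: ex_RInt_cont.
rewrite /scal /= /mult /= /Csing.
apply: Rmult_le_compat => //; exact: hI.
Qed.

(** * The Green kernel and its derivatives *)

(** Coordinates are indexed by booleans, [true] being the first, so that every statement on partial
    derivatives is proved once for both. *)
Definition co (i : bool) (z : pt) : R := if i then fst z else snd z.
Definition upc (i : bool) (z : pt) (t : R) : pt := if i then (t, snd z) else (fst z, t).
Definition pd (i : bool) (F : pt -> R) (x : pt) (l : R) : Prop :=
  is_derive (fun t => F (upc i x t)) (co i x) l.

Lemma up_co i x : upc i x (co i x) = x. Proof. by case: i; case: x. Qed.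

(* [D = false] gives the free kernel [|x - y|^2], [D = true] its reflected companion; both have the shape [a - 2 x.y + m |x|^2] with [a * m = |y|^2], so one computation serves the two. *)
Definition kq (D : bool) (x y : pt) : R := if D then DD x y else rho2 x y.
Definition km (D : bool) (y : pt) : R := if D then q2 y else 1.
Definition kw (D i : bool) (x y : pt) : R := km D y * co i x - co i y.

Lemma kq_ge0 D x y : 0 <= kq D x y.
Proof. case: D; [exact: DD_ge0 | exact: rho2_ge0]. Qed.

Lemma kq_rho D x y : q2 x <= 1 -> q2 y <= 1 -> rho2 x y <= kq D x y.
Proof. case: D => hx hy /=; [rewrite DDrho; nra | lra]. Qed.

Lemma km_01 D y : q2 y <= 1 -> 0 <= km D y <= 1.
Proof. case: D => hy /=; [have := q2_ge0 y; lra | lra]. Qed.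

(** [kw] is half the gradient of [kq] in [x], so this is an eikonal identity. It bounds the
    derivatives of [ln kq], and it makes the Laplacian of [ln (kq + e)] equal to
    [4 km e / (kq + e)^2], which vanishes with [e] away from the singularity. *)
Lemma kw_sq D x y : kw D true x y ^ 2 + kw D false x y ^ 2 = km D y * kq D x y.
Proof. case: D; rewrite /kw /km /kq /co /DD /rho2 /q2; ring. Qed.

Lemma kw_sq_le D i x y : q2 y <= 1 -> kw D i x y ^ 2 <= kq D x y.
Proof.
move=> hy; have h := kw_sq D x y; have h1 := km_01 D y hy; have h2 := kq_ge0 D x y.
have h3 := pow2_ge_0 (kw D true x y); have h4 := pow2_ge_0 (kw D false x y).
case: i; nra.
Qed.

Lemma cont_co (T : UniformSpace) i (f : T -> pt) : (forall z, continuous f z) -> cont (fun z => co i (f z)).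
Proof.
move=> hf; case: i => z /=.
  apply: (continuous_comp f fst); [exact: hf | exact: continuous_fst].
apply: (continuous_comp f snd); [exact: hf | exact: continuous_snd].
Qed.

Lemma cont_kq (T : UniformSpace) D (f g : T -> pt) : (forall z, continuous f z) -> (forall z, continuous g z) ->
  cont (fun z => kq D (f z) (g z)).
Proof.
move=> hf hg.
have h1 := cont_co T true f hf; have h2 := cont_co T false f hf.
have h3 := cont_co T true g hg; have h4 := cont_co T false g hg.
rewrite /co in h1 h2 h3 h4.
case: D; rewrite /kq /DD /rho2 /q2; ctac.
Qed.

Lemma cont_km (T : UniformSpace) D (g : T -> pt) : (forall z, continuous g z) -> cont (fun z => km D (g z)).
Proof.
move=> hg; have h3 := cont_co T true g hg; have h4 := cont_co T false g hg.
rewrite /co in h3 h4; case: D; rewrite /km /q2; ctac.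
Qed.

Lemma cont_kw (T : UniformSpace) D i (f g : T -> pt) : (forall z, continuous f z) -> (forall z, continuous g z) ->
  cont (fun z => kw D i (f z) (g z)).
Proof.
move=> hf hg; rewrite /kw; apply: cont_minus; last exact: cont_co.
apply: cont_mult; [exact: cont_km | exact: cont_co].
Qed.

(** [k0], [k1], [k2] are the regularised logarithmic kernel, its gradient and its Hessian in [x].
    For [e > 0] they are continuous everywhere, so the potentials [L0], [L1], [L2] built on them are
    differentiated under the integral. *)
Definition k0 D e x y := ln (kq D x y + e).
Definition k1 D e i x y := 2 * kw D i x y / (kq D x y + e).
Definition k2 D e i j x y :=
  2 * (if Bool.eqb i j then km D y else 0) / (kq D x y + e)
  - 4 * (kw D i x y * kw D j x y) / (kq D x y + e) ^ 2.

Lemma kqe_pos D e x y : 0 < e -> 0 < kq D x y + e.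
Proof. move=> he; have := kq_ge0 D x y; lra. Qed.

Lemma cont_k0 (T : UniformSpace) D e (f g : T -> pt) : 0 < e -> (forall z, continuous f z) -> (forall z, continuous g z) ->
  cont (fun z => k0 D e (f z) (g z)).
Proof.
move=> he hf hg; rewrite /k0; apply: cont_ln; last by move=> z; exact: kqe_pos.
apply: cont_plus; [exact: cont_kq | exact: cont_const].
Qed.

Lemma cont_kqe (T : UniformSpace) D e (f g : T -> pt) : (forall z, continuous f z) -> (forall z, continuous g z) ->
  cont (fun z => kq D (f z) (g z) + e).
Proof. move=> hf hg; apply: cont_plus; [exact: cont_kq | exact: cont_const]. Qed.

Lemma cont_k1 (T : UniformSpace) D e i (f g : T -> pt) : 0 < e -> (forall z, continuous f z) -> (forall z, continuous g z) ->
  cont (fun z => k1 D e i (f z) (g z)).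
Proof.
move=> he hf hg; rewrite /k1; apply: cont_div; last by move=> z; exact: kqe_pos.
  apply: cont_mult; [exact: cont_const | exact: cont_kw].
exact: cont_kqe.
Qed.

Lemma cont_k2 (T : UniformSpace) D e i j (f g : T -> pt) : 0 < e -> (forall z, continuous f z) -> (forall z, continuous g z) ->
  cont (fun z => k2 D e i j (f z) (g z)).
Proof.
move=> he hf hg; rewrite /k2; apply: cont_minus; apply: cont_div.
- apply: cont_mult; first exact: cont_const.
  case: (Bool.eqb i j); [exact: cont_km | exact: cont_const].
- exact: cont_kqe.
- by move=> z; exact: kqe_pos.
- apply: cont_mult; [exact: cont_const | apply: cont_mult; exact: cont_kw].
- apply: cont_pow; exact: cont_kqe.
- by move=> z; apply: pow_lt; exact: kqe_pos.
Qed.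

Lemma pd_kq D i x y : pd i (fun x => kq D x y) x (2 * kw D i x y).
Proof.
rewrite /pd; case: D; case: i; rewrite /kq /kw /km /co /upc /DD /rho2 /q2 /=; auto_derive => //; ring.
Qed.

Lemma pd_kw D i j x y : pd j (fun x => kw D i x y) x (if Bool.eqb i j then km D y else 0).
Proof.
by rewrite /pd; case: D; case: i; case: j; rewrite /kw /km /co /upc /q2 /=; auto_derive => //; ring.
Qed.

Lemma pd_k0 D e i x y : 0 < e -> pd i (fun x => k0 D e x y) x (k1 D e i x y).
Proof.
move=> he; have hp := kqe_pos D e x y he.
have h := pd_kq D i x y; rewrite /pd in h |- *.
rewrite /k0 /k1.
evar_last.
  apply: (is_derive_comp (fun t => ln t) (fun t => kq D (upc i x t) y + e)).
    rewrite up_co; apply: is_derive_ln; exact: hp.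
  apply: (is_derive_plus (V := R_NormedModule)); [exact: h | exact: is_derive_const].
rewrite /scal /plus /zero /= /mult /=; field; lra.
Qed.

Lemma pd_k1 D e i j x y : 0 < e -> pd j (fun x => k1 D e i x y) x (k2 D e i j x y).
Proof.
move=> he; have hp := kqe_pos D e x y he.
have h := pd_kq D j x y; have h1 := pd_kw D i j x y; rewrite /pd in h h1 |- *.
rewrite /k1 /k2.
evar_last.
  apply: (is_derive_div (fun t => 2 * kw D i (upc j x t) y) (fun t => kq D (upc j x t) y + e)).
  - apply: is_derive_scal; exact: h1.
  - apply: (is_derive_plus (V := R_NormedModule)); [exact: h | exact: is_derive_const].
  - rewrite up_co; lra.
rewrite /scal /plus /zero /= /mult /= !up_co; field; lra.
Qed.

Definition L0 D e f x := I2 (fun y => k0 D e x y * f y).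
Definition L1 D e f i x := I2 (fun y => k1 D e i x y * f y).
Definition L2 D e f i j x := I2 (fun y => k2 D e i j x y * f y).

Lemma cont_up (T : UniformSpace) (x : pt) j (f : T -> R) : cont f -> forall z, continuous (fun s => upc j x (f s)) z.
Proof.
move=> hf z; case: j; apply: continuous_pair; try exact: continuous_const; exact: hf.
Qed.

Lemma cont_snd_f (T U : UniformSpace) (f : U -> R) : cont f -> cont (fun z : T * U => f (snd z)).
Proof. move=> hf; apply: (cont_comp _ _ snd) => // z; exact: continuous_snd. Qed.

Lemma cont_L0 D e f : 0 < e -> cont f -> cont (L0 D e f).
Proof.
move=> he hf; apply: (cont_I2 _ (fun z => k0 D e (fst z) (snd z) * f (snd z))).
apply: cont_mult; last exact: cont_snd_f.
apply: cont_k0 => // z; [exact: continuous_fst | exact: continuous_snd].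
Qed.

Lemma cont_L1 D e f i : 0 < e -> cont f -> cont (L1 D e f i).
Proof.
move=> he hf; apply: (cont_I2 _ (fun z => k1 D e i (fst z) (snd z) * f (snd z))).
apply: cont_mult; last exact: cont_snd_f.
apply: cont_k1 => // z; [exact: continuous_fst | exact: continuous_snd].
Qed.

Lemma cont_L2 D e f i j : 0 < e -> cont f -> cont (L2 D e f i j).
Proof.
move=> he hf; apply: (cont_I2 _ (fun z => k2 D e i j (fst z) (snd z) * f (snd z))).
apply: cont_mult; last exact: cont_snd_f.
apply: cont_k2 => // z; [exact: continuous_fst | exact: continuous_snd].
Qed.

Lemma up_up j x s t : upc j (upc j x s) t = upc j x t.
Proof. by case: j. Qed.
Lemma co_up j x s : co j (upc j x s) = s.
Proof. by case: j. Qed.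

Lemma pd_line j F x s l : pd j F (upc j x s) l -> is_derive (fun t => F (upc j x t)) s l.
Proof. by rewrite /pd co_up; apply: is_derive_ext => t; rewrite up_up. Qed.

Lemma pd_mulr j F x l c : pd j F x l -> pd j (fun x => F x * c) x (l * c).
Proof.
move=> h; rewrite /pd; apply: (is_derive_ext (fun t => scal c (F (upc j x t)))).
  by move=> t; rewrite /scal /= /mult /= Rmult_comm.
rewrite Rmult_comm; exact: is_derive_scal.
Qed.

Lemma pd_L0 D e f i x : 0 < e -> cont f -> pd i (L0 D e f) x (L1 D e f i x).
Proof.
move=> he hf; rewrite /pd /L0 /L1.
have -> : I2 (fun y => k1 D e i x y * f y) = I2 (fun y => k1 D e i (upc i x (co i x)) y * f y) by rewrite up_co.
apply: (is_derive_I2 (fun z : R * pt => k0 D e (upc i x (fst z)) (snd z) * f (snd z))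
   (fun z : R * pt => k1 D e i (upc i x (fst z)) (snd z) * f (snd z))).
- apply: cont_mult; last exact: cont_snd_f.
  apply: cont_k0 => // z; [apply: cont_up => ?; exact: continuous_fst | exact: continuous_snd].
- apply: cont_mult; last exact: cont_snd_f.
  apply: cont_k1 => // z; [apply: cont_up => ?; exact: continuous_fst | exact: continuous_snd].
move=> s y /=; apply: (pd_line i (fun x => k0 D e x y * f y)); apply: pd_mulr; exact: pd_k0.
Qed.

Lemma pd_L1 D e f i j x : 0 < e -> cont f -> pd j (L1 D e f i) x (L2 D e f i j x).
Proof.
move=> he hf; rewrite /pd /L1 /L2.
have -> : I2 (fun y => k2 D e i j x y * f y) = I2 (fun y => k2 D e i j (upc j x (co j x)) y * f y) by rewrite up_co.
apply: (is_derive_I2 (fun z : R * pt => k1 D e i (upc j x (fst z)) (snd z) * f (snd z))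
   (fun z : R * pt => k2 D e i j (upc j x (fst z)) (snd z) * f (snd z))).
- apply: cont_mult; last exact: cont_snd_f.
  apply: cont_k1 => // z; [apply: cont_up => ?; exact: continuous_fst | exact: continuous_snd].
- apply: cont_mult; last exact: cont_snd_f.
  apply: cont_k2 => // z; [apply: cont_up => ?; exact: continuous_fst | exact: continuous_snd].
move=> s y /=; apply: (pd_line j (fun x => k1 D e i x y * f y)); apply: pd_mulr; exact: pd_k1.
Qed.

(** A number in [(0, 1]] is at most its power [th]. The choice of [th] trades a rate in [e] against
    a stronger singularity in [s']. *)
Lemma ratio_le (e s s' th : R) : 0 < e <= s -> 0 < s' <= s -> 0 <= th <= 1 ->
  e / s <= Rpower e th * Rpower s' (- th).
Proof.
move=> he hs ht.
have h0 : 0 < e / s by apply: Rdiv_lt_0_compat; lra.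
have h1 : e / s <= 1 by apply/Rle_div_l; lra.
have h2 : e / s <= Rpower (e / s) th.
  apply: (Rle_trans _ (Rpower (e / s) 1)); first by rewrite Rpower_1; lra.
  rewrite /Rpower; apply: exp_le.
  have hl : ln (e / s) <= 0 by rewrite -ln_1; apply: ln_le; lra.
  have := Rmult_le_pos (1 - th) (- ln (e / s)) ltac:(lra) ltac:(lra); lra.
apply: Rle_trans h2 _.
rewrite /Rdiv -Rpower_mult_distr; [lra|apply: Rinv_0_lt_compat; lra|].
apply: Rmult_le_compat_l; first by apply: Rlt_le; exact: Rpower_pos.
have -> : Rpower (/ s) th = Rpower s (- th) by rewrite /Rpower ln_Rinv; [lra | congr exp; ring].
apply: Rpower_decr; lra.
Qed.

Lemma ln_1p_sqr (t : R) : 0 <= t -> ln (1 + t * t) <= 2 * t.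
Proof.
move=> ht.
have h1 : ln (1 + t) <= t.
  have := exp_ineq1_le t => h. rewrite -{2}(ln_exp t). apply: ln_le; lra.
have h2 : ln (1 + t * t) <= ln ((1 + t) * (1 + t)) by apply: ln_le; nra.
rewrite ln_mult in h2; lra.
Qed.

Lemma Rpower_half_sqr (s : R) : 0 < s -> Rpower s (/ 2) * Rpower s (/ 2) = s.
Proof. move=> hs; rewrite -Rpower_plus; have -> : / 2 + / 2 = 1 by field. exact: Rpower_1. Qed.

(** [est0], [est1], [est2] compare kernel, gradient and Hessian at two regularisations, with
    [s = kq + e] and [s' = kq + e']. The first two give a power of [e] times an integrable power of
    [s']. The bound [e / s / s'] for the Hessian yields no rate with an integrable power; the
    missing power of [s'] comes from the Hoelder continuity of the source. *)
Lemma est0 (e s s' : R) : 0 < e -> 0 < s' <= s -> s - s' <= e ->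
  Rabs (ln s - ln s') <= 2 * (Rpower e (/ 2) * Rpower s' (- (1 - / 2))).
Proof.
move=> he hs hd.
have h0 : ln s' <= ln s by apply: ln_le; lra.
rewrite Rabs_right; first lra.
set t := Rpower e (/ 2) * Rpower s' (- (1 - / 2)).
have ht : 0 < t by apply: Rmult_lt_0_compat; exact: Rpower_pos.
have htt : t * t = e / s'.
  have h1 := Rpower_half_sqr e he; have h2 := Rpower_half_sqr s' (proj1 hs).
  have e1 : - (1 - / 2) = - / 2 by field.
  have hp := Rpower_pos s' (/ 2).
  rewrite /t e1 Rpower_Ropp.
  have -> : e / s' = (Rpower e (/ 2) * Rpower e (/ 2)) / (Rpower s' (/ 2) * Rpower s' (/ 2)) by rewrite h1 h2.
  field; lra.
have -> : ln s - ln s' = ln (s / s') by rewrite ln_div; lra.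
have := ln_1p_sqr t (Rlt_le _ _ ht).
have : ln (s / s') <= ln (1 + t * t).
  apply: ln_le; first by apply: Rdiv_lt_0_compat; lra.
  rewrite htt; apply/Rle_div_l; first lra.
  have -> : (1 + e / s') * s' = s' + e by field; lra.
  lra.
lra.
Qed.

Lemma sq_le_Rabs (w s : R) : 0 < s -> w ^ 2 <= s -> Rabs w <= Rpower s (/ 2).
Proof.
move=> hs hw; have h := Rpower_half_sqr s hs; have hp := Rpower_pos s (/ 2).
have : Rabs w ^ 2 <= s by rewrite pow2_abs.
have := Rabs_pos w; nra.
Qed.

Lemma est1 (e s s' w : R) : 0 < e <= s -> 0 < s' <= s -> s - s' <= e -> w ^ 2 <= s' ->
  Rabs (2 * w / s - 2 * w / s') <= 2 * (Rpower e (/ 4) * Rpower s' (- (1 - / 4))).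
Proof.
move=> he hs hd hw.
have -> : 2 * w / s - 2 * w / s' = - (2 * w * ((s - s') / s / s')) by field; lra.
have h0 : 0 <= (s - s') / s / s'.
  apply: Rdiv_le_0_compat; last lra. apply: Rdiv_le_0_compat; lra.
rewrite Rabs_Ropp (Rabs_mult (2 * w)) (Rabs_mult 2 w) (Rabs_right _ (Rle_ge _ _ h0)) (Rabs_right 2); first lra.
rewrite Rmult_assoc; apply: Rmult_le_compat_l; first lra.
have h1 := sq_le_Rabs w s' (proj1 hs) hw.
have h2 := ratio_le e s s' (/ 4) he hs ltac:(lra).
have h3 : (s - s') / s <= e / s.
  apply: Rmult_le_compat_r => //; apply: Rlt_le; apply: Rinv_0_lt_compat; lra.
have is' : 0 < / s' by apply: Rinv_0_lt_compat; lra.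
apply: (Rle_trans _ (Rpower s' (/ 2) * ((Rpower e (/ 4) * Rpower s' (- / 4)) * / s'))).
  apply: Rmult_le_compat => //; first exact: Rabs_pos.
  apply: Rmult_le_compat_r; lra.
apply: Req_le.
have -> : / s' = Rpower s' (- 1) by rewrite Rpower_Ropp Rpower_1; lra.
have -> : Rpower s' (- (1 - / 4)) = Rpower s' (/ 2) * Rpower s' (- / 4) * Rpower s' (-1).
  by rewrite -!Rpower_plus; congr Rpower; field.
ring.
Qed.

Lemma est2 (e s s' w v b : R) : 0 < e -> 0 < s' <= s -> s - s' <= e -> w ^ 2 <= s' -> v ^ 2 <= s' ->
  0 <= b <= 1 ->
  Rabs ((2 * b / s - 4 * (w * v) / s ^ 2) - (2 * b / s' - 4 * (w * v) / s' ^ 2)) <= 10 * (e / s / s').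
Proof.
move=> he hs hd hw hv hb.
have -> : (2 * b / s - 4 * (w * v) / s ^ 2) - (2 * b / s' - 4 * (w * v) / s' ^ 2) =
  ((s - s') / s / s') * (4 * (w * v) * (s + s') / (s * s') - 2 * b) by field; lra.
have h0 : 0 <= (s - s') / s / s'.
  apply: Rdiv_le_0_compat; last lra. apply: Rdiv_le_0_compat; lra.
rewrite Rabs_mult (Rabs_right _ (Rle_ge _ _ h0)) Rmult_comm.
have h3 : (s - s') / s / s' <= e / s / s'.
  apply: Rmult_le_compat_r; first by apply: Rlt_le; apply: Rinv_0_lt_compat; lra.
  apply: Rmult_le_compat_r => //; apply: Rlt_le; apply: Rinv_0_lt_compat; lra.
have hwv : Rabs (w * v) <= s'.
  apply: Rabs_le; split; have := pow2_ge_0 (w - v); have := pow2_ge_0 (w + v); nra.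
have hX : Rabs (4 * (w * v) * (s + s') / (s * s') - 2 * b) <= 10.
  have h4 : Rabs (4 * (w * v) * (s + s') / (s * s')) <= 8.
    have hss : 0 < s * s' by nra.
    rewrite Rabs_div; first lra. rewrite (Rabs_right (s * s')); first lra.
    apply/Rle_div_l; first lra.
    rewrite (Rabs_mult _ (s + s')) (Rabs_mult 4) (Rabs_mult w) (Rabs_right 4); first lra. rewrite (Rabs_right (s + s')); first lra.
    have : Rabs w * Rabs v <= s' by rewrite -Rabs_mult.
    have := Rabs_pos w; have := Rabs_pos v; nra.
  have := Rabs_triang (4 * (w * v) * (s + s') / (s * s')) (- (2 * b)).
  rewrite Rabs_Ropp (Rabs_right (2 * b)); first lra.
  rewrite -/(Rminus _ _); lra.
apply: Rmult_le_compat => //; exact: Rabs_pos.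
Qed.

Lemma I2_sing (F : pt -> R) x e eta c : cont F -> inQ x -> 0 < e <= 1 -> 0 < eta <= 1 -> 
  (forall y, inQ y -> Rabs (F y) <= c * Rpower (rho2 x y + e) (- (1 - eta))) ->
  0 <= c -> Rabs (I2 F) <= c * Csing eta.
Proof.
move=> hF hx he het h hc.
apply: (Rle_trans _ (I2 (fun y => c * Rpower (rho2 x y + e) (- (1 - eta))))).
  apply: I2_abs_le => //; apply: cont_mult; [exact: cont_const | apply: cont_rho2e; lra].
rewrite I2_scal; first by apply: cont_rho2e; lra.
apply: Rmult_le_compat_l => //; exact: sing_bound.
Qed.

(** * Convergence of the regularized potentials *)

Definition srcf (f : pt -> R) (M : R) : Prop :=
  cont f /\ (forall y, 1 <= q2 y -> f y = 0) /\ (forall y, Rabs (f y) <= M).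

Lemma srcf_M0 f M : srcf f M -> 0 <= M.
Proof. move=> [_ [_ h]]; apply: Rle_trans (h (0,0)); exact: Rabs_pos. Qed.

Lemma cont_const_pt (x : pt) (T : UniformSpace) : forall z : T, continuous (fun _ => x) z.
Proof. move=> z; exact: continuous_const. Qed.
Lemma cont_id_pt : forall z : pt, continuous (fun y : pt => y) z.
Proof. move=> z; exact: continuous_id. Qed.

Lemma cont_k0s D e x : 0 < e -> cont (fun y => k0 D e x y).
Proof. move=> he; exact: (cont_k0 _ D e (fun _ => x) (fun y => y) he (cont_const_pt x _) cont_id_pt). Qed.
Lemma cont_k1s D e i x : 0 < e -> cont (fun y => k1 D e i x y).
Proof. move=> he; exact: (cont_k1 _ D e i (fun _ => x) (fun y => y) he (cont_const_pt x _) cont_id_pt). Qed.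
Lemma cont_k2s D e i j x : 0 < e -> cont (fun y => k2 D e i j x y).
Proof. move=> he; exact: (cont_k2 _ D e i j (fun _ => x) (fun y => y) he (cont_const_pt x _) cont_id_pt). Qed.

Lemma I2_diff_mul (K K' f : pt -> R) : cont K -> cont K' -> cont f ->
  I2 (fun y => K y * f y) - I2 (fun y => K' y * f y) = I2 (fun y => (K y - K' y) * f y).
Proof.
move=> h h' hf; rewrite -I2_minus; try exact: cont_mult.
by apply: I2_ext => y _; ring.
Qed.

Lemma sing_weaken D x y e s a : q2 x <= 1 -> q2 y <= 1 -> 0 < e -> s = kq D x y + e -> 0 <= a ->
  Rpower s (- a) <= Rpower (rho2 x y + e) (- a).
Proof.
move=> hx hy he -> ha; apply: Rpower_decr => //; first by have := rho2_ge0 x y; lra.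
have := kq_rho D x y hx hy; lra.
Qed.

Lemma mul_src_bound f M K B y : srcf f M -> (q2 y <= 1 -> Rabs K <= B) -> 0 <= B -> Rabs (K * f y) <= M * B.
Proof.
move=> hs h hB; have hM := srcf_M0 f M hs; case: hs => [_ [h0 hb]].
rewrite Rabs_mult.
case: (Rle_dec (q2 y) 1) => hy.
  rewrite Rmult_comm; apply: Rmult_le_compat => //; try exact: Rabs_pos. exact: h.
rewrite h0; first lra. rewrite Rabs_R0 Rmult_0_r; exact: Rmult_le_pos.
Qed.

Lemma L0_cauchy D f M x e e' : srcf f M -> q2 x <= 1 -> 0 < e' <= e -> e <= 1 ->
  Rabs (L0 D e f x - L0 D e' f x) <= 2 * M * Csing (/ 2) * Rpower e (/ 2).
Proof.
move=> hs hx he he1; have hM := srcf_M0 f M hs; have [hf _] := hs.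
rewrite /L0 I2_diff_mul //; try (apply: cont_k0s; lra).
have hp := Rpower_pos e (/ 2).
have -> : 2 * M * Csing (/ 2) * Rpower e (/ 2) = (M * (2 * Rpower e (/ 2))) * Csing (/ 2) by ring.
apply: (I2_sing _ x e' (/ 2)); try lra.
- apply: cont_mult => //; apply: cont_minus; apply: cont_k0s; lra.
- exact: q2_inQ.
- move=> y _; rewrite Rmult_assoc.
  have hp2 := Rpower_pos (rho2 x y + e') (- (1 - / 2)).
  apply: mul_src_bound => //; last by nra.
  move=> hy; rewrite /k0.
  have hk := kq_ge0 D x y.
  apply: Rle_trans (est0 e (kq D x y + e) (kq D x y + e') _ _ _) _; try lra.
  have := sing_weaken D x y e' _ (1 - / 2) hx hy (proj1 he) eq_refl ltac:(lra); nra.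
- nra.
Qed.

Lemma L1_cauchy D f M i x e e' : srcf f M -> q2 x <= 1 -> 0 < e' <= e -> e <= 1 ->
  Rabs (L1 D e f i x - L1 D e' f i x) <= 2 * M * Csing (/ 4) * Rpower e (/ 4).
Proof.
move=> hs hx he he1; have hM := srcf_M0 f M hs; have [hf _] := hs.
rewrite /L1 I2_diff_mul //; try (apply: cont_k1s; lra).
have hp := Rpower_pos e (/ 4).
have -> : 2 * M * Csing (/ 4) * Rpower e (/ 4) = (M * (2 * Rpower e (/ 4))) * Csing (/ 4) by ring.
apply: (I2_sing _ x e' (/ 4)); try lra.
- apply: cont_mult => //; apply: cont_minus; apply: cont_k1s; lra.
- exact: q2_inQ.
- move=> y _; rewrite Rmult_assoc.
  have hp2 := Rpower_pos (rho2 x y + e') (- (1 - / 4)).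
  apply: mul_src_bound => //; last by nra.
  move=> hy; rewrite /k1.
  have hk := kq_ge0 D x y.
  have hw := kw_sq_le D i x y hy.
  apply: Rle_trans (est1 e (kq D x y + e) (kq D x y + e') _ _ _ _ _) _; try lra.
  have := sing_weaken D x y e' _ (1 - / 4) hx hy (proj1 he) eq_refl ltac:(lra); nra.
- nra.
Qed.

(** [DD] is at least the square of [1 - x.y], and [2 x.y <= |x|^2 + |y|^2 <= 2 - d]. Hence the
    reflected kernel stays regular as long as [x] keeps away from the circle. *)
Lemma DD_lower x y d : 0 < d <= 1 -> q2 x <= 1 - d -> q2 y <= 1 -> d ^ 2 / 4 <= DD x y.
Proof.
move=> hd hx hy.
have -> : DD x y = (1 - (fst x * fst y + snd x * snd y)) ^ 2 + (fst x * snd y - snd x * fst y) ^ 2.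
  rewrite /DD /q2; ring.
have h : fst x * fst y + snd x * snd y <= 1 - d / 2.
  move: hx hy; rewrite /q2 => hx hy.
  have := pow2_ge_0 (fst x - fst y); have := pow2_ge_0 (snd x - snd y); nra.
have := pow2_ge_0 (fst x * snd y - snd x * fst y); nra.
Qed.

Lemma div2_bound e s s' q : 0 < e -> 0 < q -> q <= s -> q <= s' -> e / s / s' <= e / q / q.
Proof.
move=> he hq h h'.
have i1 : / s <= / q by apply: Rinv_le_contravar.
have i2 : / s' <= / q by apply: Rinv_le_contravar.
have p1 : 0 < / s by apply: Rinv_0_lt_compat; lra.
have p2 : 0 < / s' by apply: Rinv_0_lt_compat; lra.
rewrite /Rdiv; apply: Rmult_le_compat; try nra.
Qed.

Lemma L2t_cauchy f M i j x e e' d : srcf f M -> 0 < d <= 1 -> q2 x <= 1 - d -> 0 < e' <= e -> e <= 1 ->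
  Rabs (L2 true e f i j x - L2 true e' f i j x) <= (4 * (M * (10 * (1 / (d ^ 2 / 4) / (d ^ 2 / 4))))) * Rpower e 1.
Proof.
move=> hs hd hx he he1; have hM := srcf_M0 f M hs; have [hf _] := hs.
rewrite /L2 I2_diff_mul //; try (apply: cont_k2s; lra).
have hq : 0 < d ^ 2 / 4 by nra.
rewrite Rpower_1; first lra.
have -> : (4 * (M * (10 * (1 / (d ^ 2 / 4) / (d ^ 2 / 4))))) * e = 4 * (M * (10 * (e / (d ^ 2 / 4) / (d ^ 2 / 4)))).
  field; lra.
apply: I2_abs_const.
  apply: cont_mult => //; apply: cont_minus; apply: cont_k2s; lra.
move=> y _; apply: mul_src_bound => //.
  move=> hy; rewrite /k2 /=.
  have hD := DD_lower x y d hd hx hy.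
  have h1 := kw_sq_le true i x y hy; have h2 := kw_sq_le true j x y hy.
  have hb := km_01 true y hy.
  rewrite /= in h1 h2 hb.
  apply: Rle_trans (est2 e (DD x y + e) (DD x y + e') _ _ _ _ _ _ _ _ _) _; try lra.
    by case: Bool.eqb; lra.
  apply: Rmult_le_compat_l; first lra.
  apply: div2_bound; lra.
have : 0 <= e / (d ^ 2 / 4) / (d ^ 2 / 4).
  apply: Rdiv_le_0_compat => //; apply: Rdiv_le_0_compat => //; lra.
lra.
Qed.

(** In the free Hessian potential [f y] is written as [(f y - f x) + f x]; [cc] is the coefficient
    of [f x]. Integrating the Hessian kernel over the whole square, beyond the disc, allows an
    integration by parts that leaves only edge terms, and these are away from [x]. *)
Definition cc e i j x := I2 (fun y => k2 false e i j x y).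

(** [upc i (t, t) s] is the point whose coordinate [i] is [s] and whose other coordinate is [t]; for
    [s = 1] or [s = -1] it runs along an edge of the square. *)
Definition edge e i j x s t := k1 false e j x (upc i (t, t) s).

Lemma k1_anti e j x y : k1 false e j x y = - k1 false e j y x.
Proof.
rewrite /k1 /kw /km /kq rho2_sym /Rdiv; ring.
Qed.
Lemma k2_symm e i j x y : k2 false e i j x y = k2 false e j i y x.
Proof.
rewrite /k2 /kw /km /kq rho2_sym /Rdiv; case: i; case: j => /=; ring.
Qed.

(** The free kernel depends on [x - y] only, so its Hessian is an exact derivative in the
    integration variable [y]; this is what [cc_edge] integrates. *)
Lemma pd_k1y e i j x y : 0 < e -> pd i (fun y => k1 false e j x y) y (- k2 false e i j x y).
Proof.
move=> he; rewrite k2_symm /pd.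
apply: (is_derive_ext (fun t => opp (k1 false e j (upc i y t) x))).
  by move=> t; rewrite (k1_anti _ _ x).
apply: is_derive_opp; exact: pd_k1.
Qed.

Lemma RInt_k2_line e i j x y : 0 < e ->
  RInt (fun t => k2 false e i j x (upc i y t)) (-1) 1 =
  k1 false e j x (upc i y (-1)) - k1 false e j x (upc i y 1).
Proof.
move=> he.
rewrite (RInt_FTC (fun t => - k1 false e j x (upc i y t))); first lra.
- move=> t _.
  have h := pd_line i _ y t _ (pd_k1y e i j x (upc i y t) he).
  evar_last; first apply: is_derive_opp; first exact: h.
  by rewrite /opp /=; ring.
- move=> t _.
  have h : cont (fun t => k2 false e i j x (upc i y t)).
    apply: (cont_k2 _ false e i j (fun _ => x) (fun t => upc i y t)) => //.
      exact: cont_const_pt.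
    apply: cont_up; exact: cont_id.
  exact: h.
rewrite /=; ring.
Qed.

Lemma cont_edge e i j x s : 0 < e -> cont (edge e i j x s).
Proof.
move=> he; apply: (cont_k1 _ false e j (fun _ => x) (fun t => upc i (t, t) s)) => //.
  exact: cont_const_pt.
move=> z; case: i; rewrite /upc /=; apply: continuous_pair; try exact: continuous_const; exact: continuous_id.
Qed.

Lemma cc_edge e i j x : 0 < e ->
  cc e i j x = RInt (fun t => edge e i j x (-1) t - edge e i j x 1 t) (-1) 1.
Proof.
move=> he; rewrite /cc /I2; case: i.
- rewrite (Fubini_RInt (fun y => k2 false e true j x y)); try lra; first exact: cont_k2s.
  apply: RInt_ext => t _.
  exact: (RInt_k2_line e true j x (t, t) he).
- apply: RInt_ext => t _.
  exact: (RInt_k2_line e false j x (t, t) he).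
Qed.

Lemma co_bound i x d : 0 < d <= 1 -> q2 x <= 1 - d -> - (1 - d / 2) <= co i x <= 1 - d / 2.
Proof.
move=> hd; rewrite /q2 => hx.
have h : co i x ^ 2 <= 1 - d.
  case: i => /=; have := pow2_ge_0 (fst x); have := pow2_ge_0 (snd x) => /=; lra.
split; nra.
Qed.

Lemma edge_rho i x d s t : 0 < d <= 1 -> q2 x <= 1 - d -> s = 1 \/ s = -1 ->
  d ^ 2 / 4 <= rho2 x (upc i (t, t) s).
Proof.
move=> hd hx hs; have h := co_bound i x d hd hx.
have : d ^ 2 / 4 <= (co i x - s) ^ 2 by case: hs => ->; nra.
rewrite /rho2; case: i h => /= h.
  have := pow2_ge_0 (snd x - t); lra.
have := pow2_ge_0 (fst x - t); lra.
Qed.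

Lemma edge_cauchy i j x d s t e e' : 0 < d <= 1 -> q2 x <= 1 - d -> s = 1 \/ s = -1 -> -1 <= t <= 1 ->
  0 < e' <= e ->
  Rabs (edge e i j x s t - edge e' i j x s t) <= 4 * (e / (d ^ 2 / 4) / (d ^ 2 / 4)).
Proof.
move=> hd hx hs ht he.
have hr := edge_rho i x d s t hd hx hs.
have hq : 0 < d ^ 2 / 4 by nra.
rewrite /edge /k1 /kq; set y := upc i (t, t) s; rewrite -/y in hr.
set r := rho2 x y; rewrite -/r in hr.
have -> : 2 * kw false j x y / (r + e) - 2 * kw false j x y / (r + e') =
   - (2 * kw false j x y) * ((e - e') / (r + e) / (r + e')) by field; lra.
rewrite Rabs_mult Rabs_Ropp.
have h1 : Rabs (2 * kw false j x y) <= 4.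
  rewrite Rabs_mult Rabs_right; first lra.
  suff : Rabs (kw false j x y) <= 2 by lra.
  have h := co_bound j x d hd hx.
  have hy : -1 <= co j y <= 1 by rewrite /y; case: (j); case: (i); case: hs => -> /=; lra.
  rewrite /kw /km; apply: Rabs_le; lra.
have h2 : 0 <= (e - e') / (r + e) / (r + e').
  apply: Rdiv_le_0_compat; last lra. apply: Rdiv_le_0_compat; lra.
rewrite (Rabs_right _ (Rle_ge _ _ h2)).
apply: Rmult_le_compat => //; first exact: Rabs_pos.
apply: (Rle_trans _ (e / (r + e) / (r + e'))); last by apply: div2_bound; lra.
apply: Rmult_le_compat_r; first by apply: Rlt_le; apply: Rinv_0_lt_compat; lra.
apply: Rmult_le_compat_r; last lra. apply: Rlt_le; apply: Rinv_0_lt_compat; lra.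
Qed.

Lemma cc_cauchy i j x d e e' : 0 < d <= 1 -> q2 x <= 1 - d -> 0 < e' <= e ->
  Rabs (cc e i j x - cc e' i j x) <= 16 * (e / (d ^ 2 / 4) / (d ^ 2 / 4)).
Proof.
move=> hd hx he; rewrite !cc_edge; try lra.
have c1 : forall e s, 0 < e -> cont (edge e i j x s) by move=> *; exact: cont_edge.
have e1 : forall e, 0 < e -> ex_RInt (fun t => edge e i j x (-1) t - edge e i j x 1 t) (-1) 1.
  by move=> a ha; apply: ex_RInt_cont; apply: cont_minus; apply: cont_edge.
rewrite -RInt_minusR; try (apply: e1; lra).
have -> : 16 * (e / (d ^ 2 / 4) / (d ^ 2 / 4)) = (1 - -1) * (8 * (e / (d ^ 2 / 4) / (d ^ 2 / 4))) by ring.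
apply: abs_RInt_le_const; first lra.
  apply: ex_RInt_cont; apply: cont_minus; apply: cont_minus; apply: c1; lra.
move=> t ht.
have h1 := edge_cauchy i j x d (-1) t e e' hd hx (or_intror eq_refl) ht he.
have h2 := edge_cauchy i j x d 1 t e e' hd hx (or_introl eq_refl) ht he.
move: h1 h2 => /Rabs_le_between h1 /Rabs_le_between h2; apply: Rabs_le; lra.
Qed.

(* [Rpower 0 a] is junk, so Hoelder continuity is phrased with an upper bound [s > 0] of the squared distance. *)
Definition holder (f : pt -> R) (g H : R) : Prop :=
  forall x y s, q2 x < 1 -> inQ y -> 0 < s -> rho2 x y <= s -> Rabs (f y - f x) <= H * Rpower s (g / 2).

Lemma holder_H0 f g H : holder f g H -> 0 <= H.
Proof.
move=> h.
have h1 : Rabs (f (0,0) - f (0,0)) <= H * Rpower 1 (g / 2).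
  by apply: (h (0,0) (0,0)); rewrite /q2 /inQ /rho2 /=; lra.
have hp := Rpower_pos 1 (g / 2); have := Rabs_pos (f (0,0) - f (0,0)).
case: (Rle_dec 0 H) => // hn; nra.
Qed.

Definition M2 e f i j x := I2 (fun y => k2 false e i j x y * (f y - f x)).

Lemma L2f_split e f i j x : 0 < e -> cont f -> L2 false e f i j x = M2 e f i j x + f x * cc e i j x.
Proof.
move=> he hf; rewrite /L2 /M2 /cc -I2_scal; first exact: cont_k2s.
rewrite -I2_plus.
- apply: cont_mult; first exact: cont_k2s. apply: cont_minus => //; exact: cont_const.
- apply: cont_mult; [exact: cont_const | exact: cont_k2s].
by apply: I2_ext => y _; ring.
Qed.

(** Hoelder continuity contributes [s'^(g/2)] against the critical [s'^(-1)]. Half of this gain is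
    spent on the rate [e^(g/4)]; the other half leaves the integrable power [s'^(-(1 - g/4))]. *)
Lemma M2_cauchy f g H i j x e e' : cont f -> holder f g H -> 0 < g <= 1 -> q2 x < 1 -> 0 < e' <= e -> e <= 1 ->
  Rabs (M2 e f i j x - M2 e' f i j x) <= (10 * H * Csing (g / 4)) * Rpower e (g / 4).
Proof.
move=> hf hh hg hx he he1; have hH := holder_H0 f g H hh.
have cf : cont (fun y => f y - f x) by apply: cont_minus => //; exact: cont_const.
rewrite /M2 I2_diff_mul //; try (apply: cont_k2s; lra).
have hp := Rpower_pos e (g / 4).
have -> : (10 * H * Csing (g / 4)) * Rpower e (g / 4) = (10 * H * Rpower e (g / 4)) * Csing (g / 4) by ring.
apply: (I2_sing _ x e' (g / 4)); try lra.
- apply: cont_mult => //; apply: cont_minus; apply: cont_k2s; lra.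
- apply: q2_inQ; lra.
- move=> y hy.
  set s := rho2 x y + e; set s' := rho2 x y + e'.
  have hr := rho2_ge0 x y.
  have hs : 0 < s' <= s by rewrite /s /s'; lra.
  have hw : forall i, kw false i x y ^ 2 <= s'.
    move=> k; have := kw_sq false x y; rewrite /km /kq /s'.
    have h1 := pow2_ge_0 (kw false true x y); have h2 := pow2_ge_0 (kw false false x y).
    case: k; lra.
  have h1 : Rabs (k2 false e i j x y - k2 false e' i j x y) <= 10 * (e / s / s').
    rewrite /k2 /kq /km -/s -/s'; apply: est2 => //; try lra; try exact: hw.
      by rewrite /s /s'; lra.
    by case: Bool.eqb; lra.
  have h2 : Rabs (f y - f x) <= H * Rpower s' (g / 2) by apply: hh => //; rewrite /s'; lra.
  have h3 : e / s <= Rpower e (g / 4) * Rpower s' (- (g / 4)).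
    apply: ratio_le; rewrite /s /s'; lra.
  rewrite Rabs_mult.
  have is' : 0 < / s' by apply: Rinv_0_lt_compat; lra.
  apply: (Rle_trans _ ((10 * (Rpower e (g / 4) * Rpower s' (- (g / 4)) * / s')) * (H * Rpower s' (g / 2)))).
    apply: Rmult_le_compat => //; try exact: Rabs_pos.
    apply: Rle_trans h1 _; apply: Rmult_le_compat_l; first lra.
    apply: Rmult_le_compat_r; lra.
  apply: Req_le.
  have -> : / s' = Rpower s' (- 1) by rewrite Rpower_Ropp Rpower_1; lra.
  have -> : Rpower s' (- (1 - g / 4)) = Rpower s' (- (g / 4)) * Rpower s' (- 1) * Rpower s' (g / 2).
    by rewrite -!Rpower_plus; congr Rpower; field.
  ring.
- nra.
Qed.

(** By [kw_sq] the trace of the free Hessian kernel is [4 e / (rho2 + e)^2], an approximate point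
    mass at [x]; tested against [f y - f x] it tends to 0. *)
Lemma M2_trace f g H x e : cont f -> holder f g H -> 0 < g <= 1 -> q2 x < 1 -> 0 < e <= 1 ->
  Rabs (M2 e f true true x + M2 e f false false x) <= (4 * H * Csing (g / 4)) * Rpower e (g / 4).
Proof.
move=> hf hh hg hx he; have hH := holder_H0 f g H hh.
have cf : cont (fun y => f y - f x) by apply: cont_minus => //; exact: cont_const.
rewrite /M2 -I2_plus; try (apply: cont_mult => //; apply: cont_k2s; lra).
have hp := Rpower_pos e (g / 4).
have -> : (4 * H * Csing (g / 4)) * Rpower e (g / 4) = (4 * H * Rpower e (g / 4)) * Csing (g / 4) by ring.
apply: (I2_sing _ x e (g / 4)); try lra.
- apply: cont_plus; apply: cont_mult => //; apply: cont_k2s; lra.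
- apply: q2_inQ; lra.
- move=> y hy.
  set s := rho2 x y + e.
  have hr := rho2_ge0 x y.
  have hs : 0 < s by rewrite /s; lra.
  have -> : k2 false e true true x y * (f y - f x) + k2 false e false false x y * (f y - f x) =
     (4 * (e / s / s)) * (f y - f x).
    have hk := kw_sq false x y; rewrite /km /kq in hk.
    rewrite /k2 /kq /km /= -/s.
    have e1 : rho2 x y = s - e by rewrite /s; ring.
    have -> : e / s / s = (s - rho2 x y) / s / s by rewrite e1; field; lra.
    have -> : rho2 x y = kw false true x y ^ 2 + kw false false x y ^ 2 by lra.
    field; lra.
  have h2 : Rabs (f y - f x) <= H * Rpower s (g / 2) by apply: hh => //; rewrite /s; lra.
  have h3 : e / s <= Rpower e (g / 4) * Rpower s (- (g / 4)).
    apply: ratio_le; rewrite /s; lra.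
  have is' : 0 < / s by apply: Rinv_0_lt_compat; lra.
  have p1 : 0 <= e / s / s by apply: Rdiv_le_0_compat => //; apply: Rdiv_le_0_compat; lra.
  rewrite Rabs_mult (Rabs_right (4 * _)); first lra.
  apply: (Rle_trans _ ((4 * (Rpower e (g / 4) * Rpower s (- (g / 4)) * / s)) * (H * Rpower s (g / 2)))).
    apply: Rmult_le_compat => //; try exact: Rabs_pos; first lra.
    apply: Rmult_le_compat_l; first lra.
    apply: Rmult_le_compat_r; lra.
  apply: Req_le.
  have -> : / s = Rpower s (- 1) by rewrite Rpower_Ropp Rpower_1; lra.
  have -> : Rpower s (- (1 - g / 4)) = Rpower s (- (g / 4)) * Rpower s (- 1) * Rpower s (g / 2).
    by rewrite -!Rpower_plus; congr Rpower; field.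
  ring.
- nra.
Qed.

(** The reflected kernel is harmonic in the limit: its trace is [4 q2 y e / (DD + e)^2], with [DD]
    bounded below. *)
Lemma L2t_trace f M x e d : srcf f M -> 0 < d <= 1 -> q2 x <= 1 - d -> 0 < e ->
  Rabs (L2 true e f true true x + L2 true e f false false x) <= (4 * (M * (4 * (1 / (d ^ 2 / 4) / (d ^ 2 / 4))))) * e.
Proof.
move=> hs hd hx he; have hM := srcf_M0 f M hs; have [hf _] := hs.
have hq : 0 < d ^ 2 / 4 by nra.
rewrite /L2 -I2_plus; try (apply: cont_mult => //; apply: cont_k2s; lra).
have -> : (4 * (M * (4 * (1 / (d ^ 2 / 4) / (d ^ 2 / 4))))) * e = 4 * (M * (4 * (e / (d ^ 2 / 4) / (d ^ 2 / 4)))).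
  field; lra.
rewrite (I2_ext _ (fun y => (k2 true e true true x y + k2 true e false false x y) * f y)).
  by move=> y _; ring.
apply: I2_abs_const.
  apply: cont_mult => //; apply: cont_plus; apply: cont_k2s; lra.
move=> y _; apply: mul_src_bound => //.
  move=> hy.
  have hD := DD_lower x y d hd hx hy.
  have hk := kw_sq true x y; have hb := km_01 true y hy; rewrite /km /kq in hk hb.
  have -> : k2 true e true true x y + k2 true e false false x y = (4 * q2 y) * (e / (DD x y + e) / (DD x y + e)).
    rewrite /k2 /kq /km /=.
    have -> : (4 * q2 y) * (e / (DD x y + e) / (DD x y + e)) = 4 * (q2 y * (DD x y + e) - q2 y * DD x y) / (DD x y + e) ^ 2.
      field; lra.
    rewrite -hk; field; lra.
  have h1 : 0 <= e / (DD x y + e) / (DD x y + e).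
    apply: Rdiv_le_0_compat; last lra. apply: Rdiv_le_0_compat; lra.
  rewrite Rabs_right; first nra.
  apply: Rmult_le_compat; try lra. apply: div2_bound; lra.
have : 0 <= e / (d ^ 2 / 4) / (d ^ 2 / 4).
  apply: Rdiv_le_0_compat => //; apply: Rdiv_le_0_compat => //; lra.
lra.
Qed.

(** The flux of the gradient of [ln (|.|^2 + e)] through an edge at distance [p]. For [e = 0] it is
    twice the angle under which the edge is seen, so the four edges add up to [4 PI]. *)
Definition Jp p c e := RInt (fun t => 2 * p / (p ^ 2 + (c - t) ^ 2 + e)) (-1) 1.

Lemma cont_Jp p c e : 0 < p -> 0 <= e -> cont (fun t => 2 * p / (p ^ 2 + (c - t) ^ 2 + e)).
Proof.
move=> hp he; apply: cont_div; [exact: cont_const | ctac | ].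
move=> t; have := pow2_ge_0 (c - t); nra.
Qed.

Lemma cc_trace_J e x : 0 < e -> -1 < fst x < 1 -> -1 < snd x < 1 ->
  cc e true true x + cc e false false x =
  (Jp (1 + fst x) (snd x) e + Jp (1 - fst x) (snd x) e) +
  (Jp (1 + snd x) (fst x) e + Jp (1 - snd x) (fst x) e).
Proof.
move=> he h1 h2; rewrite !cc_edge // /Jp.
have ee : forall p c, 0 < p -> ex_RInt (fun t => 2 * p / (p ^ 2 + (c - t) ^ 2 + e)) (-1) 1.
  move=> p c hp; apply: ex_RInt_cont; apply: cont_Jp; lra.
congr (_ + _); (rewrite -RInt_plusR; [apply: ee; lra | apply: ee; lra |]); apply: RInt_ext => t _; rewrite /edge /k1 /kw /km /kq /rho2 /co /upc /=.
  have a1 := pow2_ge_0 (fst x - 1); have a2 := pow2_ge_0 (fst x + 1); have a3 := pow2_ge_0 (snd x - t).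
  field; split; simpl in *; lra.
have a1 := pow2_ge_0 (snd x - 1); have a2 := pow2_ge_0 (snd x + 1); have a3 := pow2_ge_0 (fst x - t).
field; split; simpl in *; lra.
Qed.

Lemma Jp0 p c : 0 < p -> Jp p c 0 = 2 * (atan ((1 - c) / p) + atan ((1 + c) / p)).
Proof.
move=> hp; rewrite /Jp.
rewrite (RInt_FTC (fun t => 2 * atan ((t - c) / p))); first lra.
- move=> t _; auto_derive; first done.
  have := pow2_ge_0 (c - t); have : 0 < p ^ 2 by nra.
  move=> q1 q2; field; repeat split; try lra; rewrite /= in q1 q2 *; nra.
- move=> t _; apply: (cont_Jp p c 0) => //; lra.
have -> : (-1 - c) / p = - ((1 + c) / p) by field; lra.
rewrite atan_opp; rewrite /=; ring.
Qed.

Lemma Jp_close p c e r : 0 < r <= p -> p <= 2 -> 0 < e -> Rabs (Jp p c e - Jp p c 0) <= 2 * (4 * (e / r ^ 2 / r ^ 2)).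
Proof.
move=> hp hp2 he; rewrite /Jp.
have e1 : forall e, 0 <= e -> ex_RInt (fun t => 2 * p / (p ^ 2 + (c - t) ^ 2 + e)) (-1) 1.
  move=> a ha; apply: ex_RInt_cont; apply: cont_Jp; lra.
rewrite -RInt_minusR; try (apply: e1; lra).
have -> : 2 * (4 * (e / r ^ 2 / r ^ 2)) = (1 - -1) * (4 * (e / r ^ 2 / r ^ 2)) by ring.
apply: abs_RInt_le_const; first lra.
  apply: ex_RInt_cont; apply: cont_minus; apply: cont_Jp; lra.
move=> t _.
set q := p ^ 2 + (c - t) ^ 2.
have hq : r ^ 2 <= q by rewrite /q; have := pow2_ge_0 (c - t); nra.
have hr : 0 < r ^ 2 by nra.
have -> : 2 * p / (q + e) - 2 * p / (q + 0) = - ((2 * p) * (e / (q + e) / q)) by field; lra.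
have h0 : 0 <= e / (q + e) / q.
  apply: Rdiv_le_0_compat; last lra. apply: Rdiv_le_0_compat; lra.
rewrite Rabs_Ropp Rabs_right; first nra.
have := div2_bound e (q + e) q (r ^ 2) he hr ltac:(lra) hq; rewrite /= => h.
apply: Rmult_le_compat; lra.
Qed.

Lemma cc_trace x d e : 0 < d <= 1 -> q2 x <= 1 - d -> 0 < e ->
  Rabs (cc e true true x + cc e false false x - 4 * PI) <= 32 * (e / (d / 2) ^ 2 / (d / 2) ^ 2).
Proof.
move=> hd hx he.
have h1 := co_bound true x d hd hx; have h2 := co_bound false x d hd hx; rewrite /= in h1 h2.
have e0 : (Jp (1 + fst x) (snd x) 0 + Jp (1 - fst x) (snd x) 0) +
  (Jp (1 + snd x) (fst x) 0 + Jp (1 - snd x) (fst x) 0) = 4 * PI.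
  rewrite !Jp0; try lra.
  (* The two angles meeting at a corner of the square are complementary; the four corners contribute
     [4 * 2 * (PI / 2)]. *)
  have inv : forall a b, 0 < a -> 0 < b -> atan (a / b) + atan (b / a) = PI / 2.
    move=> a b ha hb; have -> : b / a = / (a / b) by field; lra.
    rewrite atan_inv; first by apply: Rdiv_lt_0_compat.
    ring.
  have i1 := inv (1 - snd x) (1 + fst x) ltac:(lra) ltac:(lra).
  have i2 := inv (1 + snd x) (1 + fst x) ltac:(lra) ltac:(lra).
  have i3 := inv (1 - snd x) (1 - fst x) ltac:(lra) ltac:(lra).
  have i4 := inv (1 + snd x) (1 - fst x) ltac:(lra) ltac:(lra).
  lra.
rewrite cc_trace_J //; try lra. rewrite -e0.
have j1 := Jp_close (1 + fst x) (snd x) e (d / 2) ltac:(lra) ltac:(lra) he.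
have j2 := Jp_close (1 - fst x) (snd x) e (d / 2) ltac:(lra) ltac:(lra) he.
have j3 := Jp_close (1 + snd x) (fst x) e (d / 2) ltac:(lra) ltac:(lra) he.
have j4 := Jp_close (1 - snd x) (fst x) e (d / 2) ltac:(lra) ltac:(lra) he.
move: j1 j2 j3 j4 => /Rabs_le_between j1 /Rabs_le_between j2 /Rabs_le_between j3 /Rabs_le_between j4.
apply: Rabs_le; lra.
Qed.

(** * Classical regularity of the Green potential *)

(* [F e] is Cauchy as [e -> 0+], locally uniformly in the open disc. *)
Definition LUC (F : R -> pt -> R) : Prop :=
  forall d eta, 0 < d < 1 -> 0 < eta -> exists e0, 0 < e0 <= 1 /\
    forall e e' x, 0 < e' <= e -> e <= e0 -> q2 x <= 1 - d -> Rabs (F e x - F e' x) <= eta.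

Lemma rate_small C th eta : 0 <= C -> 0 < th -> 0 < eta -> exists e0, 0 < e0 <= 1 /\
  forall e, 0 < e <= e0 -> C * Rpower e th <= eta.
Proof.
move=> hC ht he.
have hp : 0 < eta / (C + 1) by apply: Rdiv_lt_0_compat; lra.
exists (Rmin 1 (Rpower (eta / (C + 1)) (/ th))); split.
  split; last exact: Rmin_l. apply: Rmin_glb_lt; [lra | exact: Rpower_pos].
move=> e [e1 e2].
have h : Rpower e th <= eta / (C + 1).
  apply: (Rle_trans _ (Rpower (Rpower (eta / (C + 1)) (/ th)) th)).
    apply: Rle_Rpower_l; first lra. split => //; apply: Rle_trans e2 _; exact: Rmin_r.
  rewrite Rpower_mult Rinv_l; first lra. rewrite Rpower_1; lra.
have h2 := Rpower_pos e th.
apply: (Rle_trans _ ((C + 1) * (eta / (C + 1)))); last by apply: Req_le; field; lra.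
apply: Rmult_le_compat; lra.
Qed.

Lemma LUC_rate F : (forall d, 0 < d < 1 -> exists C th, 0 <= C /\ 0 < th /\
   forall e e' x, 0 < e' <= e -> e <= 1 -> q2 x <= 1 - d -> Rabs (F e x - F e' x) <= C * Rpower e th) -> LUC F.
Proof.
move=> h d eta hd he; have [C [th [hC [ht hF]]]] := h d hd.
have [e0 [h0 h1]] := rate_small C th eta hC ht he.
exists e0; split => // e e' x h2 h3 hx.
apply: Rle_trans (hF e e' x h2 _ hx) _; first lra. apply: h1; lra.
Qed.

Lemma LUC_minus F G : LUC F -> LUC G -> LUC (fun e x => F e x - G e x).
Proof.
move=> hF hG d eta hd he.
have [e1 [h1 h1']] := hF d (eta / 2) hd ltac:(lra); have [e2 [h2 h2']] := hG d (eta / 2) hd ltac:(lra).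
exists (Rmin e1 e2); split.
  split; first by apply: Rmin_glb_lt; lra. apply: Rle_trans (Rmin_l _ _) _; lra.
move=> e e' x q1 q hx.
have a1 := h1' e e' x q1 (Rle_trans _ _ _ q (Rmin_l _ _)) hx.
have a2 := h2' e e' x q1 (Rle_trans _ _ _ q (Rmin_r _ _)) hx.
move: a1 a2 => /Rabs_le_between a1 /Rabs_le_between a2; apply: Rabs_le; lra.
Qed.

Lemma LUC_mulf (f : pt -> R) M F : (forall x, Rabs (f x) <= M) -> LUC F -> LUC (fun e x => f x * F e x).
Proof.
move=> hM hF d eta hd he.
have h0 : 0 <= M by apply: Rle_trans (hM (0,0)); exact: Rabs_pos.
have [e1 [h1 h1']] := hF d (eta / (M + 1)) hd ltac:(apply: Rdiv_lt_0_compat; lra).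
exists e1; split => // e e' x q1 q hx.
have a1 := h1' e e' x q1 q hx.
rewrite -Rmult_minus_distr_l Rabs_mult.
apply: (Rle_trans _ ((M + 1) * (eta / (M + 1)))); last by apply: Req_le; field; lra.
apply: Rmult_le_compat => //; try exact: Rabs_pos. have := hM x; lra.
Qed.

Lemma LUC_scal c F : LUC F -> LUC (fun e x => c * F e x).
Proof. apply: (LUC_mulf (fun _ => c) (Rabs c)) => _; exact: Rle_refl. Qed.

Lemma LUC_ext F G : (forall e x, 0 < e -> F e x = G e x) -> LUC F -> LUC G.
Proof.
move=> h hF d eta hd he; have [e0 [h0 h1]] := hF d eta hd he.
exists e0; split => // e e' x q1 q hx; rewrite -!h; try lra. exact: h1.
Qed.

Definition sq (n : nat) : R := / (INR n + 1).

Lemma sq_pos n : 0 < sq n <= 1.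
Proof.
have h := pos_INR n; split; first by apply: Rinv_0_lt_compat; lra.
rewrite /sq -Rinv_1; apply: Rinv_le_contravar; lra.
Qed.

Lemma sq_small e : 0 < e -> exists N, forall n, (N <= n)%nat -> sq n <= e.
Proof.
move=> he; have [N hN] := archimed_cor1 e he.
exists N => n hn; apply: Rle_trans (Rlt_le _ _ (proj1 hN)).
have h1 : 0 < INR N by apply: lt_0_INR; case: hN.
have h2 := le_INR _ _ hn.
apply: Rinv_le_contravar; lra.
Qed.

(** A total definition through [Lim_seq] and [real]; it has the intended meaning only at points
    where convergence has been proved, as in [limF_cauchy]. *)
Definition limF (F : R -> pt -> R) (x : pt) : R := real (Lim_seq (fun n => F (sq n) x)).

Lemma limF_cauchy F x : (forall eta, 0 < eta -> exists e0, 0 < e0 /\ forall e e', 0 < e' <= e -> e <= e0 -> Rabs (F e x - F e' x) <= eta) ->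
  is_lim_seq (fun n => F (sq n) x) (limF F x).
Proof.
move=> h; apply: Lim_seq_correct'; apply: (proj2 (ex_lim_seq_cauchy_corr _)).
move=> eta; have [e0 [h0 h1]] := h (eta / 2) ltac:(have := cond_pos eta; lra).
have [N hN] := sq_small e0 h0.
exists N => n m hn hm; have hp := cond_pos eta.
have s1 := sq_pos n; have s2 := sq_pos m; have q1 := hN n hn; have q2 := hN m hm.
case: (Rle_dec (sq n) (sq m)) => hc.
  rewrite Rabs_minus_sym; have := h1 (sq m) (sq n) ltac:(lra) ltac:(lra); lra.
have := h1 (sq n) (sq m) ltac:(lra) ltac:(lra); lra.
Qed.

Lemma limF_close F x eta e0 : is_lim_seq (fun n => F (sq n) x) (limF F x) -> 
  (forall e', 0 < e' <= e0 -> Rabs (F e0 x - F e' x) <= eta) -> 0 < e0 ->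
  Rabs (F e0 x - limF F x) <= eta.
Proof.
move=> hl h he.
have h1 : is_lim_seq (fun n => Rabs (F e0 x - F (sq n) x)) (Rabs (F e0 x - limF F x)).
  apply: (is_lim_seq_abs _ (Finite _)).
  apply: is_lim_seq_minus'; [exact: is_lim_seq_const | exact: hl].
have [N hN] := sq_small e0 he.
apply: (is_lim_seq_le_loc _ _ (Finite _) (Finite _) _ h1 (is_lim_seq_const eta)).
exists N => n hn; apply: h; have := sq_pos n; have := hN n hn; lra.
Qed.

Lemma LUC_lim F x : LUC F -> q2 x < 1 -> is_lim_seq (fun n => F (sq n) x) (limF F x).
Proof.
move=> h hx; apply: limF_cauchy => eta he.
have h2 := q2_ge0 x.
have [e0 [h0 h1]] := h ((1 - q2 x) / 2) eta ltac:(lra) he.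
exists e0; split; first lra. move=> e e' q1 q; apply: h1 => //; lra.
Qed.

Lemma LUC_unif F d eta : LUC F -> 0 < d < 1 -> 0 < eta -> exists e0, 0 < e0 <= 1 /\
  forall e x, 0 < e <= e0 -> q2 x <= 1 - d -> Rabs (F e x - limF F x) <= eta.
Proof.
move=> h hd he; have [e0 [h0 h1]] := h d eta hd he.
exists e0; split => // e x q1 hx.
apply: limF_close; try lra.
  apply: LUC_lim => //; lra.
move=> e' he'; apply: h1 => //; lra.
Qed.

Lemma near_disc x : q2 x < 1 -> exists d, 0 < d < 1 /\ locally x (fun y => q2 y <= 1 - d).
Proof.
move=> hx; have h := q2_ge0 x.
exists ((1 - q2 x) / 2); split; first lra.
have hc : cont q2 by rewrite /q2; ctac.
have := hc x => /filterlim_locally /(_ (mkposreal ((1 - q2 x) / 2) ltac:(lra))) [r hr].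
exists r => y hy; have := hr y hy; rewrite /ball /= /AbsRing_ball /abs /minus /plus /opp /= => /Rabs_lt_between; lra.
Qed.

Lemma LUC_cont F x : LUC F -> (forall e, 0 < e <= 1 -> cont (F e)) -> q2 x < 1 -> continuous (limF F) x.
Proof.
move=> h hc hx; apply/filterlim_locally => eps.
have hp := cond_pos eps.
have [d [hd hloc]] := near_disc x hx.
have [e0 [h0 h1]] := LUC_unif F d (eps / 4) h hd ltac:(lra).
have := hc e0 h0 x => /filterlim_locally /(_ (pos_div_2 eps)) hF.
apply: filter_imp (filter_and _ _ hloc hF) => y [hy1].
rewrite /ball /= /AbsRing_ball /abs /minus /plus /opp /= => hy2.
have a1 := h1 e0 y ltac:(lra) hy1.
have a2 := h1 e0 x ltac:(lra) (locally_singleton _ _ hloc).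
move: hy2 a1 a2 => /Rabs_lt_between hy2 /Rabs_le_between a1 /Rabs_le_between a2.
apply: Rabs_def1; lra.
Qed.

Lemma MVT_line i (F G : pt -> R) x a b : (forall y, pd i F y (G y)) ->
  exists c, Rmin a b <= c <= Rmax a b /\ F (upc i x b) - F (upc i x a) = G (upc i x c) * (b - a).
Proof.
move=> h.
have hd : forall t, is_derive (fun t => F (upc i x t)) t (G (upc i x t)).
  move=> t; exact: pd_line.
have [c [hc1 hc2]] := MVT_gen (fun t => F (upc i x t)) a b (fun t => G (upc i x t)) (fun t _ => hd t) 
  (fun t _ => derivable_continuous_pt _ _ (ex_derive_Reals_0 _ _ (ex_intro _ _ (hd t)))).
by exists c.
Qed.

(** The mean value theorem for [F (sq n)] gives a point where [G (sq n)] is close to [limF G x],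
    uniformly in [n]; letting [n] grow bounds the difference quotient of [limF F]. *)
Lemma LUC_pd i F G x : LUC F -> LUC G -> (forall e, 0 < e <= 1 -> forall x, pd i (F e) x (G e x)) ->
  (forall e, 0 < e <= 1 -> cont (G e)) -> q2 x < 1 -> pd i (limF F) x (limF G x).
Proof.
move=> hF hG hpd hc hx; rewrite /pd; apply/is_derive_Reals => eps heps.
have hcont := LUC_cont G x hG hc hx.
have [d [hd hloc]] := near_disc x hx.
have := hcont => /filterlim_locally /(_ (mkposreal (eps / 4) ltac:(lra))) hG1.
have [r hr] := filter_and _ _ hloc hG1.
have [e0 [h0 h1]] := LUC_unif G d (eps / 4) hG hd ltac:(lra).
exists r => hh hne hlt.
set t0 := co i x.
have hball : forall t, Rabs (t - t0) < r -> q2 (upc i x t) <= 1 - d /\ Rabs (limF G (upc i x t) - limF G x) < eps / 4.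
  move=> t ht.
  have hb : ball x r (upc i x t).
    move: ht; rewrite /t0; case: (i) => /= ht; split => //; exact: ball_center.
  have [b1 b2] := hr _ hb; split => //.
have hin1 := hball (t0 + hh) ltac:(by replace (t0 + hh - t0) with hh by ring).
have hin0 := hball t0 ltac:(rewrite Rminus_diag Rabs_R0; exact: cond_pos).
have lim1 := LUC_lim F (upc i x (t0 + hh)) hF ltac:(lra).
have lim0 := LUC_lim F (upc i x t0) hF ltac:(lra).
have key : Rabs (limF F (upc i x (t0 + hh)) - limF F (upc i x t0) - limF G x * hh) <= eps / 2 * Rabs hh.
  have l3 : is_lim_seq (fun n => Rabs (F (sq n) (upc i x (t0 + hh)) - F (sq n) (upc i x t0) - limF G x * hh))
     (Rabs (limF F (upc i x (t0 + hh)) - limF F (upc i x t0) - limF G x * hh)).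
    apply: (is_lim_seq_abs _ (Finite _)).
    apply: is_lim_seq_minus'; last exact: is_lim_seq_const.
    apply: is_lim_seq_minus'; [exact: lim1 | exact: lim0].
  have [N hN] := sq_small e0 (proj1 h0).
  apply: (is_lim_seq_le_loc _ _ (Finite _) (Finite _) _ l3 (is_lim_seq_const _)).
  exists N => n hn.
  have sn := sq_pos n; have sn' := hN n hn.
  have [c [hc1 hc2]] := MVT_line i (F (sq n)) (G (sq n)) x t0 (t0 + hh) (hpd _ sn).
  rewrite hc2.
  have -> : G (sq n) (upc i x c) * (t0 + hh - t0) - limF G x * hh = (G (sq n) (upc i x c) - limF G x) * hh by ring.
  rewrite Rabs_mult; apply: Rmult_le_compat_r; first exact: Rabs_pos.
  have hcr : Rabs (c - t0) < r.
    apply: Rle_lt_trans hlt; move: hc1; rewrite /Rmin /Rmax; case: Rle_dec => hh' hc1.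
      rewrite !Rabs_right; lra.
    rewrite !Rabs_left1; lra.
  have [b1 b2] := hball c hcr.
  have a1 := h1 (sq n) _ ltac:(lra) b1.
  move: a1 b2 => /Rabs_le_between a1 /Rabs_lt_between b2; apply: Rabs_le; lra.
have hp : 0 < Rabs hh by apply: Rabs_pos_lt.
have -> : (limF F (upc i x (t0 + hh)) - limF F (upc i x t0)) / hh - limF G x =
  (limF F (upc i x (t0 + hh)) - limF F (upc i x t0) - limF G x * hh) / hh by field.
rewrite Rabs_div //; apply/Rlt_div_l => //.
apply: Rle_lt_trans key _; nra.
Qed.

(** The Dirichlet Green function of the unit disc is [ln (DD / rho2) / (4 PI)]; these are its
    regularised potential, gradient and Hessian. *)
Definition Ge e f x := / (4 * PI) * (L0 true e f x - L0 false e f x).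
Definition dGe e f i x := / (4 * PI) * (L1 true e f i x - L1 false e f i x).
Definition ddGe e f i j x := / (4 * PI) * (L2 true e f i j x - L2 false e f i j x).

Lemma pd_comb j F G x l m c : pd j F x l -> pd j G x m -> pd j (fun x => c * (F x - G x)) x (c * (l - m)).
Proof.
move=> hF hG; rewrite /pd; apply: is_derive_scal.
exact: (is_derive_minus (V := R_NormedModule) _ _ _ _ _ hF hG).
Qed.

Lemma pd_Ge e f i x : 0 < e -> cont f -> pd i (Ge e f) x (dGe e f i x).
Proof. move=> he hf; apply: pd_comb; exact: pd_L0. Qed.
Lemma pd_dGe e f i j x : 0 < e -> cont f -> pd j (dGe e f i) x (ddGe e f i j x).
Proof. move=> he hf; apply: pd_comb; exact: pd_L1. Qed.

Lemma cont_Ge e f : 0 < e -> cont f -> cont (Ge e f).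
Proof. move=> he hf; apply: cont_mult; [exact: cont_const | apply: cont_minus; exact: cont_L0]. Qed.
Lemma cont_dGe e f i : 0 < e -> cont f -> cont (dGe e f i).
Proof. move=> he hf; apply: cont_mult; [exact: cont_const | apply: cont_minus; exact: cont_L1]. Qed.
Lemma cont_ddGe e f i j : 0 < e -> cont f -> cont (ddGe e f i j).
Proof. move=> he hf; apply: cont_mult; [exact: cont_const | apply: cont_minus; exact: cont_L2]. Qed.

Lemma LUC_L0 D f M : srcf f M -> LUC (fun e => L0 D e f).
Proof.
move=> hs; apply: LUC_rate => d hd; exists (2 * M * Csing (/ 2)), (/ 2).
have hM := srcf_M0 f M hs; have hC := Csing_pos (/ 2) ltac:(lra).
split; first by apply: Rmult_le_pos; lra. split; first lra.
move=> e e' x h1 h2 hx; apply: L0_cauchy => //; lra.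
Qed.

Lemma LUC_Ge f M : srcf f M -> LUC (fun e => Ge e f).
Proof. move=> hs; apply: LUC_scal; apply: LUC_minus; exact: (LUC_L0 _ f M). Qed.

Lemma LUC_dGe f M i : srcf f M -> LUC (fun e => dGe e f i).
Proof.
move=> hs; apply: LUC_scal; apply: LUC_minus.
all: apply: LUC_rate => d hd; exists (2 * M * Csing (/ 4)), (/ 4).
all: have hM := srcf_M0 f M hs; have hC := Csing_pos (/ 4) ltac:(lra).
all: split; first by apply: Rmult_le_pos; lra.
all: split; first lra.
all: move=> e e' x h1 h2 hx; apply: L1_cauchy => //; lra.
Qed.

Lemma LUC_ddGe f M g H i j : srcf f M -> holder f g H -> 0 < g <= 1 -> LUC (fun e => ddGe e f i j).
Proof.
move=> hs hh hg; apply: LUC_scal; have hM := srcf_M0 f M hs; have [hf [hf0 hfM]] := hs.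
apply: LUC_minus.
  apply: LUC_rate => d hd; eexists; exists 1; split; last (split; first lra); last first.
    move=> e e' x h1 h2 hx; apply: (L2t_cauchy _ _ _ _ _ _ _ d) => //; lra.
  have h0 : 0 < d ^ 2 / 4 by nra.
  have : 0 <= 1 / (d ^ 2 / 4) / (d ^ 2 / 4) by apply: Rdiv_le_0_compat => //; apply: Rdiv_le_0_compat => //; lra.
  nra.
(* The free Hessian potential splits into the Hoelder part [M2] and the edge part; the sign is
   arranged to fit [LUC_minus]. *)
apply: (LUC_ext (fun e x => M2 e f i j x - (-1) * (f x * cc e i j x))).
  move=> e x he; rewrite L2f_split //; ring.
apply: LUC_minus.
  apply: LUC_rate => d hd; exists (10 * H * Csing (g / 4)), (g / 4).
  have hH := holder_H0 f g H hh; have hC := Csing_pos (g / 4) ltac:(lra).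
  split; first by apply: Rmult_le_pos; lra. split; first lra.
  move=> e e' x h1 h2 hx; apply: M2_cauchy => //; lra.
apply: LUC_scal; apply: (LUC_mulf f M) => //.
apply: LUC_rate => d hd; exists (16 * (1 / (d ^ 2 / 4) / (d ^ 2 / 4))), 1.
have h0 : 0 < d ^ 2 / 4 by nra.
split.
  have : 0 <= 1 / (d ^ 2 / 4) / (d ^ 2 / 4) by apply: Rdiv_le_0_compat => //; apply: Rdiv_le_0_compat => //; lra.
  lra.
split; first lra.
move=> e e' x h1 h2 hx; rewrite Rpower_1; first lra.
have -> : 16 * (1 / (d ^ 2 / 4) / (d ^ 2 / 4)) * e = 16 * (e / (d ^ 2 / 4) / (d ^ 2 / 4)) by field; lra.
apply: cc_cauchy => //; lra.
Qed.

Lemma seq_rate (s : nat -> R) (l C th : R) : 0 < th -> 0 <= C ->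
  (forall n, Rabs (s n - l) <= C * Rpower (sq n) th) -> is_lim_seq s l.
Proof.
move=> ht hC h; apply/is_lim_seq_spec => eps.
have hp := cond_pos eps.
have [e0 [h0 h1]] := rate_small C th (eps / 2) hC ht ltac:(lra).
have [N hN] := sq_small e0 (proj1 h0).
exists N => n hn; apply: Rle_lt_trans (h n) _.
have := h1 (sq n); have := sq_pos n; have := hN n hn; move=> a b c; have := c ltac:(lra); lra.
Qed.

(** Of the three contributions to the Laplacian, those of the reflected kernel and of [M2] tend to
    0. Only [f x] times the trace of [cc] remains; that trace tends to [4 PI] and cancels the
    normalisation. *)
Lemma ddGe_trace_lim f M g H x : srcf f M -> holder f g H -> 0 < g <= 1 -> q2 x < 1 ->
  limF (fun e => ddGe e f true true) x + limF (fun e => ddGe e f false false) x = - f x.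
Proof.
move=> hs hh hg hx; have hM := srcf_M0 f M hs; have [hf [hf0 hfM]] := hs.
have l1 := LUC_lim _ x (LUC_ddGe f M g H true true hs hh hg) hx.
have l2 := LUC_lim _ x (LUC_ddGe f M g H false false hs hh hg) hx.
have l3 := is_lim_seq_plus' _ _ _ _ l1 l2.
pose d := 1 - q2 x.
have hd : 0 < d <= 1 by rewrite /d; have := q2_ge0 x; lra.
have hqx : q2 x <= 1 - d by rewrite /d; lra.
have h0 : 0 < d ^ 2 / 4 by nra.
have h0' : 0 < (d / 2) ^ 2 by nra.
have Kp : 0 <= 1 / (d ^ 2 / 4) / (d ^ 2 / 4) by apply: Rdiv_le_0_compat => //; apply: Rdiv_le_0_compat => //; lra.
have Kp' : 0 <= 1 / ((d / 2) ^ 2) / ((d / 2) ^ 2) by apply: Rdiv_le_0_compat => //; apply: Rdiv_le_0_compat => //; lra.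
have hpi := PI_RGT_0.
have t1 : is_lim_seq (fun n => L2 true (sq n) f true true x + L2 true (sq n) f false false x) 0.
  apply: (seq_rate _ _ (4 * (M * (4 * (1 / (d ^ 2 / 4) / (d ^ 2 / 4))))) 1); try lra; try nra.
  move=> n; rewrite Rminus_0_r; have hn := sq_pos n.
  rewrite Rpower_1; first lra. apply: L2t_trace => //; lra.
have t2 : is_lim_seq (fun n => M2 (sq n) f true true x + M2 (sq n) f false false x) 0.
  have hH := holder_H0 f g H hh; have hC := Csing_pos (g / 4) ltac:(lra).
  apply: (seq_rate _ _ (4 * H * Csing (g / 4)) (g / 4)); try lra; try (apply: Rmult_le_pos; lra).
  move=> n; rewrite Rminus_0_r; have hn := sq_pos n; exact: M2_trace.
have t3 : is_lim_seq (fun n => cc (sq n) true true x + cc (sq n) false false x) (4 * PI).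
  apply: (seq_rate _ _ (32 * (1 / (d / 2) ^ 2 / (d / 2) ^ 2)) 1); try lra.
  move=> n; have hn := sq_pos n; rewrite Rpower_1; first lra.
  have -> : 32 * (1 / (d / 2) ^ 2 / (d / 2) ^ 2) * sq n = 32 * (sq n / (d / 2) ^ 2 / (d / 2) ^ 2) by field; lra.
  apply: cc_trace => //; lra.
have t4 : is_lim_seq (fun n => ddGe (sq n) f true true x + ddGe (sq n) f false false x) (- f x).
  have e1 : / (4 * PI) * (0 - (0 + f x * (4 * PI))) = - f x by field; lra.
  rewrite -e1.
  apply: (is_lim_seq_ext (fun n => / (4 * PI) * ((L2 true (sq n) f true true x + L2 true (sq n) f false false x)
     - ((M2 (sq n) f true true x + M2 (sq n) f false false x) + f x * (cc (sq n) true true x + cc (sq n) false false x))))).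
    move=> n; have hn := sq_pos n; rewrite /ddGe !L2f_split //; try lra; ring.
  apply: (is_lim_seq_scal_l _ _ (Finite _)).
  apply: is_lim_seq_minus' => //; apply: is_lim_seq_plus' => //.
  exact: (is_lim_seq_scal_l _ (f x) (Finite _)).
have := is_lim_seq_unique _ _ l3; rewrite (is_lim_seq_unique _ _ t4) => - [->] //.
Qed.

(** The derivatives [d] and [h] are carried as witnesses, constrained in the open disc only.
    Boundary values are stated separately, through vanishing where [1 <= q2 x]. *)
Definition poisson (u f : pt -> R) : Prop :=
  exists (d : bool -> pt -> R) (h : bool -> bool -> pt -> R),
    (forall i x, q2 x < 1 -> continuous (d i) x) /\
    (forall i j x, q2 x < 1 -> continuous (h i j) x) /\
    (forall i x, q2 x < 1 -> pd i u x (d i x)) /\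
    (forall i j x, q2 x < 1 -> pd j (d i) x (h i j x)) /\
    (forall x, q2 x < 1 -> - (h true true x + h false false x) = f x).

Definition Green (f : pt -> R) (x : pt) : R :=
  if Rlt_dec (q2 x) 1 then limF (fun e => Ge e f) x else 0.

Lemma Green_in f x : q2 x < 1 -> Green f x = limF (fun e => Ge e f) x.
Proof. by rewrite /Green; case: Rlt_dec. Qed.

Lemma Green_out f x : 1 <= q2 x -> Green f x = 0.
Proof. rewrite /Green; case: Rlt_dec => //; lra. Qed.

Lemma locally_line i x P : locally x P -> locally (co i x) (fun t => P (upc i x t)).
Proof.
move=> [r hr]; exists r => t ht; apply: hr.
case: i ht => /= ht; split => //; exact: ball_center.
Qed.

Lemma pd_ext_loc i F G x l : locally x (fun y => F y = G y) -> pd i F x l -> pd i G x l.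
Proof.
move=> h; rewrite /pd; apply: is_derive_ext_loc; exact: (locally_line i x (fun y => F y = G y)).
Qed.

Lemma locally_disc x : q2 x < 1 -> locally x (fun y => q2 y < 1).
Proof.
move=> hx; have [d [hd hl]] := near_disc x hx; apply: filter_imp hl => y; lra.
Qed.

Theorem Green_poisson f M g H : srcf f M -> holder f g H -> 0 < g <= 1 -> poisson (Green f) f.
Proof.
move=> hs hh hg; have [hf _] := hs.
exists (fun i => limF (fun e => dGe e f i)), (fun i j => limF (fun e => ddGe e f i j)).
split; [|split; [|split; [|split]]].
- move=> i x hx; apply: LUC_cont => //; first exact: (LUC_dGe f M). by move=> e he; apply: cont_dGe => //; lra.
- move=> i j x hx; apply: LUC_cont => //; first exact: (LUC_ddGe f M g H). by move=> e he; apply: cont_ddGe => //; lra.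
- move=> i x hx; apply: (pd_ext_loc _ (limF (fun e => Ge e f))).
    apply: filter_imp (locally_disc x hx) => y hy; by rewrite Green_in.
  apply: LUC_pd => //; first exact: (LUC_Ge f M); first exact: (LUC_dGe f M).
    by move=> e he y; apply: pd_Ge => //; lra.
  by move=> e he; apply: cont_dGe => //; lra.
- move=> i j x hx; apply: LUC_pd => //; first exact: (LUC_dGe f M); first exact: (LUC_ddGe f M g H).
    by move=> e he y; apply: pd_dGe => //; lra.
  by move=> e he; apply: cont_ddGe => //; lra.
- move=> x hx; rewrite (ddGe_trace_lim f M g H) //; ring.
Qed.

(** * The Green operator *)

Definition KG := Csing (/ 2).
Lemma KG_pos : 0 < KG. Proof. apply: Csing_pos; lra. Qed.

Lemma inv4pi : 0 < / (4 * PI) <= / 4.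
Proof.
have h := PI2_3_2; have h1 : 1 <= PI by rewrite /PI2 in h; lra.
split; first by apply: Rinv_0_lt_compat; lra.
apply: Rinv_le_contravar; lra.
Qed.

Lemma Ge_kernel e f x : 0 < e -> cont f -> Ge e f x = / (4 * PI) * I2 (fun y => (k0 true e x y - k0 false e x y) * f y).
Proof. move=> he hf; rewrite /Ge /L0 I2_diff_mul //; exact: cont_k0s. Qed.

Lemma k0_mono e x y : 0 < e -> q2 x <= 1 -> q2 y <= 1 -> 0 <= k0 true e x y - k0 false e x y.
Proof.
move=> he hx hy; rewrite /k0.
have h := kq_rho true x y hx hy; have h0 := rho2_ge0 x y; rewrite /= in h |- *.
have : ln (rho2 x y + e) <= ln (DD x y + e) by apply: ln_le; lra.
lra.
Qed.

(** By [DDrho], [DD + e] exceeds [rho2 + e] by at most 1, so [est0] applies with gap 1. *)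
Lemma k0_bound e x y : 0 < e -> q2 x <= 1 -> q2 y <= 1 ->
  k0 true e x y - k0 false e x y <= 2 * Rpower (rho2 x y + e) (- (1 - / 2)).
Proof.
move=> he hx hy; rewrite /k0 /=.
have h0 := rho2_ge0 x y; have hqx := q2_ge0 x; have hqy := q2_ge0 y.
set s := rho2 x y + e; have hs : 0 < s by rewrite /s; lra.
have hD : DD x y + e <= s + 1 by rewrite /s DDrho; nra.
have hD0 := DD_ge0 x y.
apply: (Rle_trans _ (ln (s + 1) - ln s)).
  have : ln (DD x y + e) <= ln (s + 1) by apply: ln_le; lra.
  lra.
have := est0 1 (s + 1) s ltac:(lra) ltac:(lra) ltac:(lra).
have -> : Rpower 1 (/ 2) = 1 by rewrite /Rpower ln_1 Rmult_0_r exp_0.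
move=> /Rabs_le_between; lra.
Qed.

Lemma Ge_bound e f M x : srcf f M -> q2 x <= 1 -> 0 < e <= 1 -> Rabs (Ge e f x) <= M * KG.
Proof.
move=> hs hx he; have hM := srcf_M0 f M hs; have [hf _] := hs.
rewrite Ge_kernel //; first lra.
have [hp1 hp2] := inv4pi; rewrite Rabs_mult (Rabs_right (/ _)); first lra.
have h : Rabs (I2 (fun y => (k0 true e x y - k0 false e x y) * f y)) <= (M * 2) * Csing (/ 2).
  apply: (I2_sing _ x e (/ 2)); try lra.
  - apply: cont_mult => //; apply: cont_minus; apply: cont_k0s; lra.
  - exact: q2_inQ.
  - move=> y _; rewrite Rmult_assoc.
    have hp := Rpower_pos (rho2 x y + e) (- (1 - / 2)).
    apply: mul_src_bound => //; last lra.
    move=> hy; rewrite Rabs_right; first by apply: Rle_ge; apply: k0_mono => //; lra.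
    apply: k0_bound => //; lra.
have hK := KG_pos; rewrite -/KG in h.
have : 0 <= M * KG by apply: Rmult_le_pos; lra.
have := Rabs_pos (I2 (fun y => (k0 true e x y - k0 false e x y) * f y)).
nra.
Qed.

Lemma Ge_cauchy e e' f M x : srcf f M -> q2 x <= 1 -> 0 < e' <= e -> e <= 1 ->
  Rabs (Ge e f x - Ge e' f x) <= M * KG * Rpower e (/ 2).
Proof.
move=> hs hx he he1; have hM := srcf_M0 f M hs.
have h1 := L0_cauchy true f M x e e' hs hx he he1.
have h2 := L0_cauchy false f M x e e' hs hx he he1.
rewrite -/KG in h1 h2.
have [hp1 hp2] := inv4pi; have hK := KG_pos; have hp := Rpower_pos e (/ 2).
have hMK : 0 <= M * KG * Rpower e (/ 2).
  apply: Rmult_le_pos; last lra. apply: Rmult_le_pos; lra.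
rewrite /Ge -Rmult_minus_distr_l Rabs_mult (Rabs_right (/ _)); first lra.
apply: (Rle_trans _ (/ 4 * (4 * (M * KG * Rpower e (/ 2))))); last lra.
apply: Rmult_le_compat; try lra; first exact: Rabs_pos.
move: h1 h2 => /Rabs_le_between h1 /Rabs_le_between h2; apply: Rabs_le; lra.
Qed.

(** On the circle [DD = rho2], so the two regularised kernels already coincide before the limit. *)
Lemma Ge_bdry e f x : q2 x = 1 -> Ge e f x = 0.
Proof.
move=> hx; rewrite /Ge /L0.
have -> : (fun y => k0 true e x y * f y) = (fun y => k0 false e x y * f y).
  apply: FunctionalExtensionality.functional_extensionality => y.
  rewrite /k0 /= DDrho hx; congr (ln _ * _); ring.
ring.
Qed.

Lemma Ge_Green e f M x : srcf f M -> q2 x <= 1 -> 0 < e <= 1 ->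
  Rabs (Ge e f x - Green f x) <= M * KG * Rpower e (/ 2).
Proof.
move=> hs hx he.
case: (Rle_lt_or_eq_dec _ _ hx) => hx'.
  rewrite Green_in //; apply: (limF_close (fun e => Ge e f)); last lra.
    apply: LUC_lim => //; exact: (LUC_Ge f M).
  move=> e' he'; apply: Ge_cauchy => //; lra.
rewrite Green_out ?Ge_bdry //; first lra.
rewrite Rminus_diag Rabs_R0; have := srcf_M0 f M hs; have := KG_pos; have := Rpower_pos e (/ 2).
move=> a b c; apply: Rmult_le_pos; last lra. apply: Rmult_le_pos; lra.
Qed.

Lemma Ge_lim f M x : srcf f M -> q2 x <= 1 -> is_lim_seq (fun n => Ge (sq n) f x) (Green f x).
Proof.
move=> hs hx; have hM := srcf_M0 f M hs; have hK := KG_pos.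
apply: (seq_rate _ _ (M * KG) (/ 2)); try lra; first by apply: Rmult_le_pos; lra.
move=> n; apply: Ge_Green => //; exact: sq_pos.
Qed.

Lemma Green_bound f M x : srcf f M -> Rabs (Green f x) <= M * KG.
Proof.
move=> hs; have hM := srcf_M0 f M hs; have hK := KG_pos.
case: (Rlt_dec (q2 x) 1) => hx; last first.
  rewrite Green_out; first lra. rewrite Rabs_R0; apply: Rmult_le_pos; lra.
have l := is_lim_seq_abs _ (Finite _) (Ge_lim f M x hs ltac:(lra)).
apply: (is_lim_seq_le _ _ (Finite _) (Finite _) _ l (is_lim_seq_const _)) => n.
apply: Ge_bound => //; first lra. exact: sq_pos.
Qed.

Lemma Green_unique f M x l : srcf f M -> q2 x <= 1 -> is_lim_seq (fun n => Ge (sq n) f x) (Finite l) -> Green f x = l.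
Proof.
move=> hs hx h; have := is_lim_seq_unique _ _ (Ge_lim f M x hs hx).
by rewrite (is_lim_seq_unique _ _ h) => - [->].
Qed.

Lemma srcf_comb f g M N a b : srcf f M -> srcf g N -> srcf (fun y => a * f y + b * g y) (Rabs a * M + Rabs b * N).
Proof.
move=> [f1 [f2 f3]] [g1 [g2 g3]]; split; first by ctac.
split; first by move=> y hy; rewrite f2 // g2 //; ring.
move=> y; apply: Rle_trans (Rabs_triang _ _) _; rewrite !Rabs_mult.
apply: Rplus_le_compat; apply: Rmult_le_compat_l => //; exact: Rabs_pos.
Qed.

Lemma Green_comb f g M N a b x : srcf f M -> srcf g N ->
  Green (fun y => a * f y + b * g y) x = a * Green f x + b * Green g x.
Proof.
move=> hf hg.
case: (Rlt_dec (q2 x) 1) => hx; last by rewrite !Green_out; try lra.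
apply: (Green_unique _ _ _ _ (srcf_comb f g M N a b hf hg)); first lra.
apply: (is_lim_seq_ext (fun n => a * Ge (sq n) f x + b * Ge (sq n) g x)).
  move=> n; have hn := sq_pos n; have [f1 _] := hf; have [g1 _] := hg.
  rewrite !Ge_kernel //; try lra; first by ctac.
  have hk : cont (fun y => k0 true (sq n) x y - k0 false (sq n) x y) by apply: cont_minus; apply: cont_k0s; lra.
  rewrite (I2_ext (fun y => _ * (a * f y + b * g y)) (fun y => a * ((k0 true (sq n) x y - k0 false (sq n) x y) * f y) + b * ((k0 true (sq n) x y - k0 false (sq n) x y) * g y))).
    by move=> y _; ring.
  rewrite I2_plus ?I2_scal; try (apply: cont_mult => //; try exact: cont_const; exact: cont_mult); try exact: cont_mult.
  ring.
apply: is_lim_seq_plus'; apply: (is_lim_seq_scal_l _ _ (Finite _)); apply: Ge_lim; eauto; lra.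
Qed.

Lemma Ge_ge0 e f M x : srcf f M -> (forall y, 0 <= f y) -> q2 x <= 1 -> 0 < e -> 0 <= Ge e f x.
Proof.
move=> [hf [hf0 _]] h0 hx he; rewrite Ge_kernel //; have [p1 p2] := inv4pi.
apply: Rmult_le_pos; first lra. apply: I2_ge0.
  apply: cont_mult => //; apply: cont_minus; exact: cont_k0s.
move=> y _; case: (Rle_dec (q2 y) 1) => hy; last by rewrite hf0; lra.
apply: Rmult_le_pos => //; exact: k0_mono.
Qed.

(** The quotient [(DD + e) / (rho2 + e)] decreases in [e] because [DD >= rho2]. Thus any fixed [e]
    bounds the Green potential from below: [e = 1] proves positivity, and [e = D] serves for the
    bump. *)
Lemma Ge_decr e e' f M x : srcf f M -> (forall y, 0 <= f y) -> q2 x <= 1 -> 0 < e' <= e -> Ge e f x <= Ge e' f x.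
Proof.
move=> [hf [hf0 _]] h0 hx he; rewrite !Ge_kernel //; try lra; have [p1 p2] := inv4pi.
apply: Rmult_le_compat_l; first lra. apply: I2_le.
- apply: cont_mult => //; apply: cont_minus; apply: cont_k0s; lra.
- apply: cont_mult => //; apply: cont_minus; apply: cont_k0s; lra.
move=> y _; case: (Rle_dec (q2 y) 1) => hy; last by rewrite hf0; lra.
apply: Rmult_le_compat_r => //; rewrite /k0 /=.
have h := kq_rho true x y hx hy; have hr := rho2_ge0 x y; rewrite /= in h.
rewrite -!ln_div; try lra; apply: ln_le; first by apply: Rdiv_lt_0_compat; lra.
apply/Rle_div_l; first lra.
have -> : (DD x y + e') / (rho2 x y + e') * (rho2 x y + e) = ((DD x y + e') * (rho2 x y + e)) / (rho2 x y + e') by field; lra.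
apply/Rle_div_r; first lra. nra.
Qed.

Lemma Green_ge_Ge e f M x : srcf f M -> (forall y, 0 <= f y) -> q2 x <= 1 -> 0 < e -> Ge e f x <= Green f x.
Proof.
move=> hs h0 hx he; have [N hN] := sq_small e he.
apply: (is_lim_seq_le_loc _ _ (Finite _) (Finite _) _ (is_lim_seq_const _) (Ge_lim f M x hs hx)).
exists N => n hn; apply: (Ge_decr _ _ f M) => //; split; [exact: (proj1 (sq_pos n)) | exact: hN].
Qed.

Lemma Green_ge0 f M x : srcf f M -> (forall y, 0 <= f y) -> 0 <= Green f x.
Proof.
move=> hs h0; case: (Rlt_dec (q2 x) 1) => hx; last by rewrite Green_out; lra.
apply: Rle_trans (Green_ge_Ge 1 f M x hs h0 _ _); try lra.
apply: (Ge_ge0 _ f M) => //; lra.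
Qed.

Lemma Green_pos f M x y0 : srcf f M -> (forall y, 0 <= f y) -> 0 < f y0 -> q2 x < 1 -> 0 < Green f x.
Proof.
move=> hs h0 hy hx; have [hf [hf0 _]] := hs.
have hy1 : q2 y0 < 1 by case: (Rlt_dec (q2 y0) 1) => // hn; have := hf0 y0 ltac:(lra); lra.
apply: Rlt_le_trans (Green_ge_Ge 1 f M x hs h0 _ _); try lra.
rewrite Ge_kernel //; first lra. have [p1 p2] := inv4pi.
apply: Rmult_lt_0_compat => //.
have hq : -1 < fst y0 < 1 /\ -1 < snd y0 < 1.
  move: hy1; rewrite /q2 => h; have := pow2_ge_0 (fst y0); have := pow2_ge_0 (snd y0) => /= *; repeat split; nra.
apply: (I2_pos_at _ y0); try (case: hq => *; assumption).
- apply: cont_mult => //; apply: cont_minus; apply: cont_k0s; lra.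
- move=> y _; case: (Rle_dec (q2 y) 1) => hy'; last by rewrite hf0; lra.
  apply: Rmult_le_pos => //; apply: k0_mono; lra.
- apply: Rmult_lt_0_compat => //; rewrite /k0 /= DDrho.
  have hr := rho2_ge0 x y0.
  have : ln (rho2 x y0 + 1) < ln (rho2 x y0 + (1 - q2 x) * (1 - q2 y0) + 1) by apply: ln_increasing; nra.
  lra.
Qed.

(** * Lipschitz continuity of the Green potential *)

Definition dist1 (x y : pt) := Rabs (fst x - fst y) + Rabs (snd x - snd y).

Lemma dist1_ge0 x y : 0 <= dist1 x y.
Proof. rewrite /dist1; have := Rabs_pos (fst x - fst y); have := Rabs_pos (snd x - snd y); lra. Qed.
Lemma dist1_sym x y : dist1 x y = dist1 y x.
Proof. by rewrite /dist1 (Rabs_minus_sym (fst x)) (Rabs_minus_sym (snd x)). Qed.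

Lemma dGe_bound e f M i x : srcf f M -> q2 x <= 1 -> 0 < e <= 1 -> Rabs (dGe e f i x) <= M * KG.
Proof.
move=> hs hx he; have hM := srcf_M0 f M hs; have [hf _] := hs; have hK := KG_pos.
have h : forall D, Rabs (L1 D e f i x) <= (M * 2) * Csing (/ 2).
  move=> D; apply: (I2_sing _ x e (/ 2)); try lra.
  - apply: cont_mult => //; apply: cont_k1s; lra.
  - exact: q2_inQ.
  - move=> y _; rewrite Rmult_assoc.
    have hp := Rpower_pos (rho2 x y + e) (- (1 - / 2)).
    apply: mul_src_bound => //; last lra.
    move=> hy; rewrite /k1.
    have hw := kw_sq_le D i x y hy; have hq := kq_ge0 D x y.
    set s := kq D x y + e; have hs0 : 0 < s by rewrite /s; lra.
    have h1 := sq_le_Rabs (kw D i x y) s hs0 ltac:(rewrite /s; lra).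
    have is' : 0 < / s by apply: Rinv_0_lt_compat.
    have h2 := sing_weaken D x y e s (1 - / 2) hx hy ltac:(lra) eq_refl ltac:(lra).
    rewrite Rabs_mult (Rabs_right (/ s)); first lra.
    rewrite Rabs_mult (Rabs_right 2); first lra.
    apply: (Rle_trans _ (2 * (Rpower s (/ 2) * / s))); first nra.
    apply: Rmult_le_compat_l; first lra.
    apply: Rle_trans h2; apply: Req_le.
    have -> : / s = Rpower s (- 1) by rewrite Rpower_Ropp Rpower_1; lra.
    rewrite -Rpower_plus; congr Rpower; field.
have [p1 p2] := inv4pi; have h1 := h true; have h2 := h false; rewrite -/KG in h1 h2.
rewrite /dGe Rabs_mult (Rabs_right (/ _)); first lra.
have hMK : 0 <= M * KG by apply: Rmult_le_pos; lra.
apply: (Rle_trans _ (/ 4 * (4 * (M * KG)))); last lra.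
apply: Rmult_le_compat; try lra; first exact: Rabs_pos.
move: h1 h2 => /Rabs_le_between h1 /Rabs_le_between h2; apply: Rabs_le; lra.
Qed.

Lemma Ge_lip_line e f M i x a b : srcf f M -> 0 < e <= 1 -> q2 (upc i x a) <= 1 -> q2 (upc i x b) <= 1 ->
  Rabs (Ge e f (upc i x b) - Ge e f (upc i x a)) <= M * KG * Rabs (b - a).
Proof.
move=> hs he ha hb; have [hf _] := hs.
have [c [hc ->]] := MVT_line i (Ge e f) (dGe e f i) x a b (fun y => pd_Ge e f i y (proj1 he) hf).
rewrite Rabs_mult; apply: Rmult_le_compat_r; first exact: Rabs_pos.
apply: dGe_bound => //.
have hc2 : c ^ 2 <= a ^ 2 \/ c ^ 2 <= b ^ 2.
  move: hc; rewrite /Rmin /Rmax; case: Rle_dec => h hc.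
    case: (Rle_dec 0 c) => h0; [right | left]; nra.
  case: (Rle_dec 0 c) => h0; [left | right]; nra.
move: ha hb; rewrite /q2; case: i => /= ha hb; rewrite /= in hc2; lra.
Qed.

Lemma Ge_lip e f M x y : srcf f M -> 0 < e <= 1 -> q2 x <= 1 -> q2 y <= 1 ->
  Rabs (Ge e f x - Ge e f y) <= M * KG * dist1 x y.
Proof.
move=> hs he hx hy.
(* The two values add up to [q2 x + q2 y <= 2], so one of the two axis-parallel paths from [x] to
   [y] has its corner in the disc. *)
have hc : q2 (fst x, snd y) <= 1 \/ q2 (fst y, snd x) <= 1.
  move: hx hy; rewrite /q2 /= => hx hy; lra.
case: hc => hc.
  have h1 := Ge_lip_line e f M false x (snd y) (snd x) hs he hc ltac:(by rewrite /= -surjective_pairing).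
  have h2 := Ge_lip_line e f M true y (fst y) (fst x) hs he ltac:(by rewrite /= -surjective_pairing) hc.
  rewrite /= -!surjective_pairing in h1 h2.
  have -> : Ge e f x - Ge e f y = (Ge e f x - Ge e f (fst x, snd y)) + (Ge e f (fst x, snd y) - Ge e f y) by ring.
  apply: Rle_trans (Rabs_triang _ _) _; rewrite /dist1; lra.
have h1 := Ge_lip_line e f M true x (fst y) (fst x) hs he hc ltac:(by rewrite /= -surjective_pairing).
have h2 := Ge_lip_line e f M false y (snd y) (snd x) hs he ltac:(by rewrite /= -surjective_pairing) hc.
rewrite /= -!surjective_pairing in h1 h2.
have -> : Ge e f x - Ge e f y = (Ge e f x - Ge e f (fst y, snd x)) + (Ge e f (fst y, snd x) - Ge e f y) by ring.
apply: Rle_trans (Rabs_triang _ _) _; rewrite /dist1; lra.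
Qed.

Lemma Green_lip_in f M x y : srcf f M -> q2 x <= 1 -> q2 y <= 1 ->
  Rabs (Green f x - Green f y) <= M * KG * dist1 x y.
Proof.
move=> hs hx hy.
have l := is_lim_seq_abs _ (Finite _) (is_lim_seq_minus' _ _ _ _ (Ge_lim f M x hs hx) (Ge_lim f M y hs hy)).
apply: (is_lim_seq_le _ _ (Finite _) (Finite _) _ l (is_lim_seq_const _)) => n.
apply: Ge_lip => //; exact: sq_pos.
Qed.

Lemma cross_bdry x y : q2 x <= 1 -> 1 <= q2 y -> exists z, q2 z = 1 /\ dist1 x z <= dist1 x y.
Proof.
move=> hx hy.
pose p s := (fst x + s * (fst y - fst x), snd x + s * (snd y - snd x)).
have hc : forall s, continuity_pt (fun s => q2 (p s) - 1) s.
  move=> s; apply/continuity_pt_filterlim; have : cont (fun s => q2 (p s) - 1) by rewrite /p /q2 /=; ctac.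
  by apply.
have p0 : p 0 = x by rewrite /p; case: (x) => a b /=; congr pair; ring.
have p1 : p 1 = y by rewrite /p; case: (y) => a b /=; congr pair; ring.
have [s hs] : {s | 0 <= s <= 1 /\ q2 (p s) - 1 = 0}.
  case: (Req_EM_T (q2 x) 1) => e1; first by exists 0; rewrite p0; lra.
  case: (Req_EM_T (q2 y) 1) => e2; first by exists 1; rewrite p1; lra.
  apply: (IVT (fun s => q2 (p s) - 1) 0 1) => //; rewrite ?p0 ?p1; lra.
exists (p s); split; first lra.
rewrite /dist1 /p /=.
have -> : fst x - (fst x + s * (fst y - fst x)) = s * (fst x - fst y) by ring.
have -> : snd x - (snd x + s * (snd y - snd x)) = s * (snd x - snd y) by ring.
rewrite !Rabs_mult (Rabs_right s); first lra.
have := Rabs_pos (fst x - fst y); have := Rabs_pos (snd x - snd y); nra.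
Qed.

Lemma lip_ext (u : pt -> R) L : 0 <= L -> (forall x, 1 <= q2 x -> u x = 0) ->
  (forall x y, q2 x <= 1 -> q2 y <= 1 -> Rabs (u x - u y) <= L * dist1 x y) ->
  forall x y, Rabs (u x - u y) <= L * dist1 x y.
Proof.
move=> hL h0 h.
have hio : forall x y, q2 x <= 1 -> 1 <= q2 y -> Rabs (u x - u y) <= L * dist1 x y.
  move=> x y hx hy; have [z [hz1 hz2]] := cross_bdry x y hx hy.
  rewrite (h0 y) // -(h0 z); first lra.
  apply: Rle_trans (h x z hx _) _; first lra. exact: Rmult_le_compat_l.
move=> x y; case: (Rle_dec (q2 x) 1) => hx; case: (Rle_dec (q2 y) 1) => hy.
- exact: h.
- apply: hio; lra.
- rewrite Rabs_minus_sym dist1_sym; apply: hio; lra.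
- rewrite !h0; try lra. rewrite Rminus_diag Rabs_R0; apply: Rmult_le_pos => //; exact: dist1_ge0.
Qed.

Lemma Green_lip f M x y : srcf f M -> Rabs (Green f x - Green f y) <= M * KG * dist1 x y.
Proof.
move=> hs; apply: lip_ext.
- apply: Rmult_le_pos; [exact: (srcf_M0 f) | exact: Rlt_le KG_pos].
- exact: Green_out.
- move=> a b; exact: Green_lip_in.
Qed.

Lemma lip_cont (u : pt -> R) L : (forall x y, Rabs (u x - u y) <= L * dist1 x y) -> cont u.
Proof.
move=> h x; apply/filterlim_locally => eps; have hp := cond_pos eps.
have hq : 0 < eps / (2 * (Rabs L + 1)).
  apply: Rdiv_lt_0_compat => //; have := Rabs_pos L; lra.
exists (mkposreal _ hq) => y [].
rewrite /ball /= /AbsRing_ball /abs /minus /plus /opp /= => h1 h2.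
apply: Rle_lt_trans (h y x) _.
have hd : dist1 y x < 2 * (eps / (2 * (Rabs L + 1))) by move: h1 h2; rewrite /dist1 /Rminus /=; lra.
have hL := Rle_abs L; have hL0 := Rabs_pos L; have d0 := dist1_ge0 y x.
have e1 : (Rabs L + 1) * (2 * (eps / (2 * (Rabs L + 1)))) = eps by field; lra.
nra.
Qed.

Lemma Green_cont f M : srcf f M -> cont (Green f).
Proof. move=> hs; apply: (lip_cont _ (M * KG)) => x y; exact: Green_lip. Qed.

(** * Symmetry of the Green operator *)

Lemma Ge_sym e f g M N : srcf f M -> srcf g N -> 0 < e ->
  I2 (fun x => g x * Ge e f x) = I2 (fun x => f x * Ge e g x).
Proof.
move=> [hf _] [hg _] he.
have kc : forall D (a b : pt * pt -> pt), (forall z, continuous a z) -> (forall z, continuous b z) -> cont (fun z => k0 D e (a z) (b z)).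
  by move=> D a b ha hb; exact: cont_k0.
have c1 : cont (fun z : pt * pt => k0 true e (fst z) (snd z) - k0 false e (fst z) (snd z)).
  apply: cont_minus; apply: kc => z; try exact: continuous_fst; exact: continuous_snd.
have cg : cont (fun z : pt * pt => g (fst z)) by apply: (cont_comp _ _ fst) => // z; exact: continuous_fst.
have cf : cont (fun z : pt * pt => f (snd z)) by exact: cont_snd_f.
have cg' : cont (fun z : pt * pt => g (snd z)) by exact: cont_snd_f.
have cf' : cont (fun z : pt * pt => f (fst z)) by apply: (cont_comp _ _ fst) => // z; exact: continuous_fst.
have key : forall h1 h2, cont h1 -> cont h2 -> I2 (fun x => h1 x * Ge e h2 x) =
   / (4 * PI) * I2 (fun x => I2 (fun y => h1 x * ((k0 true e x y - k0 false e x y) * h2 y))).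
  move=> h1 h2 ch1 ch2.
  have cin : forall x, cont (fun y => (k0 true e x y - k0 false e x y) * h2 y).
    move=> x; apply: cont_mult => //; apply: cont_minus; exact: cont_k0s.
  rewrite -I2_scal.
    apply: (cont_I2 _ (fun z : pt * pt => h1 (fst z) * ((k0 true e (fst z) (snd z) - k0 false e (fst z) (snd z)) * h2 (snd z)))).
    apply: cont_mult; first by apply: (cont_comp _ _ fst) => // z; exact: continuous_fst.
    apply: cont_mult => //; exact: cont_snd_f.
  apply: I2_ext => x _; rewrite Ge_kernel // I2_scal //; ring.
rewrite (key g f hg hf) (key f g hf hg); apply: Rmult_eq_compat_l.
rewrite (I2_swap (fun z => g (fst z) * ((k0 true e (fst z) (snd z) - k0 false e (fst z) (snd z)) * f (snd z)))).
  by apply: cont_mult => //; apply: cont_mult.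
apply: I2_ext => x _; apply: I2_ext => y _ /=.
have -> : k0 true e y x = k0 true e x y by rewrite /k0 /= DD_sym.
have -> : k0 false e y x = k0 false e x y by rewrite /k0 /= rho2_sym.
ring.
Qed.

Lemma I2_Ge_Green f g M N e : srcf f M -> srcf g N -> 0 < e <= 1 ->
  Rabs (I2 (fun x => g x * Ge e f x) - I2 (fun x => g x * Green f x)) <= 4 * (N * (M * KG)) * Rpower e (/ 2).
Proof.
move=> hf hg he; have [cf _] := hf; have [cg [g0 gN]] := hg.
have c1 : cont (Ge e f) by apply: cont_Ge => //; lra.
have c2 := Green_cont f M hf.
rewrite -I2_minus; try exact: cont_mult.
rewrite Rmult_assoc; apply: I2_abs_const.
  by apply: cont_minus; apply: cont_mult.
move=> x _; rewrite -Rmult_minus_distr_l Rmult_assoc Rmult_comm.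
have h := mul_src_bound g N (Ge e f x - Green f x) (M * KG * Rpower e (/ 2)) x hg (fun hx => Ge_Green e f M x hf hx he).
apply: h; apply: Rmult_le_pos; last exact: Rlt_le (Rpower_pos _ _).
apply: Rmult_le_pos; [exact: srcf_M0 hf | exact: Rlt_le KG_pos].
Qed.

Lemma Green_sym f g M N : srcf f M -> srcf g N ->
  I2 (fun x => g x * Green f x) = I2 (fun x => f x * Green g x).
Proof.
move=> hf hg.
have l : forall f g M N, srcf f M -> srcf g N -> is_lim_seq (fun n => I2 (fun x => g x * Ge (sq n) f x)) (I2 (fun x => g x * Green f x)).
  move=> f1 g1 M1 N1 h1 h2.
  apply: (seq_rate _ _ (4 * (N1 * (M1 * KG))) (/ 2)); try lra.
    have := srcf_M0 _ _ h1; have := srcf_M0 _ _ h2; have := KG_pos => a b c.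
    have : 0 <= N1 * (M1 * KG) by apply: Rmult_le_pos => //; apply: Rmult_le_pos => //; lra.
    lra.
  move=> n; apply: I2_Ge_Green => //; exact: sq_pos.
have l1 := l f g M N hf hg; have l2 := l g f N M hg hf.
have l3 : is_lim_seq (fun n => I2 (fun x => g x * Ge (sq n) f x)) (I2 (fun x => f x * Green g x)).
  apply: (is_lim_seq_ext _ _ _ _ l2) => n; symmetry; apply: (Ge_sym _ f g M N) => //; exact: (proj1 (sq_pos n)).
have e1 := is_lim_seq_unique _ _ l1; have e3 := is_lim_seq_unique _ _ l3.
exact (f_equal real (eq_trans (eq_sym e1) e3)).
Qed.

(** * Maximum principle and reflections *)

Opaque I2 Green.

(** Each vertical slice is minimised first. The slice minimum is continuous in [x] by [near_unif],
    although the chosen minimiser [Y] may jump, and is then minimised in turn. *)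
Lemma min_Q (W : pt -> R) : cont W -> exists z, inQ z /\ forall y, inQ y -> W z <= W y.
Proof.
move=> hW.
have sl : forall x, exists y, -1 <= y <= 1 /\ forall y', -1 <= y' <= 1 -> W (x, y) <= W (x, y').
  move=> x; have [y [h1 h2]] := continuity_ab_min (fun y => W (x, y)) (-1) 1 ltac:(lra)
    (fun c _ => proj2 (continuity_pt_filterlim _ _) (cont_slice _ W x hW c)).
  by exists y.
pose Y x := proj1_sig (constructive_indefinite_description _ (sl x)).
have hY : forall x, -1 <= Y x <= 1 /\ forall y', -1 <= y' <= 1 -> W (x, Y x) <= W (x, y').
  by move=> x; rewrite /Y; case: constructive_indefinite_description.
have hc : forall x, continuous (fun x => W (x, Y x)) x.
  move=> x; apply/filterlim_locally => eps.
  apply: filter_imp (near_unif _ W (-1) 1 x eps hW) => t ht.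
  have [a1 a2] := hY x; have [b1 b2] := hY t.
  have h1 := ht (Y x) a1; have h2 := ht (Y t) b1.
  have h3 := b2 (Y x) a1; have h4 := a2 (Y t) b1.
  move: h1 h2 => /Rabs_lt_between h1 /Rabs_lt_between h2.
  have H : forall p q r s e : R, - e < q - r < e -> - e < p - s < e -> p <= q -> r <= s -> Rabs (p + - r) < e.
    move=> *; apply: Rabs_def1; lra.
  exact: (H _ _ _ _ _ h1 h2 h3 h4).
have [x [h1 h2]] := continuity_ab_min (fun x => W (x, Y x)) (-1) 1 ltac:(lra)
    (fun c _ => proj2 (continuity_pt_filterlim _ _) (hc c)).
exists (x, Y x); split; first by split => //; exact: (proj1 (hY x)).
move=> [a b] [/= ha hb]; apply: Rle_trans (h1 a ha) _; exact: (proj2 (hY a)).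
Qed.

(** If [l < 0], then [h'] lies below [h' t0] just to the right of [t0] and above it just to the
    left. According to the sign of [h' t0], [h] falls below [h t0] on the right or on the left. *)
Lemma second_deriv_min (h h' : R -> R) (t0 r l : R) : 0 < r ->
  (forall t, Rabs (t - t0) < r -> is_derive h t (h' t) /\ h t0 <= h t) ->
  is_derive h' t0 l -> 0 <= l.
Proof.
move=> hr hh hl; case: (Rle_dec 0 l) => // hn; exfalso.
have := hl => /is_derive_Reals /(_ (- l) ltac:(lra)) [del hdel].
pose s := Rmin r del / 2.
have hs : 0 < s /\ s < r /\ s < del.
  have d1 := cond_pos del; have := Rmin_l r del; have := Rmin_r r del.
  have : 0 < Rmin r del by apply: Rmin_glb_lt.
  rewrite /s; lra.
have sgn : forall k, k <> 0 -> Rabs k < del -> (h' (t0 + k) - h' t0) / k < 0.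
  move=> k k0 kd; have := hdel k k0 kd => /Rabs_lt_between; lra.
have mv : forall a b, a < b -> t0 - r < a -> b < t0 + r -> exists c, a <= c <= b /\ h b - h a = h' c * (b - a).
  move=> a b hab ha hb.
  apply: MVT_le => [|t ht]; first lra.
  apply: (proj1 (hh t _)); apply: Rabs_def1; lra.
case: (Rle_dec (h' t0) 0) => hc.
- have [c [hc1 hc2]] := mv t0 (t0 + s / 2) ltac:(lra) ltac:(lra) ltac:(lra).
  have h1 := proj2 (hh (t0 + s) ltac:(rewrite Rabs_right; lra)).
  have hnc : h' c <= 0.
    case: (Req_dec c t0) => [->|hne] //.
    have := sgn (c - t0) ltac:(lra) ltac:(rewrite Rabs_right; lra).
    have -> : t0 + (c - t0) = c by ring.
    move=> /Rlt_div_l hq; have := hq ltac:(lra); lra.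
  have h2 : h (t0 + s / 2) <= h t0 by nra.
  have [c' [hc1' hc2']] := mv (t0 + s / 2) (t0 + s) ltac:(lra) ltac:(lra) ltac:(lra).
  have := sgn (c' - t0) ltac:(lra) ltac:(rewrite Rabs_right; lra).
  have -> : t0 + (c' - t0) = c' by ring.
  move=> /Rlt_div_l hq; have h3 := hq ltac:(lra).
  nra.
- have [c [hc1 hc2]] := mv (t0 - s) t0 ltac:(lra) ltac:(lra) ltac:(lra).
  have h1 := proj2 (hh (t0 - s) ltac:(rewrite Rabs_left; lra)).
  have hpc : 0 < h' c.
    case: (Req_dec c t0) => [->|hne]; first lra.
    have := sgn (c - t0) ltac:(lra) ltac:(rewrite Rabs_left; lra).
    have -> : t0 + (c - t0) = c by ring.
    have -> : (h' c - h' t0) / (c - t0) = (h' t0 - h' c) / (t0 - c) by field; lra.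
    move=> /Rlt_div_l hq; have := hq ltac:(lra); lra.
  nra.
Qed.

(** Subtracting [e q2] makes the differential inequality strict. With [e = - W x1 / 4], and
    [q2 <= 2] on the square, the minimum point of [W - e q2] still has [W < 0], so it lies in the
    open disc, and the second-order condition there contradicts [l true + l false <= 0]. *)
Lemma min_principle (W : pt -> R) : cont W ->
  (forall x, inQ x -> W x < 0 -> q2 x < 1 /\ exists (d : bool -> pt -> R) (l : bool -> R),
     locally x (fun y => forall i, pd i W y (d i y)) /\ (forall i, pd i (d i) x (l i)) /\ l true + l false <= 0) ->
  forall x, inQ x -> 0 <= W x.
Proof.
move=> hW h x1 hx1; case: (Rle_dec 0 (W x1)) => // hn; exfalso.
pose e := - W x1 / 4; have he : 0 < e by rewrite /e; lra.
have cV : cont (fun x => W x - e * q2 x) by apply: cont_minus => //; rewrite /q2; ctac.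
have [z [hz hmin]] := min_Q _ cV.
have qz : q2 z <= 2.
  case: (hz) => a1 a2; rewrite /q2.
  have b1 : fst z ^ 2 <= 1 by nra.
  have b2 : snd z ^ 2 <= 1 by nra.
  lra.
have h1 := hmin x1 hx1; have q1 := q2_ge0 x1.
have e4 : W x1 = - 4 * e by rewrite /e; field.
have hWz : W z < 0 by clearbody e; nra.
have [hd [d [l [h2 [h3 h4]]]]] := h z hz hWz.
have hloc : locally z (fun y => (forall i, pd i W y (d i y)) /\ q2 y < 1) by apply: filter_and => //; exact: locally_disc.
have key : forall i, 0 <= l i - 2 * e.
  move=> i.
  have [r hr] := locally_line i z (fun y => (forall i, pd i W y (d i y)) /\ q2 y < 1) hloc.
  apply: (second_deriv_min (fun t => W (upc i z t) - e * q2 (upc i z t)) (fun t => d i (upc i z t) - e * (2 * t)) (co i z) r).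
  - exact: cond_pos.
  - move=> t ht; have [a1 a2] := hr t ht; split.
      apply: (is_derive_minus (V := R_NormedModule)).
        exact: (pd_line i W z t _ (a1 i)).
      apply: is_derive_scal; rewrite /q2; case: (i) => /=; auto_derive => //; ring.
    rewrite !up_co; apply: hmin; apply: q2_inQ; lra.
  - apply: (is_derive_minus (V := R_NormedModule)); first exact: h3.
    auto_derive => //; ring.
have := key true; have := key false; lra.
Qed.

Lemma chain_pd i (u : pt -> R) (d : bool -> pt -> R) (P Q : pt -> R) (P' Q' : R) x :
  (forall i y, q2 y < 1 -> continuous (d i) y) -> (forall i y, q2 y < 1 -> pd i u y (d i y)) ->
  pd i P x P' -> pd i Q x Q' -> q2 (P x, Q x) < 1 ->
  pd i (fun x => u (P x, Q x)) x (d true (P x, Q x) * P' + d false (P x, Q x) * Q').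
Proof.
move=> hc hd hP hQ hx; rewrite /pd; apply/is_derive_Reals.
have e0 : x = upc i x (co i x) by rewrite up_co.
apply: (derivable_pt_lim_comp_2d (fun a b => u (a, b)) (fun t => P (upc i x t)) (fun t => Q (upc i x t))); last first.
- apply/is_derive_Reals; exact: hQ.
- apply/is_derive_Reals; exact: hP.
rewrite !up_co.
apply/filterdiff_differentiable_pt_lim.
apply: (is_derive_filterdiff (fun a b => u (a, b)) (P x) (Q x) (fun a b => d true (a, b)) (d false (P x, Q x))).
- by apply: filter_imp (locally_disc _ hx) => y hy; move: (hd true y hy); rewrite /pd /=; case: (y).
- exact: (hd false _ hx).
- apply: (continuous_ext (d true)); first by case.
  exact: hc.
Qed.

Definition refl (c s : R) (x : pt) : pt :=
  (fst x - 2 * (c * fst x + s * snd x) * c, snd x - 2 * (c * fst x + s * snd x) * s).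

(* Such functions are even in the angle and nonincreasing in it on [0, PI] ([conep_pol], [conep_even]). *)
Definition conep (w : pt -> R) : Prop :=
  forall c s, c ^ 2 + s ^ 2 = 1 -> 0 <= c -> forall x, 0 <= c * fst x + s * snd x -> w (refl c s x) <= w x.

Lemma q2_refl c s x : c ^ 2 + s ^ 2 = 1 -> q2 (refl c s x) = q2 x.
Proof.
move=> h; rewrite /q2 /refl /=.
have -> : (fst x - 2 * (c * fst x + s * snd x) * c) ^ 2 + (snd x - 2 * (c * fst x + s * snd x) * s) ^ 2
  = fst x ^ 2 + snd x ^ 2 + 4 * (c * fst x + s * snd x) ^ 2 * (c ^ 2 + s ^ 2 - 1) by ring.
rewrite h; ring.
Qed.

Lemma pd_minus i F G x l m : pd i F x l -> pd i G x m -> pd i (fun x => F x - G x) x (l - m).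
Proof. move=> h h'; exact: (is_derive_minus (V := R_NormedModule) _ _ _ _ _ h h'). Qed.

Lemma pd_plus i F G x l m : pd i F x l -> pd i G x m -> pd i (fun x => F x + G x) x (l + m).
Proof. move=> h h'; exact: (is_derive_plus (V := R_NormedModule) _ _ _ _ _ h h'). Qed.

Lemma pd_scal i F x l c : pd i F x l -> pd i (fun x => c * F x) x (c * l).
Proof. move=> h; exact: (is_derive_scal _ _ c _ h). Qed.

Lemma cont_refl c s : forall z, continuous (refl c s) z.
Proof.
move=> z; apply: continuous_pair.
  suff : cont (fun x : pt => fst x - 2 * (c * fst x + s * snd x) * c) by apply. ctac.
suff : cont (fun x : pt => snd x - 2 * (c * fst x + s * snd x) * s) by apply. ctac.
Qed.

(** The Jacobian of [refl c s]: component [j] differentiated in coordinate [i]. *)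
Definition sg (c s : R) (j i : bool) : R :=
  match j, i with
  | true, true => 1 - 2 * c * c | true, false => - (2 * s * c)
  | false, true => - (2 * c * s) | false, false => 1 - 2 * s * s end.

Lemma pd_refl1 c s i x : pd i (fun x => fst (refl c s x)) x (sg c s true i).
Proof. rewrite /pd /refl /sg; case: i => /=; auto_derive => //; ring. Qed.
Lemma pd_refl2 c s i x : pd i (fun x => snd (refl c s x)) x (sg c s false i).
Proof. rewrite /pd /refl /sg; case: i => /=; auto_derive => //; ring. Qed.

Lemma pd_comp_refl c s i (u : pt -> R) (d : bool -> pt -> R) x : c ^ 2 + s ^ 2 = 1 ->
  (forall i y, q2 y < 1 -> continuous (d i) y) -> (forall i y, q2 y < 1 -> pd i u y (d i y)) -> q2 x < 1 ->
  pd i (fun x => u (refl c s x)) x (sg c s true i * d true (refl c s x) + sg c s false i * d false (refl c s x)).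
Proof.
move=> hcs hc hd hx.
have := chain_pd i u d _ _ _ _ x hc hd (pd_refl1 c s i x) (pd_refl2 c s i x).
rewrite -!surjective_pairing q2_refl // => /(_ hx).
by rewrite (Rmult_comm (d true _)) (Rmult_comm (d false _)).
Qed.

(** On the half disc in front of the mirror, [u] minus its reflection vanishes on the boundary, and
    the cone inequality for [f] makes it superharmonic. To use [min_principle] on the whole square,
    [pr] projects the other half plane onto the mirror, so that [W] is continuous and equals 0
    there. *)
Lemma poisson_cone u f : cont u -> (forall x, 1 <= q2 x -> u x = 0) -> poisson u f -> conep f -> conep u.
Proof.
move=> cu u0 [d [h [hdc [hhc [hd [hh hf]]]]]] hcone c s hcs hc.
pose dp (x : pt) := c * fst x + s * snd x.
pose mn x := - Rmax 0 (- dp x).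
pose pr (x : pt) : pt := (fst x - mn x * c, snd x - mn x * s).
pose W x := u (pr x) - u (refl c s (pr x)).
have cmn : cont mn by rewrite /mn /dp; ctac.
have cpr : forall z, continuous pr z.
  move=> z; apply: continuous_pair.
    suff : cont (fun x : pt => fst x - mn x * c) by apply. ctac.
  suff : cont (fun x : pt => snd x - mn x * s) by apply. ctac.
have cW : cont W.
  apply: cont_minus; apply: cont_comp => //.
  move=> z; apply: continuous_comp; [exact: cpr | exact: cont_refl].
have dppr : forall x, dp x <= 0 -> dp (pr x) = 0.
  move=> x hx; have hm : mn x = dp x by rewrite /mn Rmax_right; lra.
  have -> : dp (pr x) = dp x - mn x * (c ^ 2 + s ^ 2) by rewrite /dp /pr /=; ring.
  rewrite hcs hm; ring.
have W0 : forall x, dp x <= 0 -> W x = 0.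
  move=> x hx; have e := dppr x hx.
  have er : refl c s (pr x) = pr x.
    rewrite /refl -/(dp (pr x)) e; case: (pr x) => a b /=; congr pair; ring.
  by rewrite /W er; ring.
have pr1 : forall x, 0 <= dp x -> pr x = x.
  move=> x hx; have hm : mn x = 0 by rewrite /mn Rmax_left; lra.
  rewrite /pr hm; case: (x) => a b /=; congr pair; ring.
have hW : forall x, inQ x -> 0 <= W x.
  apply: min_principle => // x hx hneg.
  have hdp : 0 < dp x by case: (Rlt_dec 0 (dp x)) => // hn; have := W0 x ltac:(lra); lra.
  have hqx : q2 x < 1.
    case: (Rlt_dec (q2 x) 1) => // hn; move: hneg; rewrite /W pr1; first lra.
    rewrite (u0 x) ?u0 ?q2_refl //; lra.
  split => //.
  have cdp : cont dp by rewrite /dp; ctac.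
  have locdp : locally x (fun y => 0 < dp y).
    have := cdp x => /filterlim_locally /(_ (mkposreal _ hdp)); apply: filter_imp => y.
    rewrite /ball /= /AbsRing_ball /abs /minus /plus /opp /= => /Rabs_lt_between; lra.
  pose d' i y := d i y - (sg c s true i * d true (refl c s y) + sg c s false i * d false (refl c s y)).
  have pdW0 : forall y i, q2 y < 1 -> pd i (fun y => u y - u (refl c s y)) y (d' i y).
    move=> y i hy; apply: pd_minus; first exact: hd. exact: pd_comp_refl.
  exists d', (fun i => h i i x - (sg c s true i * (sg c s true i * h true true (refl c s x) + sg c s false i * h true false (refl c s x))
     + sg c s false i * (sg c s true i * h false true (refl c s x) + sg c s false i * h false false (refl c s x)))).
  split; [|split].
  - have ll0 : locally x (fun y => 0 < dp y /\ q2 y < 1) by apply: filter_and => //; exact: locally_disc.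
    have ll := locally_locally _ _ ll0.
    apply: filter_imp ll => y ly i.
    have [_ hy2] := locally_singleton _ _ ly.
    apply: (pd_ext_loc _ (fun y => u y - u (refl c s y))); last exact: pdW0.
    apply: filter_imp ly => w [hw _]; rewrite /W pr1 //; lra.
  - move=> i; apply: pd_minus; first exact: hh.
    have a : forall k, pd i (fun x => d k (refl c s x)) x (sg c s true i * h k true (refl c s x) + sg c s false i * h k false (refl c s x)).
      move=> k; apply: (pd_comp_refl c s i (d k) (h k)) => //; move=> j y hy; [exact: hhc | exact: hh].
    apply: pd_plus; apply: pd_scal; exact: a.
  - have h1 := hf x hqx; have h2 := hf (refl c s x) ltac:(by rewrite q2_refl).
    have h3 := hcone c s hcs hc x (Rlt_le _ _ hdp).
    move: h1 h2; set a := h true true (refl c s x); set b := h false false (refl c s x).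
    set m := h true false (refl c s x); set n := h false true (refl c s x).
    rewrite /sg => h1 h2.
    (* Invariance of the Laplacian: [sg] is orthogonal, so conjugating the Hessian by it preserves
       the trace. *)
    have e1 : (1 - 2 * c * c) * ((1 - 2 * c * c) * a + - (2 * c * s) * m) + - (2 * c * s) * ((1 - 2 * c * c) * n + - (2 * c * s) * b)
       + (- (2 * s * c) * (- (2 * s * c) * a + (1 - 2 * s * s) * m) + (1 - 2 * s * s) * (- (2 * s * c) * n + (1 - 2 * s * s) * b)) = a + b.
      have es : s ^ 2 = 1 - c ^ 2 by lra.
      ring_simplify.
      have e4 : s ^ 4 = (1 - c ^ 2) ^ 2 by rewrite -es; ring.
      have e3 : s ^ 3 = s * (1 - c ^ 2) by rewrite -es; ring.
      rewrite ?e4 ?e3 ?es; ring.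
    lra.
move=> x hx.
case: (Rlt_dec (q2 x) 1) => hq; last by rewrite !u0 ?q2_refl; lra.
have := hW x (q2_inQ x ltac:(lra)); rewrite /W pr1 //; lra.
Qed.

(** Sources are compared only where [u < v]. This lets each source depend on the other solution, as
    happens for the 2-periodic limit of the iteration. *)
Lemma comparison u v F G : cont u -> cont v -> (forall x, 1 <= q2 x -> u x = 0) -> (forall x, 1 <= q2 x -> v x = 0) ->
  poisson u F -> poisson v G -> (forall x, u x < v x -> G x <= F x) -> forall x, v x <= u x.
Proof.
move=> cu cv u0 v0 [d [h [hdc [hhc [hd [hh hf]]]]]] [d' [h' [hdc' [hhc' [hd' [hh' hf']]]]]] hFG x.
case: (Rlt_dec (q2 x) 1) => hq; last by rewrite u0 ?v0; lra.
suff : 0 <= u x - v x by lra.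
apply: (min_principle (fun x => u x - v x)); last by apply: q2_inQ; lra.
  exact: cont_minus.
move=> y hy hn.
have hqy : q2 y < 1 by case: (Rlt_dec (q2 y) 1) => // hn'; move: hn; rewrite u0 ?v0; lra.
split => //; exists (fun i y => d i y - d' i y), (fun i => h i i y - h' i i y); split; [|split].
- apply: filter_imp (locally_disc y hqy) => w hw i; apply: pd_minus; [exact: hd | exact: hd'].
- move=> i; apply: pd_minus; [exact: hh | exact: hh'].
- have h1 := hf y hqy; have h2 := hf' y hqy; have h3 := hFG y ltac:(lra); lra.
Qed.

(** * Powers and the Hoelder inequality *)

(** [Rpower] has junk values for bases [t <= 0]; [pw] is the power of the positive part, continuous
    for [0 < a]. *)
Definition pw (a t : R) : R := if Rle_dec t 0 then 0 else Rpower t a.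

Lemma pw_pos a t : 0 < t -> pw a t = Rpower t a.
Proof. rewrite /pw; case: Rle_dec => //; lra. Qed.
Lemma pw_npos a t : t <= 0 -> pw a t = 0.
Proof. rewrite /pw; case: Rle_dec => //; lra. Qed.
Lemma pw_0 a : pw a 0 = 0. Proof. apply: pw_npos; lra. Qed.
Lemma pw_gt0 a t : 0 < t -> 0 < pw a t.
Proof. move=> h; rewrite pw_pos //; exact: Rpower_pos. Qed.
Lemma pw_ge0 a t : 0 <= pw a t.
Proof. rewrite /pw; case: Rle_dec => h; [lra | exact: Rlt_le (Rpower_pos _ _)]. Qed.
Lemma pw_1r a : pw a 1 = 1.
Proof. rewrite pw_pos; [lra | by rewrite /Rpower ln_1 Rmult_0_r exp_0]. Qed.
Lemma pw_1l t : 0 <= t -> pw 1 t = t.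
Proof. case=> [h|<-]; [by rewrite pw_pos // Rpower_1 | exact: pw_0]. Qed.
Lemma pw_mono a s t : 0 <= a -> s <= t -> pw a s <= pw a t.
Proof.
move=> ha hst; rewrite /pw; case: Rle_dec => h1; case: Rle_dec => h2; try lra.
  exact: Rlt_le (Rpower_pos _ _).
apply: Rle_Rpower_l => //; lra.
Qed.
Lemma pw_mult a s t : 0 <= s -> 0 <= t -> pw a (s * t) = pw a s * pw a t.
Proof.
move=> [hs|<-] [ht|<-]; rewrite ?Rmult_0_l ?Rmult_0_r ?pw_0 ?Rmult_0_l ?Rmult_0_r //.
rewrite !pw_pos //; last by rewrite Rpower_mult_distr.
exact: Rmult_lt_0_compat.
Qed.
Lemma pw_plus a b t : pw (a + b) t = pw a t * pw b t.
Proof. rewrite /pw; case: Rle_dec => h; [ring | exact: Rpower_plus]. Qed.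
Lemma pw_pw a b t : pw a (pw b t) = pw (b * a) t.
Proof.
case: (Rle_dec t 0) => h; first by rewrite !(pw_npos _ t) // pw_0.
rewrite !(pw_pos _ t); try lra. rewrite pw_pos; first exact: Rpower_pos. exact: Rpower_mult.
Qed.
Lemma pw_inv a t : 0 < t -> pw a (/ t) = / pw a t.
Proof.
move=> h; have h' := Rinv_0_lt_compat _ h; rewrite !pw_pos //.
by rewrite /Rpower ln_Rinv // -exp_Ropp; congr exp; ring.
Qed.
Lemma bernoulli (n : nat) r : 0 <= r <= 1 -> 1 - INR n * (1 - r) <= r ^ n.
Proof.
move=> hr; elim: n => [|n IH]; first by rewrite /=; lra.
rewrite S_INR /=; have hn := pos_INR n.
have h1 := Rmult_le_compat_l r _ _ (proj1 hr) IH.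
have h2 : 0 <= INR n * (1 - r) ^ 2 by apply: Rmult_le_pos => //; exact: pow2_ge_0.
nra.
Qed.

(** Scaling by [t] reduces the claim to [1 - r^a] with [r] in [[0, 1]]; for an integer [n >= a]
    Bernoulli gives at most [n (1 - r)], which is at most [n (1 - r)^g]. *)
Lemma pw_holder_mono a g R0 : 0 < g <= 1 -> g <= a -> 0 < R0 -> exists C, 0 <= C /\
  forall s t, s <= t -> t <= R0 -> pw a t - pw a s <= C * pw g (t - s).
Proof.
move=> hg ha hR.
have [n hn] := INR_unbounded (Rmax a 1).
have hna : a <= INR n by have := Rmax_l a 1; lra.
have hn1 : 1 <= INR n by have := Rmax_r a 1; lra.
have hC : 0 <= INR n * pw (a - g) R0 by apply: Rmult_le_pos; [lra | exact: pw_ge0].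
exists (INR n * pw (a - g) R0); split => // s t hst htR.
case: (Rle_dec t 0) => ht0.
  rewrite (pw_npos a t) // (pw_npos a s); first lra. have := pw_ge0 g (t - s) => h; have := Rmult_le_pos _ _ hC h; lra.
have ht : 0 < t by lra.
have main : forall z, 0 <= z <= t -> pw a t - pw a z <= INR n * pw (a - g) R0 * pw g (t - z).
  move=> z hs.
  pose r := z / t.
  have hr : 0 <= r <= 1.
    split; first by apply: Rdiv_le_0_compat; lra. apply/Rle_div_l; lra.
  have es : z = t * r by rewrite /r; field; lra.
  clearbody r.
  have h1 : 1 - INR n * (1 - r) <= pw a r.
    case: (Req_dec r 0) => hr0.
      rewrite hr0 pw_0; lra.
    have hrp : 0 < r by lra.
    apply: Rle_trans (bernoulli n r hr) _; rewrite pw_pos // -Rpower_pow //.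
    rewrite /Rpower; apply: exp_le.
    have hl : ln r <= 0 by rewrite -ln_1; apply: ln_le; lra.
    have := Rmult_le_pos (INR n - a) (- ln r) ltac:(lra) ltac:(lra); lra.
  have h2 : 1 - r <= pw g (1 - r).
    case: (Req_dec (1 - r) 0) => hr0; first by rewrite hr0 pw_0; lra.
    rewrite pw_pos; first lra.
    apply: (Rle_trans _ (Rpower (1 - r) 1)); first by rewrite Rpower_1; lra.
    rewrite /Rpower; apply: exp_le.
    have hl : ln (1 - r) <= 0 by rewrite -ln_1; apply: ln_le; lra.
    have := Rmult_le_pos (1 - g) (- ln (1 - r)) ltac:(lra) ltac:(lra); lra.
  have -> : t - z = t * (1 - r) by rewrite es; ring.
  rewrite es !pw_mult; try lra.
  have -> : pw a t = pw (a - g) t * pw g t by rewrite -pw_plus; congr pw; ring.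
  have h3 : pw (a - g) t <= pw (a - g) R0 by apply: pw_mono; lra.
  have h4 := pw_ge0 g t; have h5 := pw_ge0 g (1 - r); have h6 := pw_ge0 (a - g) t.
  have h7 : 1 - pw a r <= INR n * pw g (1 - r).
    apply: (Rle_trans _ (INR n * (1 - r))); first lra. apply: Rmult_le_compat_l; lra.
  have -> : pw (a - g) t * pw g t - pw (a - g) t * pw g t * pw a r = (pw (a - g) t * pw g t) * (1 - pw a r) by ring.
  apply: (Rle_trans _ ((pw (a - g) t * pw g t) * (INR n * pw g (1 - r)))).
    apply: Rmult_le_compat_l => //; exact: Rmult_le_pos.
  have -> : INR n * pw (a - g) R0 * (pw g t * pw g (1 - r)) = (pw (a - g) R0) * (pw g t * (INR n * pw g (1 - r))) by ring.
  rewrite Rmult_assoc; apply: Rmult_le_compat_r => //.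
  apply: Rmult_le_pos => //; apply: Rmult_le_pos; lra.
case: (Rle_dec 0 s) => hs0; first exact: main.
rewrite (pw_npos a s); first lra. have := main 0 ltac:(lra); rewrite pw_0 => h.
apply: Rle_trans h _; apply: Rmult_le_compat_l => //; apply: pw_mono; lra.
Qed.

Lemma pw_holder a g R0 : 0 < g <= 1 -> g <= a -> 0 < R0 -> exists C, 0 <= C /\
  forall s t, s <= R0 -> t <= R0 -> Rabs (pw a t - pw a s) <= C * pw g (Rabs (t - s)).
Proof.
move=> hg ha hR; have [C [hC h]] := pw_holder_mono a g R0 hg ha hR.
exists C; split => // s t hs ht.
case: (Rle_dec s t) => hst.
  rewrite !Rabs_right; try lra; first by have := pw_mono a s t ltac:(lra) hst; lra.
  exact: h.
rewrite Rabs_minus_sym (Rabs_minus_sym t) !Rabs_right; try lra.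
  have := pw_mono a t s ltac:(lra) ltac:(lra); lra.
apply: h; lra.
Qed.

Lemma pw_small g e : 0 < g -> 0 < e -> exists d, 0 < d /\ forall t, t < d -> pw g t < e.
Proof.
move=> hg he; exists (Rpower e (/ g)); split; first exact: Rpower_pos.
move=> t ht; rewrite /pw; case: Rle_dec => // h.
have -> : e = Rpower (Rpower e (/ g)) g by rewrite Rpower_mult Rinv_l; [lra | rewrite Rpower_1; lra].
apply: Rlt_Rpower_l => //; lra.
Qed.

Lemma cont_pw1 a : 0 < a -> cont (pw a).
Proof.
move=> ha t; apply/filterlim_locally => eps; have he := cond_pos eps.
pose g := Rmin a 1.
have hg : 0 < g <= 1 by split; [apply: Rmin_glb_lt; lra | exact: Rmin_r].
have [C [hC h]] := pw_holder a g (Rabs t + 1) hg (Rmin_l _ _) ltac:(have := Rabs_pos t; lra).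
have [d [hd hds]] := pw_small g (eps / (C + 1)) (proj1 hg) ltac:(apply: Rdiv_lt_0_compat; lra).
have hm : 0 < Rmin d 1 by apply: Rmin_glb_lt; lra.
exists (mkposreal _ hm) => s; rewrite /ball /= /AbsRing_ball /abs /minus /plus /opp /= => hs.
have h1 := Rmin_l d 1; have h2 := Rmin_r d 1.
have ht := Rle_abs t.
have hst : s <= Rabs t + 1 by move: hs => /Rabs_lt_between; lra.
apply: Rle_lt_trans (h t s ltac:(lra) hst) _.
have h3 := hds (Rabs (s - t)) ltac:(rewrite /Rminus; lra).
have h4 := pw_ge0 g (Rabs (s - t)).
have e1 : (C + 1) * (eps / (C + 1)) = eps by field; lra.
nra.
Qed.

Lemma cont_pw (T : UniformSpace) a (f : T -> R) : 0 < a -> cont f -> cont (fun z => pw a (f z)).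
Proof. move=> ha hf; apply: cont_comp => //; exact: cont_pw1. Qed.

Lemma exp_ineq_strict z : z <> 0 -> 1 + z < exp z.
Proof. exact: exp_ineq1. Qed.

(* Tangent line of [exp] at the barycentre. *)
Lemma exp_convex la a b : 0 < la < 1 ->
  exp (la * a + (1 - la) * b) <= la * exp a + (1 - la) * exp b /\
  (exp (la * a + (1 - la) * b) = la * exp a + (1 - la) * exp b -> a = b).
Proof.
move=> hl; set m := la * a + (1 - la) * b.
have hm := exp_pos m.
have T : forall z, exp m * (1 + (z - m)) <= exp z.
  move=> z; have -> : exp z = exp m * exp (z - m) by rewrite -exp_plus; congr exp; ring.
  apply: Rmult_le_compat_l; first lra. exact: exp_ineq1_le.
have Ta := T a; have Tb := T b.
have e1 : la * (exp m * (1 + (a - m))) + (1 - la) * (exp m * (1 + (b - m))) = exp m by rewrite /m; ring.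
split; first nra.
move=> he; case: (Req_dec a b) => // hab; exfalso.
have ham : a - m <> 0.
  have -> : a - m = (1 - la) * (a - b) by rewrite /m; ring.
  apply: Rmult_integral_contrapositive_currified; lra.
have : exp m * (1 + (a - m)) < exp a.
  have -> : exp a = exp m * exp (a - m) by rewrite -exp_plus; congr exp; ring.
  apply: Rmult_lt_compat_l => //; exact: exp_ineq_strict.
nra.
Qed.

(** The defect in Young's inequality for the exponents [(p + 1) / p] and [p + 1]. Carrying the
    defect itself gives both Hoelder's inequality and its equality case. *)
Definition ydef p s t := p / (p + 1) * pw (p + 1) s + / (p + 1) * pw (p + 1) t - pw p s * t.

Lemma young p s t : 0 < p -> 0 <= s -> 0 <= t -> 0 <= ydef p s t /\ (ydef p s t = 0 -> s = t).
Proof.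
move=> hp hs ht; rewrite /ydef.
have c1 : 0 < p / (p + 1) by apply: Rdiv_lt_0_compat; lra.
have c2 : 0 < / (p + 1) by apply: Rinv_0_lt_compat; lra.
have g1 := pw_ge0 (p + 1) s; have g2 := pw_ge0 (p + 1) t.
case: hs => [hs|hs]; last first.
  rewrite -hs !pw_0; split; first nra.
  case: ht => [ht|//]. have := pw_gt0 (p + 1) t ht; nra.
case: ht => [ht|ht]; last first.
  rewrite -ht !pw_0; split; first nra. have := pw_gt0 (p + 1) s hs; nra.
have hl : 0 < p / (p + 1) < 1 by split => //; apply/Rlt_div_l; lra.
have [h1 h2] := exp_convex (p / (p + 1)) ((p + 1) * ln s) ((p + 1) * ln t) hl.
have e1 : exp (p / (p + 1) * ((p + 1) * ln s) + (1 - p / (p + 1)) * ((p + 1) * ln t)) = pw p s * t.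
  rewrite pw_pos // /Rpower -{2}(exp_ln t) // -exp_plus; congr exp; field; lra.
have e2 : 1 - p / (p + 1) = / (p + 1) by field; lra.
rewrite e1 e2 in h1 h2; rewrite !(pw_pos (p + 1)) // /Rpower.
split; first lra.
move=> h; have h3 := h2 ltac:(lra).
have : ln s = ln t by apply: (Rmult_eq_reg_l (p + 1)); lra.
exact: ln_inv.
Qed.

Section Src.
Variables (al p : R).
Hypotheses (hal : 0 < al) (hp : 1 < p).

Definition wgt (x : pt) : R := pw (al / 2) (q2 x).

Lemma cont_Wt : cont wgt.
Proof. apply: cont_pw; first lra. rewrite /q2; ctac. Qed.
Lemma Wt_ge0 x : 0 <= wgt x. Proof. exact: pw_ge0. Qed.
Lemma Wt_le1 x : q2 x <= 1 -> wgt x <= 1.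
Proof. move=> h; rewrite /wgt -(pw_1r (al / 2)); apply: pw_mono; lra. Qed.
Lemma Wt_pos x : 0 < q2 x -> 0 < wgt x.
Proof. exact: pw_gt0. Qed.

Definition hrhs (w : pt -> R) (x : pt) : R := wgt x * pw p (w x).

Definition good (w : pt -> R) (L B : R) : Prop :=
  (forall x, 0 <= w x <= B) /\ (forall x, 1 <= q2 x -> w x = 0) /\
  (forall x y, Rabs (w x - w y) <= L * dist1 x y).

Lemma good_cont w L B : good w L B -> cont w.
Proof. move=> [_ [_ h]]; exact: (lip_cont w L). Qed.
Lemma good_B0 w L B : good w L B -> 0 <= B.
Proof. move=> [h _]; have := h (0,0); lra. Qed.
Lemma good_L0 w L B : good w L B -> 0 <= L.
Proof.
move=> [_ [_ h]]; have := h (1,0) (0,0); rewrite /dist1 /= !Rminus_0_r Rabs_R1 Rabs_R0.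
have := Rabs_pos (w (1,0) - w (0,0)); lra.
Qed.

Lemma fs_ge0 w x : 0 <= hrhs w x.
Proof. apply: Rmult_le_pos; [exact: Wt_ge0 | exact: pw_ge0]. Qed.

Lemma cont_fs w : cont w -> cont (hrhs w).
Proof. move=> h; apply: cont_mult; [exact: cont_Wt | apply: cont_pw => //; lra]. Qed.

Lemma fs_srcf w L B : good w L B -> srcf (hrhs w) (pw p B).
Proof.
move=> hg; have [h1 [h2 h3]] := hg; split; first by apply: cont_fs; exact: (good_cont w L B).
split; first by move=> y hy; rewrite /hrhs h2 // pw_0; ring.
move=> y; rewrite Rabs_right; first exact: Rle_ge (fs_ge0 w y).
have hB := pw_ge0 p B.
case: (Rle_dec (q2 y) 1) => hy; last by rewrite /hrhs h2; [lra | rewrite pw_0; lra].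
have a1 := Wt_le1 y hy; have a2 := Wt_ge0 y; have a3 := pw_mono p (w y) B ltac:(lra) ltac:(have := h1 y; lra).
have a4 := pw_ge0 p (w y); rewrite /hrhs; nra.
Qed.

(** A Hoelder exponent of the weight, which is the power [al / 2] of the locally Lipschitz function
    [q2]. *)
Definition gam := Rmin (al / 2) 1.
Lemma gam01 : 0 < gam <= 1.
Proof. rewrite /gam; split; [apply: Rmin_glb_lt; lra | exact: Rmin_r]. Qed.

Lemma dist1_rho x y s : 0 < s -> rho2 x y <= s -> dist1 x y <= 2 * Rpower s (/ 2).
Proof.
move=> hs h; rewrite /rho2 in h.
have q1 := pow2_ge_0 (fst x - fst y); have q2 := pow2_ge_0 (snd x - snd y).
have a := sq_le_Rabs (fst x - fst y) s hs ltac:(lra).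
have b := sq_le_Rabs (snd x - snd y) s hs ltac:(lra).
rewrite /dist1; lra.
Qed.

Lemma q2_lip x y : inQ x -> inQ y -> Rabs (q2 x - q2 y) <= 2 * dist1 x y.
Proof.
move=> [a b] [c d]; rewrite /q2 /dist1.
have e : forall u v, -1 <= u <= 1 -> -1 <= v <= 1 -> Rabs (u ^ 2 - v ^ 2) <= 2 * Rabs (u - v).
  move=> u v hu hv; have -> : u ^ 2 - v ^ 2 = (u + v) * (u - v) by ring.
  rewrite Rabs_mult; apply: Rmult_le_compat_r; first exact: Rabs_pos. apply: Rabs_le; lra.
have -> : fst x ^ 2 + snd x ^ 2 - (fst y ^ 2 + snd y ^ 2) = (fst x ^ 2 - fst y ^ 2) + (snd x ^ 2 - snd y ^ 2) by ring.
apply: Rle_trans (Rabs_triang _ _) _; have := e _ _ a c; have := e _ _ b d; lra.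
Qed.

Lemma fs_holder w L B : good w L B -> exists H, holder (hrhs w) gam H.
Proof.
move=> hg; have [h1 [h2 h3]] := hg; have hB := good_B0 w L B hg; have hL := good_L0 w L B hg.
have hgm := gam01.
have [C1 [hC1 H1]] := pw_holder p gam (B + 1) hgm ltac:(lra) ltac:(lra).
have [C2 [hC2 H2]] := pw_holder (al / 2) gam 2 hgm (Rmin_l _ _) ltac:(lra).
exists (C1 * pw gam (L * 2) + pw p B * (C2 * pw gam 4)) => x y s hx hy hs hr.
have hd := dist1_rho x y s hs hr.
have hsq := Rpower_pos s (/ 2).
have esq : pw gam (Rpower s (/ 2)) = Rpower s (gam / 2).
  rewrite pw_pos // Rpower_mult; congr Rpower; field.
have hpB := pw_ge0 p B.
have P1 : Rabs (pw p (w y) - pw p (w x)) <= C1 * pw gam (L * 2) * Rpower s (gam / 2).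
  apply: Rle_trans (H1 (w x) (w y) _ _) _; try (have := h1 x; have := h1 y; lra).
  rewrite Rmult_assoc; apply: Rmult_le_compat_l => //.
  rewrite -esq -pw_mult; try lra.
  apply: pw_mono; first lra. rewrite Rabs_minus_sym; apply: Rle_trans (h3 x y) _; nra.
have P2 : Rabs (wgt y - wgt x) <= C2 * pw gam 4 * Rpower s (gam / 2).
  have qx : q2 x <= 2 by lra.
  have qy : q2 y <= 2.
    case: hy => a b; rewrite /q2.
    have b1 : fst y ^ 2 <= 1 by nra.
    have b2 : snd y ^ 2 <= 1 by nra.
    lra.
  apply: Rle_trans (H2 (q2 x) (q2 y) qx qy) _.
  rewrite Rmult_assoc; apply: Rmult_le_compat_l => //.
  rewrite -esq -pw_mult; try lra.
  apply: pw_mono; first lra. rewrite Rabs_minus_sym.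
  have := q2_lip x y (q2_inQ x ltac:(lra)) hy; lra.
have -> : hrhs w y - hrhs w x = (wgt y - wgt x) * pw p (w y) + wgt x * (pw p (w y) - pw p (w x)) by rewrite /hrhs; ring.
apply: Rle_trans (Rabs_triang _ _) _; rewrite !Rabs_mult (Rabs_right (wgt x)); first exact: Rle_ge (Wt_ge0 x).
rewrite (Rabs_right (pw p (w y))); first exact: Rle_ge (pw_ge0 _ _).
have a1 := Wt_le1 x ltac:(lra); have a2 := Wt_ge0 x.
have a3 := pw_mono p (w y) B ltac:(lra) ltac:(have := h1 y; lra); have a4 := pw_ge0 p (w y).
have a5 := Rabs_pos (wgt y - wgt x); have a6 := Rabs_pos (pw p (w y) - pw p (w x)).
have -> : (C1 * pw gam (L * 2) + pw p B * (C2 * pw gam 4)) * Rpower s (gam / 2) =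
  C2 * pw gam 4 * Rpower s (gam / 2) * pw p B + 1 * (C1 * pw gam (L * 2) * Rpower s (gam / 2)) by ring.
apply: Rplus_le_compat; apply: Rmult_le_compat => //.
Qed.

Lemma fs_poisson w L B : good w L B -> poisson (Green (hrhs w)) (hrhs w).
Proof.
move=> hg; have [H hH] := fs_holder w L B hg.
exact: (Green_poisson _ (pw p B) gam H (fs_srcf w L B hg) hH gam01).
Qed.

Definition energy (w : pt -> R) : R := I2 (fun x => wgt x * pw (p + 1) (w x)).
Definition pnorm (w : pt -> R) : R := pw (/ (p + 1)) (energy w).

Lemma cont_Wpw a w : 0 < a -> cont w -> cont (fun x => wgt x * pw a (w x)).
Proof. move=> ha h; apply: cont_mult; [exact: cont_Wt | exact: cont_pw]. Qed.

Lemma En_ge0 w : cont w -> 0 <= energy w.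
Proof.
move=> h; apply: I2_ge0; first by apply: cont_Wpw => //; lra.
move=> x _; apply: Rmult_le_pos; [exact: Wt_ge0 | exact: pw_ge0].
Qed.

Lemma nn_pow w : cont w -> pw (p + 1) (pnorm w) = energy w.
Proof. move=> h; rewrite /pnorm pw_pw Rinv_l; first lra. apply: pw_1l; exact: En_ge0. Qed.

Lemma nn_ge0 w : 0 <= pnorm w. Proof. exact: pw_ge0. Qed.

Lemma En_pos w x : cont w -> 0 < q2 x < 1 -> 0 < w x -> 0 < energy w.
Proof.
move=> h hx hw.
have hq : -1 < fst x < 1 /\ -1 < snd x < 1.
  case: hx; rewrite /q2 => _ hh; have a := pow2_ge_0 (fst x); have b := pow2_ge_0 (snd x); repeat split; nra.
apply: (I2_pos_at _ x); try (case: hq => *; assumption).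
- by apply: cont_Wpw => //; lra.
- move=> y _; apply: Rmult_le_pos; [exact: Wt_ge0 | exact: pw_ge0].
- apply: Rmult_lt_0_compat; [apply: Wt_pos; lra | exact: pw_gt0].
Qed.

Lemma nn_pos w : cont w -> 0 < energy w -> 0 < pnorm w.
Proof. move=> h he; exact: pw_gt0. Qed.

(** After normalisation the two power terms integrate to [p / (p + 1)] and [1 / (p + 1)], hence the
    1. A nonnegative defect is Hoelder's inequality. *)
Lemma I2_ydef w u : cont w -> cont u -> (forall x, 0 <= w x) -> (forall x, 0 <= u x) -> 0 < pnorm w -> 0 < pnorm u ->
  I2 (fun x => wgt x * ydef p (w x / pnorm w) (u x / pnorm u)) = 1 - I2 (fun x => hrhs w x * u x) / (pw p (pnorm w) * pnorm u).
Proof.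
move=> cw cu w0 u0 hw hu.
have pw1 := pw_gt0 p (pnorm w) hw.
have iw : 0 < / pnorm w by apply: Rinv_0_lt_compat.
have iu : 0 < / pnorm u by apply: Rinv_0_lt_compat.
rewrite (I2_ext _ (fun x => (p / (p + 1) * / energy w * (wgt x * pw (p + 1) (w x)) + / (p + 1) * / energy u * (wgt x * pw (p + 1) (u x)))
   - / (pw p (pnorm w) * pnorm u) * (hrhs w x * u x))).
  move=> x _; rewrite /ydef /Rdiv !pw_mult; try lra; try exact: w0; try exact: u0.
  rewrite (pw_inv _ _ hw) (pw_inv _ _ hw) (pw_inv _ _ hu) (nn_pow w cw) (nn_pow u cu) /hrhs Rinv_mult; ring.
have c1 := cont_Wpw (p + 1) w ltac:(lra) cw; have c2 := cont_Wpw (p + 1) u ltac:(lra) cu.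
have c3 : cont (fun x => hrhs w x * u x) by apply: cont_mult => //; exact: cont_fs.
rewrite I2_minus.
- apply: cont_plus; apply: cont_mult => //; exact: cont_const.
- apply: cont_mult => //; exact: cont_const.
rewrite I2_plus; try (apply: cont_mult => //; exact: cont_const).
rewrite !I2_scal //.
rewrite -!/(energy _).
have ew : 0 < energy w by rewrite -(nn_pow w cw); exact: pw_gt0.
have eu : 0 < energy u by rewrite -(nn_pow u cu); exact: pw_gt0.
field; repeat split; lra.
Qed.

Lemma cont_ydef w u a b : cont w -> cont u -> cont (fun x => wgt x * ydef p (w x / a) (u x / b)).
Proof.
move=> cw cu; apply: cont_mult; first exact: cont_Wt.
have c1 : cont (fun x => w x / a) by apply: cont_mult => //; exact: cont_const.
have c2 : cont (fun x => u x / b) by apply: cont_mult => //; exact: cont_const.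
rewrite /ydef; apply: cont_minus; last by apply: cont_mult => //; apply: cont_pw => //; lra.
apply: cont_plus; apply: cont_mult; try exact: cont_const; apply: cont_pw => //; lra.
Qed.

Lemma holder_ineq w u : cont w -> cont u -> (forall x, 0 <= w x) -> (forall x, 0 <= u x) -> 0 < pnorm w -> 0 < pnorm u ->
  I2 (fun x => hrhs w x * u x) <= pw p (pnorm w) * pnorm u.
Proof.
move=> cw cu w0 u0 hw hu.
have h := I2_ydef w u cw cu w0 u0 hw hu.
have pw1 := pw_gt0 p (pnorm w) hw.
have hpos : 0 < pw p (pnorm w) * pnorm u by apply: Rmult_lt_0_compat.
have : 0 <= I2 (fun x => wgt x * ydef p (w x / pnorm w) (u x / pnorm u)).
  apply: I2_ge0; first exact: cont_ydef.
  move=> x _; apply: Rmult_le_pos; first exact: Wt_ge0.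
  apply: (proj1 (young p _ _ _ _ _)); first lra; apply: Rdiv_le_0_compat => //.
rewrite h => h1.
have : I2 (fun x => hrhs w x * u x) / (pw p (pnorm w) * pnorm u) <= 1 by lra.
move=> /Rle_div_l => h2; have := h2 hpos; lra.
Qed.

(** A continuous nonnegative integrand with zero integral vanishes; this determines the functions
    only where the weight is positive, so the origin is excluded. *)
Lemma holder_eq w u : cont w -> cont u -> (forall x, 0 <= w x) -> (forall x, 0 <= u x) -> 0 < pnorm w -> pnorm u = pnorm w ->
  I2 (fun x => hrhs w x * u x) = pw p (pnorm w) * pnorm u -> forall x, 0 < q2 x < 1 -> w x = u x.
Proof.
move=> cw cu w0 u0 hw hu he x hx.
have h := I2_ydef w u cw cu w0 u0 hw ltac:(rewrite hu; exact: hw).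
have pw1 := pw_gt0 p (pnorm w) hw.
rewrite he Rdiv_diag in h; first by apply: Rgt_not_eq; apply: Rmult_lt_0_compat; lra.
have wx : 0 <= w x / pnorm w by apply: Rdiv_le_0_compat.
have ux : 0 <= u x / pnorm u by apply: Rdiv_le_0_compat; [exact: u0 | lra].
have [y1 y2] := young p _ _ ltac:(lra) wx ux.
case: y1 => y1; last first.
  have := y2 (eq_sym y1); rewrite hu => e.
  apply: (Rmult_eq_reg_r (/ pnorm w)); [exact e | apply: Rinv_neq_0_compat; lra].
exfalso.
have hq : -1 < fst x < 1 /\ -1 < snd x < 1.
  case: hx; rewrite /q2 => _ hh; have a := pow2_ge_0 (fst x); have b := pow2_ge_0 (snd x); repeat split; nra.
suff : 0 < I2 (fun x => wgt x * ydef p (w x / pnorm w) (u x / pnorm u)) by rewrite h; lra.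
apply: (I2_pos_at _ x); try (case: hq => *; assumption).
- exact: cont_ydef.
- move=> y _; apply: Rmult_le_pos; first exact: Wt_ge0.
  apply: (proj1 (young p _ _ _ _ _)); [lra | apply: Rdiv_le_0_compat; [exact: w0 | lra] | apply: Rdiv_le_0_compat; [exact: u0 | lra]].
- apply: Rmult_lt_0_compat; [apply: Wt_pos; lra | exact: y1].
Qed.

End Src.

(** * Compactness of equi-Lipschitz sequences *)

Definition infinite (S : nat -> Prop) : Prop := forall N, exists n, (N <= n)%nat /\ S n.

Lemma infinite_split (S P : nat -> Prop) : infinite S ->
  infinite (fun n => S n /\ P n) \/ infinite (fun n => S n /\ ~ P n).
Proof.
move=> h; case: (classic (infinite (fun n => S n /\ P n))) => hn; [by left | right].
move=> N; apply: NNPP => hN; apply: hn => M.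
have [n [h1 h2]] := h (max N M).
exists n; split; first lia. split => //; apply: NNPP => hP; apply: hN; exists n; split => //; lia.
Qed.

Lemma pigeon (S : nat -> Prop) (a : nat -> R) lo hi eta : 0 < eta -> infinite S ->
  (forall n, S n -> lo <= a n <= hi) ->
  exists S', infinite S' /\ (forall n, S' n -> S n) /\ forall k l, S' k -> S' l -> Rabs (a k - a l) <= eta.
Proof.
move=> he.
have [m hm] := INR_unbounded ((hi - lo) / eta).
have hm' : hi - lo <= INR m * eta by apply/Rle_div_l => //; lra.
clear hm; elim: m S lo hm' => [|m IH] S lo hm hS ha.
  exists S; split => //; split => // k l hk hl; have := ha k hk; have := ha l hl; rewrite /= in hm => *.
  apply: Rabs_le; lra.
rewrite S_INR in hm.
case: (infinite_split S (fun n => a n <= lo + eta) hS) => h.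
  exists (fun n => S n /\ a n <= lo + eta); split => //; split; first by move=> n [].
  move=> k l [k1 k2] [l1 l2]; have := ha k k1; have := ha l l1 => *; apply: Rabs_le; lra.
have [S' [h1 [h2 h3]]] := IH (fun n => S n /\ ~ a n <= lo + eta) (lo + eta) ltac:(lra) h
   ltac:(move=> n [n1 n2]; have := ha n n1; lra).
by exists S'; split => //; split => // n /h2 [].
Qed.

Lemma pigeon_list (s : nat -> pt -> R) B eta (l : list pt) (S : nat -> Prop) : 0 < eta ->
  (forall n x, 0 <= s n x <= B) -> infinite S ->
  exists S', infinite S' /\ (forall n, S' n -> S n) /\
    forall z k l', In z l -> S' k -> S' l' -> Rabs (s k z - s l' z) <= eta.
Proof.
move=> he hB; elim: l S => [|z l IH] S hS; first by exists S.
have [S1 [a1 [a2 a3]]] := IH S hS.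
have [S2 [b1 [b2 b3]]] := pigeon S1 (fun n => s n z) 0 B eta he a1 (fun n _ => hB n z).
exists S2; split => //; split; first by move=> n /b2 /a2.
move=> z' k l' [<-|hz] hk hl; first exact: b3. apply: a3 => //; exact: b2.
Qed.

Lemma net1 h : 0 < h -> exists l : list R, forall t, -1 <= t <= 1 -> exists z, In z l /\ Rabs (t - z) <= h.
Proof.
move=> hh.
have H : forall n, exists l : list R, forall t, -1 <= t <= -1 + INR n * h -> exists z, In z l /\ Rabs (t - z) <= h.
  elim=> [|n [l hl]].
    exists (-1 :: nil) => t ht; rewrite /= in ht; exists (-1); split; first by left.
    have -> : t - -1 = 0 by lra. rewrite Rabs_R0; lra.
  exists ((-1 + INR n * h) :: l) => t; rewrite S_INR => ht.
  case: (Rle_dec t (-1 + INR n * h)) => hc.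
    have [z [z1 z2]] := hl t ltac:(lra); exists z; split => //; by right.
  exists (-1 + INR n * h); split; first by left. apply: Rabs_le; lra.
have [m hm] := INR_unbounded (2 / h).
have [l hl] := H m; exists l => t ht; apply: hl; split; first lra.
have : 2 <= INR m * h by apply/Rle_div_l => //; lra.
lra.
Qed.

(** Values on a finite net are matched up to [eta / 2] by pigeonhole; the mesh is chosen so that
    each of the two Lipschitz errors is at most [eta / 4]. *)
Lemma uniform_class (s : nat -> pt -> R) L B eta (S : nat -> Prop) : 0 < eta -> infinite S ->
  (forall n, good (s n) L B) ->
  exists S', infinite S' /\ (forall n, S' n -> S n) /\
    forall x k l, S' k -> S' l -> Rabs (s k x - s l x) <= eta.
Proof.
move=> he hS hg; have hL := good_L0 _ L B (hg O).
have hh : 0 < eta / (8 * (L + 1)) by apply: Rdiv_lt_0_compat; lra.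
have [l hl] := net1 _ hh.
have [S' [h1 [h2 h3]]] := pigeon_list s B (eta / 2) (list_prod l l) S ltac:(lra) (fun n => proj1 (hg n)) hS.
exists S'; split => //; split => // x k k' hk hk'.
case: (Rle_dec (q2 x) 1) => hx; last first.
  have [_ [z1 _]] := hg k; have [_ [z2 _]] := hg k'.
  rewrite z1 ?z2; try lra. rewrite Rminus_diag Rabs_R0; lra.
have [qa qb] := q2_inQ x hx.
have [a [a1 a2]] := hl _ qa; have [b [b1 b2]] := hl _ qb.
have hz := h3 (a, b) k k' (in_prod _ _ _ _ a1 b1) hk hk'.
have [_ [_ l1]] := hg k; have [_ [_ l2]] := hg k'.
have d : dist1 x (a, b) <= 2 * (eta / (8 * (L + 1))) by rewrite /dist1 /=; lra.
have e1 : (L + 1) * (2 * (eta / (8 * (L + 1)))) = eta / 4 by field; lra.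
have d0 := dist1_ge0 x (a, b).
have m1 : L * dist1 x (a, b) <= eta / 4 by nra.
have := l1 x (a, b); have := l2 x (a, b) => /Rabs_le_between c2 /Rabs_le_between c1.
move: hz => /Rabs_le_between hz; apply: Rabs_le; lra.
Qed.

Definition unif_cv (s : nat -> pt -> R) (u : pt -> R) : Prop :=
  forall eps, 0 < eps -> exists N, forall n x, (N <= n)%nat -> Rabs (s n x - u x) <= eps.

Lemma unif_cv_of_cauchy (s : nat -> pt -> R) :
  (forall eps, 0 < eps -> exists N, forall n m x, (N <= n)%nat -> (N <= m)%nat -> Rabs (s n x - s m x) <= eps) ->
  exists u, unif_cv s u.
Proof.
move=> h; exists (fun x => real (Lim_seq (fun n => s n x))).
have hl : forall x, is_lim_seq (fun n => s n x) (real (Lim_seq (fun n => s n x))).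
  move=> x; apply: Lim_seq_correct'; apply: (proj2 (ex_lim_seq_cauchy_corr _)) => eps.
  have hp := cond_pos eps; have [N hN] := h (eps / 2) ltac:(lra).
  exists N => n m hn hm; have := hN n m x hn hm; lra.
move=> eps he; have [N hN] := h eps he; exists N => n x hn.
have l1 := is_lim_seq_abs _ (Finite _) (is_lim_seq_minus' _ _ _ _ (is_lim_seq_const (s n x)) (hl x)).
apply: (is_lim_seq_le_loc _ _ (Finite _) (Finite _) _ l1 (is_lim_seq_const eps)).
exists N => m hm; exact: hN.
Qed.

Lemma unif_cv_lim s u x : unif_cv s u -> is_lim_seq (fun n => s n x) (u x).
Proof.
move=> h; apply/is_lim_seq_spec => eps; have hp := cond_pos eps.
have [N hN] := h (eps / 2) ltac:(lra); exists N => n hn; have := hN n x hn; lra.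
Qed.

Lemma unif_cv_good s u L B : unif_cv s u -> (forall n, good (s n) L B) -> good u L B.
Proof.
move=> h hg; split; [|split].
- move=> x; have l := unif_cv_lim s u x h; split.
    apply: (is_lim_seq_le _ _ (Finite _) (Finite _) _ (is_lim_seq_const 0) l) => n; have [a _] := hg n; have := a x; lra.
  apply: (is_lim_seq_le _ _ (Finite _) (Finite _) _ l (is_lim_seq_const B)) => n; have [a _] := hg n; have := a x; lra.
- move=> x hx; have l := unif_cv_lim s u x h.
  have := is_lim_seq_unique _ _ l; rewrite (is_lim_seq_unique _ (Finite 0)); last by move=> [->].
  apply: (is_lim_seq_ext (fun _ => 0)); last exact: is_lim_seq_const.
  by move=> n; have [_ [a _]] := hg n; rewrite a.
- move=> x y.
  have l := is_lim_seq_abs _ (Finite _) (is_lim_seq_minus' _ _ _ _ (unif_cv_lim s u x h) (unif_cv_lim s u y h)).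
  apply: (is_lim_seq_le _ _ (Finite _) (Finite _) _ l (is_lim_seq_const _)) => n; have [_ [_ a]] := hg n; exact: a.
Qed.

(** [SS m] are nested infinite index sets on which the functions differ by at most [sq m], and
    [phi m] picks an index of [SS m] beyond [m]. The condition [n <= phi n] takes the place of
    monotonicity of [phi]. *)
Lemma arzela (s : nat -> pt -> R) L B : (forall n, good (s n) L B) ->
  exists (phi : nat -> nat) u, (forall n, (n <= phi n)%nat) /\ unif_cv (fun n => s (phi n)) u.
Proof.
move=> hg.
pose T := {S : nat -> Prop | infinite S}.
have nxt : forall (S : T) (m : nat), exists S' : T, (forall n, proj1_sig S' n -> proj1_sig S n) /\
    forall x k l, proj1_sig S' k -> proj1_sig S' l -> Rabs (s k x - s l x) <= sq m.
  move=> [S hS] m.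
  have [S' [a [b c]]] := uniform_class s L B (sq m) S (proj1 (sq_pos m)) hS hg.
  by exists (exist _ S' a).
pose nx S m := proj1_sig (constructive_indefinite_description _ (nxt S m)).
have hnx : forall S m, (forall n, proj1_sig (nx S m) n -> proj1_sig S n) /\
    forall x k l, proj1_sig (nx S m) k -> proj1_sig (nx S m) l -> Rabs (s k x - s l x) <= sq m.
  by move=> S m; rewrite /nx; case: constructive_indefinite_description.
have all : infinite (fun _ => True) by move=> N; exists N.
pose SS := fix SS (m : nat) : T := match m with O => nx (exist _ _ all) O | S m' => nx (SS m') m end.
have mono : forall m k n, proj1_sig (SS (m + k)%nat) n -> proj1_sig (SS m) n.
  move=> m; elim=> [|k IH] n; first by rewrite Nat.add_0_r.
  rewrite Nat.add_succ_r /= => hn; apply: IH; exact: (proj1 (hnx _ _) n hn).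
have pick : forall m, exists n, (m <= n)%nat /\ proj1_sig (SS m) n by move=> m; exact: (proj2_sig (SS m) m).
pose phi m := proj1_sig (constructive_indefinite_description _ (pick m)).
have hphi : forall m, (m <= phi m)%nat /\ proj1_sig (SS m) (phi m).
  by move=> m; rewrite /phi; case: constructive_indefinite_description.
have close : forall m x k l, proj1_sig (SS m) k -> proj1_sig (SS m) l -> Rabs (s k x - s l x) <= sq m.
  case=> [|m] x k l; exact: (proj2 (hnx _ _)).
have [u hu] : exists u, unif_cv (fun n => s (phi n)) u.
  apply: unif_cv_of_cauchy => eps he; have [N hN] := sq_small eps he.
  exists N => n m x hn hm; apply: Rle_trans (hN N ltac:(lia)).
  apply: close.
    apply: (mono N (n - N)%nat); have -> : (N + (n - N) = n)%nat by lia. exact: (proj2 (hphi n)).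
  apply: (mono N (m - N)%nat); have -> : (N + (m - N) = m)%nat by lia. exact: (proj2 (hphi m)).
by exists phi, u; split => // n; case: (hphi n).
Qed.

(** * The power iteration *)

Lemma poisson_scal u f c : poisson u f -> poisson (fun x => c * u x) (fun x => c * f x).
Proof.
move=> [d [h [h1 [h2 [h3 [h4 h5]]]]]].
exists (fun i x => c * d i x), (fun i j x => c * h i j x).
split; [|split; [|split; [|split]]].
- move=> i x hx; apply: (continuous_mult (K := R_AbsRing)); [exact: continuous_const | exact: h1].
- move=> i j x hx; apply: (continuous_mult (K := R_AbsRing)); [exact: continuous_const | exact: h2].
- move=> i x hx; apply: pd_scal; exact: h3.
- move=> i j x hx; apply: pd_scal; exact: h4.
- move=> x hx; rewrite -h5 //; ring.
Qed.

Lemma poisson_ext u v f : (forall x, u x = v x) -> poisson u f -> poisson v f.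
Proof. by move=> h; have -> : u = v by apply: functional_extensionality. Qed.

Section Iter.
Variables (al p : R).
Hypotheses (hal : 0 < al) (hp : 1 < p).

Local Notation Wt := (wgt al).
Local Notation fs := (hrhs al p).
Local Notation En := (energy al p).
Local Notation nn := (pnorm al p).

(** The quotient is invariant under multiplication of [w] by positive constants, so the iteration
    neither collapses nor explodes by scaling. *)
Definition step (w : pt -> R) (x : pt) : R := / pw p (nn w) * Green (fs w) x.

Definition ok (w : pt -> R) : Prop := (exists L B, good w L B) /\ conep w /\ 0 < nn w.

Lemma ok_cont w : ok w -> cont w.
Proof. move=> [[L [B h]] _]; exact: (good_cont w L B). Qed.
Lemma ok_ge0 w : ok w -> forall x, 0 <= w x.
Proof. move=> [[L [B [h _]]] _] x; have := h x; lra. Qed.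
Lemma ok_src w : ok w -> exists M, srcf (fs w) M.
Proof. move=> [[L [B h]] _]; exists (pw p B); exact: (fs_srcf al p hal hp w L B). Qed.
Lemma ok_nnp w : ok w -> 0 < pw p (nn w).
Proof. move=> [_ [_ h]]; exact: pw_gt0. Qed.

Lemma nn_witness w : cont w -> (forall x, 1 <= q2 x -> w x = 0) -> (forall x, 0 <= w x) -> 0 < nn w -> exists x, 0 < q2 x < 1 /\ 0 < w x.
Proof.
move=> cw wz w0 hn; apply: NNPP => h.
have e : En w = 0.
  rewrite /energy (I2_ext _ (fun _ => 0)); last by rewrite I2_const; ring.
  move=> z _; case: (Rlt_dec 0 (q2 z)) => hz; last first.
    rewrite /wgt pw_npos; [lra | ring].
  case: (Rlt_dec (q2 z) 1) => hz1; last by rewrite wz ?pw_0; [lra | ring].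
  rewrite pw_npos; last by ring.
  case: (Rle_dec (w z) 0) => // hc; exfalso; apply: h; exists z; lra.
rewrite /pnorm e pw_0 in hn; lra.
Qed.

Lemma ok_witness w : ok w -> exists x, 0 < q2 x < 1 /\ 0 < w x.
Proof.
move=> h; apply: nn_witness; [exact: ok_cont | | exact: ok_ge0 | by case: h => _ []].
by case: h => [[L [B [_ [a _]]]] _].
Qed.

Lemma conep_fs w : conep w -> conep (fs w).
Proof.
move=> h c s hcs hc x hx; rewrite /hrhs /wgt q2_refl //.
apply: Rmult_le_compat_l; first exact: pw_ge0. apply: pw_mono; [lra | exact: h].
Qed.

Lemma step_good w M a : srcf (fs w) M -> 0 < a <= pw p (nn w) -> good (step w) (/ a * (M * KG)) (/ a * (M * KG)).
Proof.
move=> hs ha.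
have hM := srcf_M0 _ _ hs; have hK := KG_pos.
have i1 : 0 < / pw p (nn w) by apply: Rinv_0_lt_compat; lra.
have i2 : / pw p (nn w) <= / a by apply: Rinv_le_contravar; lra.
split; [|split].
- move=> x; have g0 := Green_ge0 _ _ x hs (fs_ge0 al p w); have := Green_bound _ _ x hs.
  rewrite Rabs_right; first lra. move=> gb; rewrite /step; split; first by apply: Rmult_le_pos; lra.
  apply: Rmult_le_compat; lra.
- move=> x hx; rewrite /step Green_out //; ring.
- move=> x y; rewrite /step -Rmult_minus_distr_l Rabs_mult Rabs_right; first lra.
  rewrite Rmult_assoc; apply: Rmult_le_compat; try lra; first exact: Rabs_pos.
  exact: Green_lip.
Qed.

Lemma step_poisson w : ok w -> poisson (step w) (fun x => / pw p (nn w) * fs w x).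
Proof.
move=> [[L [B h]] _]; apply: poisson_scal; exact: (fs_poisson al p hal hp w L B).
Qed.

Lemma step_pos w x : ok w -> q2 x < 1 -> 0 < step w x.
Proof.
move=> h hx; have [M hM] := ok_src w h; have [y [y1 y2]] := ok_witness w h.
apply: Rmult_lt_0_compat; first by apply: Rinv_0_lt_compat; exact: ok_nnp.
apply: (Green_pos _ M _ y) => //; first exact: fs_ge0.
apply: Rmult_lt_0_compat; [apply: Wt_pos; lra | exact: pw_gt0].
Qed.

Lemma step_ok w : ok w -> ok (step w).
Proof.
move=> h; have [M hM] := ok_src w h; have hn := ok_nnp w h.
have hg := step_good w M _ hM (conj hn (Rle_refl _)).
have hc : cont (step w) by exact: good_cont hg.
split; [|split].
- by do 2 eexists; exact: hg.
- apply: (poisson_cone _ _ hc _ (step_poisson w h)); first by case: hg => _ [].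
  case: h => _ [h _]; have := conep_fs w h => hf c s hcs hc0 x hx.
  apply: Rmult_le_compat_l; [by apply: Rlt_le; apply: Rinv_0_lt_compat | exact: hf].
- apply: nn_pos => //.
  apply: (En_pos al p hal hp _ (/ 2, 0)) => //; first by rewrite /q2 /=; lra.
  apply: step_pos => //; rewrite /q2 /=; lra.
Qed.

Lemma pw_split t : 0 <= t -> pw p t * t = pw (p + 1) t.
Proof. by move=> h; rewrite pw_plus pw_1l. Qed.

(* The symmetry of the Green operator turns the pairing of [fs w] with the second iterate into [En] of the first one. *)
Lemma pairing w : ok w -> I2 (fun x => fs w x * step (step w) x) = pw p (nn w) * nn (step w).
Proof.
move=> h; have hu := step_ok w h; set u := step w; rewrite -/u in hu.
have [M hM] := ok_src w h; have [N hN] := ok_src u hu.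
have cw := Green_cont _ _ hM; have cu := Green_cont _ _ hN.
have cfw : cont (fs w) by case: hM. have cfu : cont (fs u) by case: hN.
have n1 := ok_nnp w h; have n2 := ok_nnp u hu.
have cU := ok_cont u hu; have U0 := ok_ge0 u hu.
have e1 : I2 (fun x => fs w x * step u x) = / pw p (nn u) * I2 (fun x => fs w x * Green (fs u) x).
  rewrite -I2_scal; first exact: cont_mult.
  apply: I2_ext => x _; rewrite /step; ring.
have e2 : I2 (fun x => fs u x * Green (fs w) x) = pw p (nn w) * En u.
  rewrite -I2_scal; first by apply: cont_Wpw => //; lra.
  apply: I2_ext => x _.
  have -> : Green (fs w) x = pw p (nn w) * u x by rewrite /u /step; field; lra.
  rewrite -pw_split; first exact: U0. rewrite /hrhs; ring.
rewrite e1 (Green_sym (fs u) (fs w) N M hN hM) e2 -(nn_pow al p hal hp u cU) -pw_split; first exact: nn_ge0.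
field; lra.
Qed.

(** Hoelder's inequality for the left side of [pairing]; the common factor [nn w] to the power [p]
    cancels. *)
Lemma nn_step_mono w : ok w -> nn (step w) <= nn (step (step w)).
Proof.
move=> h; have hu := step_ok w h; have hv := step_ok _ hu.
have n1 := ok_nnp w h.
have e := pairing w h.
have [_ [_ nw]] := h; have [_ [_ nv]] := hv.
have hh := holder_ineq al p hal hp w _ (ok_cont w h) (ok_cont _ hv) (ok_ge0 w h) (ok_ge0 _ hv) nw nv.
rewrite e in hh; exact: Rmult_le_reg_l n1 hh.
Qed.

(** From [ln z <= z^kap / kap] at [z = (s + 1) / s], the [(p + 1)]-st power of the kernel is bounded
    by a constant times [z^(1/2)], because [kap (p + 1) = 1/2]. Since [s + 1 <= 10], this is at most
    [Cp s^(-1/2)], an integrable singularity. *)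
Definition kap := / (2 * (p + 1)).
Definition Cp := pw (p + 1) (/ kap) * pw (/ 2) 10.
Definition Bp := Cp * KG + 1.

Lemma Bp_pos : 0 < Bp.
Proof.
rewrite /Bp; have := KG_pos; have : 0 <= Cp by apply: Rmult_le_pos; exact: pw_ge0.
move=> a b; have := Rmult_le_pos _ _ a (Rlt_le _ _ b); lra.
Qed.

Lemma kernel_pow e x y : 0 < e <= 1 -> q2 x <= 1 -> q2 y <= 1 ->
  pw (p + 1) (k0 true e x y - k0 false e x y) <= Cp * Rpower (rho2 x y + e) (- (1 - / 2)).
Proof.
move=> he hx hy.
have hk : 0 < kap by apply: Rinv_0_lt_compat; lra.
have h0 := rho2_ge0 x y; have hqx := q2_ge0 x; have hqy := q2_ge0 y.
set s := rho2 x y + e; have hs : 0 < s by rewrite /s; lra.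
have hs9 : s + 1 <= 10.
  have [[a1 a2] [a3 a4]] := q2_inQ x hx; have [[b1 b2] [b3 b4]] := q2_inQ y hy.
  rewrite /s /rho2; nra.
have hD : DD x y + e <= s + 1 by rewrite /s DDrho; nra.
have hD0 := DD_ge0 x y.
have h1 : k0 true e x y - k0 false e x y <= / kap * pw kap ((s + 1) / s).
  rewrite /k0 /= -/s.
  have l1 : ln (DD x y + e) <= ln (s + 1) by apply: ln_le; lra.
  have hq : 0 < (s + 1) / s by apply: Rdiv_lt_0_compat; lra.
  have l2 : ln (s + 1) - ln s = / kap * ln (pw kap ((s + 1) / s)).
    rewrite pw_pos // ln_Rpower ln_div; try lra. field; lra.
  have l3 : ln (pw kap ((s + 1) / s)) <= pw kap ((s + 1) / s).
    have hpp := pw_gt0 kap _ hq; have := exp_ineq1_le (ln (pw kap ((s + 1) / s))); rewrite exp_ln //; lra.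
  have ik : 0 < / kap by apply: Rinv_0_lt_compat.
  have := Rmult_le_compat_l _ _ _ (Rlt_le _ _ ik) l3; lra.
apply: Rle_trans (pw_mono (p + 1) _ _ ltac:(lra) h1) _.
have ik : 0 < / kap by apply: Rinv_0_lt_compat.
rewrite pw_mult; [lra | exact: pw_ge0 |].
rewrite pw_pw.
have -> : kap * (p + 1) = / 2 by rewrite /kap; field; lra.
rewrite /Cp Rmult_assoc; apply: Rmult_le_compat_l; first exact: pw_ge0.
have is' : 0 < / s by apply: Rinv_0_lt_compat.
rewrite /Rdiv pw_mult; try lra.
have -> : - (1 - / 2) = - / 2 by field.
have -> : pw (/ 2) (/ s) = Rpower s (- / 2) by rewrite pw_inv // pw_pos // Rpower_Ropp.
apply: Rmult_le_compat_r; first exact: Rlt_le (Rpower_pos _ _).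
apply: pw_mono; lra.
Qed.

(* [a b^p <= a^(p+1) + b^(p+1)]: integrability of powers of the kernel bounds the iterates uniformly. *)
Lemma step_bound w x : ok w -> step w x <= Bp.
Proof.
move=> h; have [M hM] := ok_src w h; have n1 := ok_nnp w h; have hn : 0 < nn w by case: h => _ [].
have cw := ok_cont w h; have w0 := ok_ge0 w h; have hB := Bp_pos.
have wz : forall x, 1 <= q2 x -> w x = 0 by case: h => [[L [B [_ [a _]]]] _].
case: (Rlt_dec (q2 x) 1) => hx; last first.
  rewrite /step Green_out; lra.
have hK := KG_pos.
rewrite /step; apply: (Rmult_le_reg_l (pw p (nn w))) => //.
rewrite -Rmult_assoc Rinv_r; first lra. rewrite Rmult_1_l.
apply: (is_lim_seq_le _ _ (Finite _) (Finite _) _ (Ge_lim _ M x hM ltac:(lra)) (is_lim_seq_const _)) => n.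
have he := sq_pos n; have cf : cont (fs w) by case: hM.
rewrite Ge_kernel //; first lra.
have [p1 p2] := inv4pi.
have iw : 0 < / nn w by apply: Rinv_0_lt_compat.
have cF : cont (fun y => (k0 true (sq n) x y - k0 false (sq n) x y) * fs w y).
  apply: cont_mult => //; apply: cont_minus; apply: cont_k0s; lra.
have cG1 : cont (fun y => Rpower (rho2 x y + sq n) (- (1 - / 2))) by apply: cont_rho2e; lra.
have cG2 : cont (fun y => Wt y * pw (p + 1) (w y)) by apply: cont_Wpw => //; lra.
have key : I2 (fun y => (k0 true (sq n) x y - k0 false (sq n) x y) * fs w y) <=
  I2 (fun y => pw p (nn w) * Cp * Rpower (rho2 x y + sq n) (- (1 - / 2)) + pw p (nn w) * / En w * (Wt y * pw (p + 1) (w y))).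
  apply: I2_le => //.
    by apply: cont_plus; apply: cont_mult => //; exact: cont_const.
  move=> y _.
  have hW := Wt_ge0 al y; have hpw := pw_ge0 (p + 1) (w y).
  have hRp := Rpower_pos (rho2 x y + sq n) (- (1 - / 2)).
  have hC : 0 <= Cp by apply: Rmult_le_pos; exact: pw_ge0.
  have hE : 0 < En w by rewrite -(nn_pow al p hal hp w cw); exact: pw_gt0.
  have iE : 0 < / En w by apply: Rinv_0_lt_compat.
  case: (Rle_dec (q2 y) 1) => hy; last first.
    rewrite /hrhs wz; first lra. rewrite !pw_0.
    have := Rmult_le_pos _ _ (Rmult_le_pos _ _ (Rlt_le _ _ n1) hC) (Rlt_le _ _ hRp); lra.
  set K := k0 true (sq n) x y - k0 false (sq n) x y.
  have K0 : 0 <= K by apply: k0_mono; lra.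
  have K1 : pw (p + 1) K <= Cp * Rpower (rho2 x y + sq n) (- (1 - / 2)) by apply: kernel_pow => //; lra.
  have W1 := Wt_le1 al hal y hy.
  pose v := w y / nn w.
  have v0 : 0 <= v by apply: Rdiv_le_0_compat => //; exact: w0.
  have ev : pw p (w y) = pw p (nn w) * pw p v.
    by rewrite -pw_mult //; [lra | congr pw; rewrite /v; field; lra].
  have ev1 : / En w * pw (p + 1) (w y) = pw (p + 1) v.
    rewrite /v /Rdiv (pw_mult _ _ _ (w0 y) (Rlt_le _ _ iw)) (pw_inv _ _ hn) (nn_pow al p hal hp w cw); ring.
  have yg : K * pw p v <= pw (p + 1) K + pw (p + 1) v.
    case: (Rle_dec K v) => hKv.
      have : K * pw p v <= v * pw p v by apply: Rmult_le_compat_r => //; exact: pw_ge0.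
      have := pw_split v v0; have := pw_ge0 (p + 1) K; lra.
    have a1 := pw_mono p v K ltac:(lra) ltac:(lra).
    have : K * pw p v <= K * pw p K by apply: Rmult_le_compat_l.
    have := pw_split K K0; have := pw_ge0 (p + 1) v; lra.
  rewrite /hrhs ev.
  have -> : K * (Wt y * (pw p (nn w) * pw p v)) = pw p (nn w) * (Wt y * (K * pw p v)) by ring.
  have -> : pw p (nn w) * Cp * Rpower (rho2 x y + sq n) (- (1 - / 2)) + pw p (nn w) * / En w * (Wt y * pw (p + 1) (w y)) =
     pw p (nn w) * (Cp * Rpower (rho2 x y + sq n) (- (1 - / 2)) + Wt y * (/ En w * pw (p + 1) (w y))) by ring.
  apply: Rmult_le_compat_l; first lra.
  rewrite ev1.
  have g1 := pw_ge0 (p + 1) K; have g2 := pw_ge0 (p + 1) v.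
  apply: (Rle_trans _ (Wt y * (pw (p + 1) K + pw (p + 1) v))); first exact: Rmult_le_compat_l.
  nra.
rewrite I2_plus in key; try (apply: cont_mult => //; exact: cont_const).
rewrite !I2_scal // in key.
have hE : 0 < En w by rewrite -(nn_pow al p hal hp w cw); exact: pw_gt0.
rewrite -/(En w) in key.
have hC : 0 <= Cp by apply: Rmult_le_pos; exact: pw_ge0.
have sb := sing_bound x (sq n) (/ 2) (q2_inQ x ltac:(lra)) he ltac:(lra).
rewrite -/KG in sb.
have key2 : I2 (fun y => (k0 true (sq n) x y - k0 false (sq n) x y) * fs w y) <= pw p (nn w) * Bp.
  apply: Rle_trans key _.
  have -> : pw p (nn w) * / En w * En w = pw p (nn w) by field; lra.
  have := Rmult_le_compat_l (pw p (nn w) * Cp) _ _ (Rmult_le_pos _ _ (Rlt_le _ _ n1) hC) sb.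
  rewrite /Bp; lra.
have pb : 0 < pw p (nn w) * Bp by apply: Rmult_lt_0_compat.
have i0 : 0 <= I2 (fun y => (k0 true (sq n) x y - k0 false (sq n) x y) * fs w y).
  apply: I2_ge0 => // y _; case: (Rle_dec (q2 y) 1) => hy; last by rewrite /hrhs wz ?pw_0; lra.
  apply: Rmult_le_pos; [apply: k0_mono; lra | exact: fs_ge0].
nra.
Qed.

Lemma pw_lip_B a B : 1 <= a -> 0 <= B -> exists C, 0 <= C /\ forall s t, 0 <= s <= B -> 0 <= t <= B ->
  Rabs (pw a s - pw a t) <= C * Rabs (s - t).
Proof.
move=> ha hB; have [C [h0 h]] := pw_holder a 1 (B + 1) ltac:(lra) ha ltac:(lra).
exists C; split => // s t hs ht; have := h t s ltac:(lra) ltac:(lra); rewrite pw_1l //; exact: Rabs_pos.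
Qed.

Lemma unif_cv_En s u L B : unif_cv s u -> (forall n, good (s n) L B) -> good u L B ->
  is_lim_seq (fun n => En (s n)) (En u).
Proof.
move=> h hg hu; have hB := good_B0 _ _ _ hu.
have [C [hC hl]] := pw_lip_B (p + 1) B ltac:(lra) hB.
apply/is_lim_seq_spec => eps; have he := cond_pos eps.
have [N hN] := h (eps / (8 * (C + 1))) ltac:(apply: Rdiv_lt_0_compat; lra).
exists N => n hn.
have c1 := good_cont _ _ _ (hg n); have c2 := good_cont _ _ _ hu.
have w1 := cont_Wpw al hal (p + 1) _ ltac:(lra) c1; have w2 := cont_Wpw al hal (p + 1) _ ltac:(lra) c2.
rewrite /energy -I2_minus //.
have e1 : 4 * ((C + 1) * (eps / (8 * (C + 1)))) = eps / 2 by field; lra.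
apply: (Rle_lt_trans _ (eps / 2)); last lra.
rewrite -e1; apply: I2_abs_const; first exact: cont_minus.
move=> x _; rewrite -Rmult_minus_distr_l Rabs_mult.
have [g1 [g2 _]] := hg n; have [u1 [u2 _]] := hu.
have pe : 0 < (C + 1) * (eps / (8 * (C + 1))) by lra.
case: (Rle_dec (q2 x) 1) => hx; last first.
  rewrite g2 ?u2; try lra. rewrite Rminus_diag Rabs_R0; lra.
rewrite Rabs_right; first exact: Rle_ge (Wt_ge0 _ _).
have a1 := Wt_le1 al hal x hx; have a2 := Wt_ge0 al x.
have a3 := hl _ _ (g1 x) (u1 x); have a4 := hN n x hn; have a5 := Rabs_pos (s n x - u x).
have a6 := Rabs_pos (pw (p + 1) (s n x) - pw (p + 1) (u x)).
nra.
Qed.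

Lemma unif_cv_nn s u L B : unif_cv s u -> (forall n, good (s n) L B) -> good u L B ->
  is_lim_seq (fun n => nn (s n)) (nn u).
Proof.
move=> h hg hu; have l := unif_cv_En s u L B h hg hu.
apply: (is_lim_seq_continuous (pw (/ (p + 1)))) => //.
apply/continuity_pt_filterlim; apply: cont_pw1; apply: Rinv_0_lt_compat; lra.
Qed.

Lemma unif_cv_step s u L B a : 0 < a -> unif_cv s u -> (forall n, good (s n) L B) -> good u L B ->
  (forall n, a <= nn (s n)) -> unif_cv (fun n => step (s n)) (step u).
Proof.
move=> ha h hg hu hn; have hB := good_B0 _ _ _ hu.
have ln := unif_cv_nn s u L B h hg hu.
have hau : a <= nn u.
  exact: (is_lim_seq_le _ _ (Finite _) (Finite _) hn (is_lim_seq_const a) ln).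
have pa := pw_gt0 p a ha.
have lp : is_lim_seq (fun n => / pw p (nn (s n))) (/ pw p (nn u)).
  apply: (is_lim_seq_inv _ (Finite _)).
    apply: (is_lim_seq_continuous (pw p)) => //.
    apply/continuity_pt_filterlim; apply: cont_pw1; lra.
  have := pw_mono p a (nn u) ltac:(lra) hau => hh [] ; lra.
have [C [hC hl]] := pw_lip_B p B ltac:(lra) hB.
have hK := KG_pos.
have pB := pw_ge0 p B.
move=> eps he.
(* [e1] controls the change of the source and [e2] below that of the normalising factor; each costs
   [eps / 2]. *)
pose e1 := eps / 2 / ((C + 1) * KG * / pw p a).
have D1 : 0 < (C + 1) * KG * / pw p a.
  apply: Rmult_lt_0_compat; last by apply: Rinv_0_lt_compat. apply: Rmult_lt_0_compat; lra.
have he1 : 0 < e1 by apply: Rdiv_lt_0_compat; lra.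
have D2 : 0 < pw p B * KG + 1 by have := Rmult_le_pos _ _ pB (Rlt_le _ _ hK); lra.
pose e2 := eps / 2 / (pw p B * KG + 1).
have he2 : 0 < e2 by apply: Rdiv_lt_0_compat; lra.
have [N1 hN1] := h e1 he1.
move: lp => /is_lim_seq_spec /(_ (mkposreal _ he2)) [N2 hN2].
exists (max N1 N2) => n x hnn.
have n1 := hN1 n; have n2 := hN2 n ltac:(lia); rewrite /= in n2.
have s1 := fs_srcf al p hal hp _ _ _ (hg n); have s2 := fs_srcf al p hal hp _ _ _ hu.
have sd : srcf (fun y => 1 * fs (s n) y + (-1) * fs u y) (C * e1).
  have [q1 [q2' _]] := srcf_comb _ _ _ _ 1 (-1) s1 s2; split => //; split => //.
  move=> y; have [g1 [g2 _]] := hg n; have [u1 [u2 _]] := hu.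
  have -> : 1 * fs (s n) y + (-1) * fs u y = Wt y * (pw p (s n y) - pw p (u y)) by rewrite /hrhs; ring.
  rewrite Rabs_mult.
  have Ce : 0 <= C * e1 by apply: Rmult_le_pos; lra.
  case: (Rle_dec (q2 y) 1) => hy; last first.
    rewrite g2 ?u2; try lra. rewrite Rminus_diag Rabs_R0; lra.
  rewrite Rabs_right; first exact: Rle_ge (Wt_ge0 _ _).
  have a1 := Wt_le1 al hal y hy; have a2 := Wt_ge0 al y.
  have a3 := hl _ _ (g1 y) (u1 y); have a4 := n1 y ltac:(lia); have a5 := Rabs_pos (s n y - u y).
  have a6 := Rabs_pos (pw p (s n y) - pw p (u y)).
  nra.
have gd := Green_bound _ _ x sd.
rewrite (Green_comb _ _ _ _ 1 (-1) x s1 s2) in gd.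
have gu := Green_bound _ _ x s2.
have pn : pw p a <= pw p (nn (s n)) by apply: pw_mono; [lra | exact: hn].
have i1 : 0 < / pw p (nn (s n)) by apply: Rinv_0_lt_compat; lra.
have i2 : / pw p (nn (s n)) <= / pw p a by apply: Rinv_le_contravar.
rewrite /step.
have -> : / pw p (nn (s n)) * Green (fs (s n)) x - / pw p (nn u) * Green (fs u) x =
  / pw p (nn (s n)) * (1 * Green (fs (s n)) x + -1 * Green (fs u) x) + (/ pw p (nn (s n)) - / pw p (nn u)) * Green (fs u) x by ring.
apply: Rle_trans (Rabs_triang _ _) _; rewrite !Rabs_mult (Rabs_right (/ _)); first lra.
have t1 : / pw p (nn (s n)) * Rabs (1 * Green (fs (s n)) x + -1 * Green (fs u) x) <= eps / 2.
  apply: (Rle_trans _ (/ pw p a * ((C + 1) * e1 * KG))).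
    apply: Rmult_le_compat; try lra; first exact: Rabs_pos.
    apply: Rle_trans gd _; apply: Rmult_le_compat_r; nra.
  apply: Req_le; rewrite /e1; field; repeat split; lra.
have t2 : Rabs (/ pw p (nn (s n)) - / pw p (nn u)) * Rabs (Green (fs u) x) <= eps / 2.
  apply: (Rle_trans _ (e2 * (pw p B * KG + 1))).
    apply: Rmult_le_compat; try exact: Rabs_pos; lra.
  apply: Req_le; rewrite /e2; field; lra.
lra.
Qed.

Lemma unif_cv_cone s u : unif_cv s u -> (forall n, conep (s n)) -> conep u.
Proof.
move=> h hc c t hct h0 x hx.
apply: (is_lim_seq_le _ _ (Finite _) (Finite _) _ (unif_cv_lim s u _ h) (unif_cv_lim s u x h)) => n; exact: hc.
Qed.

Theorem fixed_point w0 : ok w0 -> exists u, ok u /\ nn (step w0) <= nn u /\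
  (forall x, q2 x < 1 -> 0 < u x) /\ (forall x, 1 <= q2 x -> u x = 0) /\
  poisson u (fun x => / pw p (nn u) * fs u x).
Proof.
move=> h0.
(* Starting from [step w0] makes [step_bound] apply to every term, so all sources share the bound
   [M]; one more shift gives the common Lipschitz constant [L]. *)
pose W := fix W (k : nat) : pt -> R := match k with O => step w0 | S k' => step (W k') end.
have okW : forall k, ok (W k) by elim=> [|k IH] /=; exact: step_ok.
have mono1 : forall k, nn (W k) <= nn (W (S k)).
  by case=> [|k]; [exact: (nn_step_mono w0 h0) | exact: (nn_step_mono (W k) (okW k))].
have nW : forall k, nn (W O) <= nn (W k).
  elim=> [|k IH]; [exact: Rle_refl | exact: Rle_trans IH (mono1 k)].
have n0 : 0 < nn (W O) by case: (okW O) => _ [].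
have hB := Bp_pos.
pose M := pw p Bp.
have srcW : forall k, srcf (fs (W k)) M.
  move=> k; have [[L [B [g1 [g2 g3]]]] _] := okW k.
  apply: (fs_srcf al p hal hp _ L Bp); split; [|split => //].
  move=> x; split; first by have := g1 x; lra.
  case: k {g1 g2 g3} => [|k]; exact: step_bound.
pose L := / pw p (nn (W O)) * (M * KG).
have goodW : forall k, good (W (S k)) L L.
  move=> k; apply: step_good; first exact: srcW.
  split; [exact: pw_gt0 | apply: pw_mono; [lra | exact: nW]].
have [phi [u [hphi hu]]] := arzela (fun k => W (S k)) L L goodW.
have gu : good u L L by apply: (unif_cv_good _ u L L hu) => n; exact: goodW.
have UCu : unif_cv (fun n => W (S (phi n))) u by [].
have UCv := unif_cv_step _ u L L _ n0 hu (fun n => goodW (phi n)) gu (fun n => nW _).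
have gv : good (step u) L L by apply: (unif_cv_good _ _ L L UCv) => n; exact: (goodW (S (phi n))).
have UCz := unif_cv_step _ _ L L _ n0 UCv (fun n => goodW (S (phi n))) gv (fun n => nW (S (S (phi n)))).
have gz : good (step (step u)) L L by apply: (unif_cv_good _ _ L L UCz) => n; exact: (goodW (S (S (phi n)))).
have l1 := unif_cv_nn _ _ L L hu (fun n => goodW (phi n)) gu.
have l2 := unif_cv_nn _ _ L L UCv (fun n => goodW (S (phi n))) gv.
have l3 := unif_cv_nn _ _ L L UCz (fun n => goodW (S (S (phi n)))) gz.
(* the monotone sequence [nn (W k)] converges, so its subsequences share the limit *)
have Emax : forall k, nn (W (S k)) <= nn u.
  have monok : forall k j, nn (W k) <= nn (W (k + j)%nat).
    move=> k; elim=> [|j IH]; first by rewrite Nat.add_0_r; lra.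
    rewrite Nat.add_succ_r; exact: Rle_trans IH (mono1 _).
  move=> k; apply: (is_lim_seq_le_loc _ _ (Finite _) (Finite _) _ (is_lim_seq_const _) l1).
  exists k => n hn.
  have -> : S (phi n) = (S k + (phi n - k))%nat by have := hphi n; lia.
  exact: monok.
have nv : nn (step u) = nn u.
  apply: Rle_antisym.
    exact: (is_lim_seq_le (fun n => nn (W (S (S (phi n))))) _ (Finite _) (Finite _) (fun n => Emax _) l2 (is_lim_seq_const (nn u))).
  exact: (is_lim_seq_le (fun n => nn (W (S (phi n)))) (fun n => nn (W (S (S (phi n))))) (Finite _) (Finite _) (fun n => mono1 _) l1 l2).
have nz : nn (step (step u)) = nn u.
  apply: Rle_antisym.
    exact: (is_lim_seq_le (fun n => nn (W (S (S (S (phi n)))))) _ (Finite _) (Finite _) (fun n => Emax _) l3 (is_lim_seq_const (nn u))).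
  have : nn (step u) <= nn (step (step u)).
    exact: (is_lim_seq_le (fun n => nn (W (S (S (phi n))))) (fun n => nn (W (S (S (S (phi n)))))) (Finite _) (Finite _) (fun n => mono1 _) l2 l3).
  exact (Rle_trans _ _ _ (Req_le _ _ (eq_sym nv))).
have nu0 : nn (W O) <= nn u.
  exact: Rle_trans (mono1 O) (Emax O).
have oku : ok u.
  split; first by exists L, L. split; last lra.
  apply: (unif_cv_cone _ u hu) => n; by case: (okW (S (phi n))) => _ [].
have okv := step_ok u oku; have okz := step_ok _ okv.
(* [u], [step u] and [step (step u)] have the same norm, the limit of an increasing sequence; hence
   Hoelder's inequality between [u] and [step (step u)] is an equality. *)
have uz : forall x, u x = step (step u) x.
  have off : forall x, 0 < q2 x < 1 -> u x = step (step u) x.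
    have e : I2 (fun x => fs u x * step (step u) x) = pw p (nn u) * nn (step (step u)).
      exact (eq_trans (pairing u oku) (f_equal (Rmult _) (eq_trans nv (eq_sym nz)))).
    exact (holder_eq al p hal hp u _ (ok_cont u oku) (ok_cont _ okz) (ok_ge0 u oku) (ok_ge0 _ okz) (proj2 (proj2 oku)) nz e).
  move=> x; case: (Rlt_dec (q2 x) 1) => hx; last first.
    rewrite (proj1 (proj2 gu) x ltac:(lra)) (proj1 (proj2 gz) x ltac:(lra)); reflexivity.
  case: (Rlt_dec 0 (q2 x)) => hx0; first by apply: off.
  (* The weight vanishes at the origin, so equality there is recovered by continuity from the points
     [(t, 0)]. *)
  have ex : x = (0, 0).
    have : q2 x <= 0 by lra.
    case: (x) => a b; rewrite /q2 /= => hh.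
    have a0 : a = 0 by nra.
    have b0 : b = 0 by nra.
    by rewrite a0 b0.
  rewrite ex.
  apply: Rminus_diag_uniq; case: (Req_dec (u (0,0) - step (step u) (0,0)) 0) => // hne; exfalso.
  have cc : cont (fun x => u x - step (step u) x) by apply: cont_minus; exact: ok_cont.
  have := cc (0,0) => /filterlim_locally /(_ (mkposreal _ (Rabs_pos_lt _ hne))) [d hd].
  pose t := Rmin d 1 / 2; have dp := cond_pos d.
  have ht : 0 < t /\ t < d /\ t < 1.
    have := Rmin_l d 1; have := Rmin_r d 1; have : 0 < Rmin d 1 by apply: Rmin_glb_lt; lra.
    rewrite /t; lra.
  have hball : ball (0, 0) d (t, 0).
    split; rewrite /ball /= /AbsRing_ball /abs /minus /plus /opp /=; rewrite Ropp_0 Rplus_0_r.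
      rewrite Rabs_right; lra.
    rewrite Rabs_R0; lra.
  have := hd _ hball; rewrite /ball /= /AbsRing_ball /abs /minus /plus /opp /=.
  rewrite (off (t, 0)); first by rewrite /q2 /=; nra.
  rewrite Rminus_diag Rplus_0_l Rabs_Ropp; lra.
have pu : poisson u (fun x => / pw p (nn u) * fs (step u) x).
  have := step_poisson _ okv; rewrite nv; apply: poisson_ext => x; by rewrite uz.
have pv : poisson (step u) (fun x => / pw p (nn u) * fs u x) by exact: step_poisson.
have ip : 0 < / pw p (nn u) by apply: Rinv_0_lt_compat; exact: ok_nnp.
have cmp : forall a b, a <= b -> forall x, / pw p (nn u) * (Wt x * pw p a) <= / pw p (nn u) * (Wt x * pw p b).
  move=> a b hab x; apply: Rmult_le_compat_l; first lra. apply: Rmult_le_compat_l; first exact: Wt_ge0.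
  apply: pw_mono; lra.
have zu : forall x, 1 <= q2 x -> u x = 0 by case: gu => _ [].
have zv : forall x, 1 <= q2 x -> step u x = 0 by case: gv => _ [].
have cu := ok_cont u oku; have cv := ok_cont _ okv.
(* [u] and [step u] solve each other's equation: where one is smaller, its source is the larger,
   which [comparison] rules out. *)
have uv : forall x, u x = step u x.
  move=> x; apply: Rle_antisym.
    apply: (comparison _ _ _ _ cv cu zv zu pv pu) => y hy; apply: cmp; lra.
  apply: (comparison _ _ _ _ cu cv zu zv pu pv) => y hy; apply: cmp; lra.
exists u; split; [exact oku | split; [exact nu0 | split; [| split; [exact zu |]]]].
  move=> x hx; rewrite uv; exact (step_pos u x oku hx).
apply: (poisson_ext (step u)) pv => x; exact (eq_sym (uv x)).
Qed.

End Iter.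

(** * Radial solutions: pointwise bound *)

Lemma cont_bounded (f : R -> R) a b : a <= b -> cont f -> exists M, 0 <= M /\ forall t, a <= t <= b -> Rabs (f t) <= M.
Proof.
move=> hab hf.
have [x [h1 h2]] := continuity_ab_maj (fun t => Rabs (f t)) a b hab
   (fun c _ => proj2 (continuity_pt_filterlim _ _) (cont_Rabs _ f hf c)).
exists (Rabs (f x)); split; [exact: Rabs_pos | exact: h1].
Qed.

(** The majorant may be unbounded at 0, so a short interval [[0, d]] is handled by boundedness of
    [g] and the rest by the explicit primitive. *)
Lemma RInt_power_bound (g : R -> R) C eta : cont g -> 0 < eta -> 0 <= C ->
  (forall t, 0 < t < 1 -> g t <= C * Rpower t (eta - 1)) -> RInt g 0 1 <= C / eta.
Proof.
move=> hg he hC h; apply: Rle_plus_epsilon => eps heps.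
have [M [hM hb]] := cont_bounded g 0 1 ltac:(lra) hg.
pose d := Rmin (/ 2) (eps / (M + 1)).
have hd : 0 < d /\ d < 1 /\ d * M <= eps.
  have h1 : 0 < eps / (M + 1) by apply: Rdiv_lt_0_compat; lra.
  have h2 := Rmin_l (/ 2) (eps / (M + 1)); have h3 := Rmin_r (/ 2) (eps / (M + 1)).
  have h4 : 0 < d by apply: Rmin_glb_lt; lra.
  have e1 : eps / (M + 1) * (M + 1) = eps by field; lra.
  rewrite -/d in h2 h3; repeat split; nra.
have ei : forall a b, ex_RInt g a b by move=> a b; exact: ex_RInt_cont.
rewrite (RInt_split g 0 d 1 hg).
have t1 : RInt g 0 d <= eps.
  have h1 := abs_RInt_le_const g 0 d M ltac:(lra) (ei _ _) (fun t ht => hb t ltac:(lra)).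
  move: h1 => /Rabs_le_between; lra.
suff : RInt g d 1 <= C / eta by lra.
have D : forall t, d <= t -> is_derive (fun t => C / eta * Rpower t eta) t (C * Rpower t (eta - 1)).
  move=> t ht; evar_last; first by apply: is_derive_scal; apply: is_derive_Rpower; lra.
  field; lra.
have cC : forall t, d <= t <= 1 -> continuous (fun t => C * Rpower t (eta - 1)) t.
  move=> t ht; apply: (ex_derive_continuous (V := R_NormedModule)).
  eexists; apply: is_derive_scal; apply: is_derive_Rpower; lra.
apply: (Rle_trans _ (RInt (fun t => C * Rpower t (eta - 1)) d 1)).
  apply: RInt_le => //; first lra.
    by apply: ex_RInt_continuous => t; rewrite Rmin_left ?Rmax_right; try lra; exact: cC.
  move=> t ht; apply: h; lra.
rewrite (RInt_FTC (fun t => C / eta * Rpower t eta) _ d 1 ltac:(lra) (fun t ht => D t (proj1 ht)) cC).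
have -> : Rpower 1 eta = 1 by rewrite /Rpower ln_1 Rmult_0_r exp_0.
have := Rpower_pos d eta; have hce : 0 <= C / eta by apply: Rdiv_le_0_compat.
nra.
Qed.

Lemma cont_q2c : cont q2.
Proof. rewrite /q2; ctac. Qed.

Lemma rho2_0 y : rho2 (0, 0) y = q2 y.
Proof. rewrite /rho2 /q2 /=; ring. Qed.

Section Radial.
Variable H : R -> R.
Hypotheses (cH : cont H) (H1 : forall t, 1 <= t -> H t = 0).

Let M t := RInt H 0 t.

Lemma M_derive t : is_derive M t (H t).
Proof.
apply: (is_derive_RInt H M 0); last exact: cH.
apply: filter_forall => s; apply: RInt_correct; exact: ex_RInt_cont.
Qed.

Lemma cont_M : cont M.
Proof. move=> t; apply: (ex_derive_continuous (V := R_NormedModule)); eexists; exact: M_derive. Qed.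

Lemma M_out t : 1 <= t -> M t = M 1.
Proof.
move=> ht; rewrite /M.
rewrite (RInt_split H 0 1 t) //.
rewrite (RInt_ext_le H (fun _ => 0) 1 t) //; first by move=> x hx; apply: H1; lra.
rewrite RInt_const /scal /= /mult /=; ring.
Qed.

(** Regularisation of the radial field [x M(|x|^2) / |x|^2], whose divergence is [2 H(|x|^2)].
    [dVf e i] is the derivative of component [i] in direction [i]. *)
Definition Vf e i (x : pt) := co i x * (M (q2 x) / (q2 x + e)).
Definition dVf e i (x : pt) := M (q2 x) / (q2 x + e) + 2 * co i x ^ 2 * (H (q2 x) / (q2 x + e) - M (q2 x) / (q2 x + e) ^ 2).

Lemma pd_Vf e i x : 0 < e -> pd i (Vf e i) x (dVf e i x).
Proof.
move=> he; have hq := q2_ge0 x.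
have dq : is_derive (fun t => q2 (upc i x t)) (co i x) (2 * co i x).
  rewrite /q2; case: i => /=; auto_derive => //; ring.
rewrite /pd /Vf.
apply: (is_derive_ext (fun t => t * (M (q2 (upc i x t)) / (q2 (upc i x t) + e)))); first by move=> t; rewrite co_up.
evar_last.
  apply: (is_derive_mult (K := R_AbsRing) (fun t => t) (fun t => M (q2 (upc i x t)) / (q2 (upc i x t) + e))).
  - exact: is_derive_id.
  - apply: is_derive_div.
    + apply: is_derive_comp; [exact: M_derive | exact: dq].
    + apply: (is_derive_plus (V := R_NormedModule)); [exact: dq | exact: is_derive_const].
    + rewrite up_co; lra.
  - move=> n m; exact: Rmult_comm.
rewrite /plus /mult /scal /one /zero /= /mult /= !up_co /dVf; field; lra.
Qed.

Lemma cont_q2e e : 0 < e -> cont (fun x => q2 x + e).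
Proof. move=> he; apply: cont_plus; [exact: cont_q2c | exact: cont_const]. Qed.

Lemma cont_Mq : cont (fun x : pt => M (q2 x)).
Proof. apply: (cont_comp _ _ q2 M); [exact: cont_q2c | exact: cont_M]. Qed.
Lemma cont_Hq : cont (fun x : pt => H (q2 x)).
Proof. apply: (cont_comp _ _ q2 H); [exact: cont_q2c | exact: cH]. Qed.

Lemma cont_dVf e i : 0 < e -> cont (dVf e i).
Proof.
move=> he; have c1 := cont_q2e e he; have c2 := cont_Mq; have c3 := cont_Hq.
have hp : forall z, 0 < q2 z + e by move=> z; have := q2_ge0 z; lra.
have c4 : cont (fun x : pt => co i x) by apply: cont_co => z; exact: continuous_id.
apply: cont_plus; first exact: cont_div.
apply: cont_mult; first by apply: cont_mult; [exact: cont_const | exact: cont_pow].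
apply: cont_minus; apply: cont_div => //; first exact: cont_pow.
move=> z; exact: pow_lt.
Qed.

Lemma I2_dVf e i : 0 < e -> I2 (dVf e i) = M 1 * Jp 1 0 e.
Proof.
move=> he.
have line : forall t, RInt (fun s => dVf e i (upc i (t, t) s)) (-1) 1 = M 1 * (2 * 1 / (1 ^ 2 + (0 - t) ^ 2 + e)).
  move=> t.
  rewrite (RInt_FTC (fun s => Vf e i (upc i (t, t) s))); first lra.
  - move=> s _; apply: (pd_line i (Vf e i)); exact: pd_Vf.
  - move=> s _; have : cont (fun s => dVf e i (upc i (t, t) s)).
      apply: cont_comp; [exact: (cont_up R_UniformSpace (t, t) i (fun s => s) cont_id) | exact: cont_dVf].
    by apply.
  have qe : forall s, s = 1 \/ s = -1 -> q2 (upc i (t, t) s) = 1 + t ^ 2.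
    by move=> s hs; rewrite /q2; case: (i); case: hs => -> /=; ring.
  rewrite /Vf !co_up !qe; try (by left); try (by right).
  rewrite M_out; first by have := pow2_ge_0 t; lra.
  have h := pow2_ge_0 t; rewrite /= in h; rewrite /=; field; simpl; nra.
have -> : M 1 * Jp 1 0 e = RInt (fun t => M 1 * (2 * 1 / (1 ^ 2 + (0 - t) ^ 2 + e))) (-1) 1.
  rewrite RInt_scalR //; apply: ex_RInt_cont; apply: cont_Jp; lra.
Transparent I2.
rewrite /I2; move: line; case: i => line.
  rewrite Fubini_RInt; try lra; first exact: cont_dVf.
  apply: RInt_ext => t _; exact: line.
apply: RInt_ext => t _; exact: line.
Opaque I2.
Qed.

(** Integration in polar coordinates by way of the divergence theorem on the square: on its edges
    [q2 >= 1], so [M] equals [M 1], and the flux reduces to the arctangent integrals [Jp 1 0 e],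
    which tend to [PI]. *)
Lemma radial_integral : I2 (fun x => H (q2 x)) = PI * RInt H 0 1.
Proof.
have [h0 [h00 hb]] := cont_bounded H 0 2 ltac:(lra) cH.
have hM : forall t, 0 <= t <= 2 -> Rabs (M t) <= h0 * t.
  move=> t ht; have := abs_RInt_le_const H 0 t h0 ltac:(lra) (ex_RInt_cont _ _ _ cH) (fun s hs => hb s ltac:(lra)).
  rewrite /M; lra.
have est : forall e, 0 < e <= 1 -> Rabs (2 * I2 (fun x => H (q2 x)) - 2 * (M 1 * Jp 1 0 e)) <= (4 * h0) * KG * Rpower e (/ 2).
  move=> e he.
  have c1 := cont_dVf e true ltac:(lra); have c2 := cont_dVf e false ltac:(lra); have cq := cont_Hq.
  have -> : 2 * (M 1 * Jp 1 0 e) = I2 (dVf e true) + I2 (dVf e false) by rewrite !I2_dVf; lra.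
  rewrite -I2_plus // -I2_scal // -I2_minus; [apply: cont_mult => //; exact: cont_const | exact: cont_plus |].
  have -> : (4 * h0) * KG * Rpower e (/ 2) = ((4 * h0) * Rpower e (/ 2)) * Csing (/ 2) by rewrite /KG; ring.
  have hr := Rpower_pos e (/ 2).
  apply: (I2_sing _ (0, 0) e (/ 2)); try lra; last by apply: Rmult_le_pos; lra.
  - apply: cont_minus; [apply: cont_mult => //; exact: cont_const | exact: cont_plus].
  - rewrite /inQ /=; lra.
  move=> y hy; rewrite rho2_0.
  have hq := q2_ge0 y.
  have hq2 : q2 y <= 2.
    case: hy => a b; rewrite /q2.
    have b1 : fst y ^ 2 <= 1 by nra.
    have b2 : snd y ^ 2 <= 1 by nra.
    lra.
  have -> : 2 * H (q2 y) - (dVf e true y + dVf e false y) =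
    (2 * H (q2 y) - 2 * (M (q2 y) / (q2 y + e))) * (e / (q2 y + e)).
    rewrite /dVf /co.
    have -> : 2 * H (q2 y) - (M (q2 y) / (q2 y + e) + 2 * fst y ^ 2 * (H (q2 y) / (q2 y + e) - M (q2 y) / (q2 y + e) ^ 2) +
      (M (q2 y) / (q2 y + e) + 2 * snd y ^ 2 * (H (q2 y) / (q2 y + e) - M (q2 y) / (q2 y + e) ^ 2))) =
      2 * H (q2 y) - 2 * (M (q2 y) / (q2 y + e)) - 2 * (fst y ^ 2 + snd y ^ 2) * (H (q2 y) / (q2 y + e) - M (q2 y) / (q2 y + e) ^ 2) by ring.
    rewrite -/(q2 y); field; lra.
  rewrite Rabs_mult.
  have r0 : 0 <= e / (q2 y + e) by apply: Rdiv_le_0_compat; lra.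
  rewrite (Rabs_right _ (Rle_ge _ _ r0)).
  have hr1 := ratio_le e (q2 y + e) (q2 y + e) (/ 2) ltac:(lra) ltac:(lra) ltac:(lra).
  have -> : - (1 - / 2) = - / 2 by field.
  rewrite (Rmult_assoc (4 * h0)).
  apply: Rmult_le_compat => //; first exact: Rabs_pos.
  have b1 := hb (q2 y) ltac:(lra).
  have b2 : Rabs (M (q2 y) / (q2 y + e)) <= h0.
    rewrite Rabs_div; first lra. rewrite (Rabs_right (q2 y + e)); first lra.
    apply/Rle_div_l; first lra. have := hM (q2 y) ltac:(lra); nra.
  move: b1 b2 => /Rabs_le_between b1 /Rabs_le_between b2; apply: Rabs_le; lra.
have l1 : is_lim_seq (fun n => 2 * (M 1 * Jp 1 0 (sq n))) (2 * I2 (fun x => H (q2 x))).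
  have hK := KG_pos.
  apply: (seq_rate _ _ ((4 * h0) * KG) (/ 2)); try lra; first by apply: Rmult_le_pos; lra.
  move=> n; rewrite Rabs_minus_sym; apply: est; exact: sq_pos.
have l2 : is_lim_seq (fun n => 2 * (M 1 * Jp 1 0 (sq n))) (2 * (M 1 * PI)).
  apply: (is_lim_seq_scal_l _ _ (Finite _)); apply: (is_lim_seq_scal_l _ _ (Finite _)).
  apply: (seq_rate _ _ 8 1); try lra.
  move=> n; have hn := sq_pos n; rewrite Rpower_1; first lra.
  have e0 : Jp 1 0 0 = PI.
    rewrite Jp0; first lra. have -> : (1 - 0) / 1 = 1 by field. have -> : (1 + 0) / 1 = 1 by field.
    rewrite atan_1; lra.
  have := Jp_close 1 0 (sq n) 1 ltac:(lra) ltac:(lra) ltac:(lra); rewrite e0.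
  have -> : 2 * (4 * (sq n / 1 ^ 2 / 1 ^ 2)) = 8 * sq n by field.
  done.
have e1 := is_lim_seq_unique _ _ l1; have e2 := is_lim_seq_unique _ _ l2.
have e3 : 2 * I2 (fun x => H (q2 x)) = 2 * (M 1 * PI) by exact (f_equal real (eq_trans (eq_sym e1) e2)).
rewrite /M in e3; lra.
Qed.

End Radial.

Section RadialODE.
Variables (U U' F : R -> R) (Phi : R -> R).
Hypotheses (cU : cont U) (U1 : U 1 = 0) (cPhi : cont Phi).
Hypothesis dU : forall r, 0 < r < 1 -> is_derive U r (U' r).
Hypothesis dU' : forall r, 0 < r < 1 -> is_derive U' r (- F r - U' r / r).
Hypothesis U'0 : exists C d, 0 < d < 1 /\ forall r, 0 < r < d -> Rabs (U' r) <= C.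
Hypothesis U0 : forall r, 0 <= U r.
Hypothesis F0 : forall r, 0 < r < 1 -> 0 <= F r.
Hypothesis Phi0 : forall t, 0 <= t -> 0 <= Phi t.
Hypothesis PhiF : forall r, 0 < r < 1 -> Phi (r ^ 2) = F r * U r.

(** [B] has derivative [- r U'(r)^2]: it plays the role of the Dirichlet energy outside radius [r],
    written after an integration by parts so that no control of [U'] near [r = 1] is involved. [b]
    is the corresponding total energy. *)
Let b := / 2 * RInt Phi 0 1.
Let M r := - r * U' r.
Let B r := M r * U r + / 2 * RInt Phi (r ^ 2) 1.

Lemma dM r : 0 < r < 1 -> is_derive M r (r * F r).
Proof.
move=> hr; rewrite /M; evar_last.
  apply: (is_derive_mult (K := R_AbsRing) (fun r => - r) U'); [|exact: (dU' r hr)|move=> *; exact: Rmult_comm].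
  apply: (is_derive_opp (V := R_NormedModule)); exact: is_derive_id.
rewrite /plus /mult /opp /one /=; field; lra.
Qed.

Lemma incr_from_derive (f f' : R -> R) : (forall r, 0 < r < 1 -> is_derive f r (f' r)) -> (forall r, 0 < r < 1 -> 0 <= f' r) ->
  forall s r, 0 < s <= r -> r < 1 -> f s <= f r.
Proof.
move=> h h0 s r hs hr.
have [c [hc1 hc2]] := MVT_le f f' s r (proj2 hs) (fun t ht => h t ltac:(lra)).
have := h0 c ltac:(lra); nra.
Qed.

Lemma M_incr s r : 0 < s <= r -> r < 1 -> M s <= M r.
Proof. apply: (incr_from_derive M (fun r => r * F r) dM) => t ht; apply: Rmult_le_pos; [lra | exact: F0]. Qed.

Lemma M_small eps : 0 < eps -> exists d, 0 < d < 1 /\ forall r, 0 < r < d -> Rabs (M r) <= eps.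
Proof.
move=> he; have [C [d [hd h]]] := U'0.
have hC : 0 <= C by apply: Rle_trans (h (d / 2) ltac:(lra)); exact: Rabs_pos.
have h1 : 0 < eps / (C + 1) by apply: Rdiv_lt_0_compat; lra.
exists (Rmin d (eps / (C + 1))); split.
  split; first by apply: Rmin_glb_lt; lra. apply: Rle_lt_trans (Rmin_l _ _) _; lra.
move=> r hr; have h2 := Rmin_l d (eps / (C + 1)); have h3 := Rmin_r d (eps / (C + 1)).
rewrite /M Rabs_mult Rabs_Ropp Rabs_right; first lra.
have h4 := h r ltac:(lra); have h5 := Rabs_pos (U' r).
have e1 : eps / (C + 1) * (C + 1) = eps by field; lra.
apply: (Rle_trans _ (eps / (C + 1) * (C + 1))); last lra.
apply: Rmult_le_compat; lra.
Qed.

Lemma M_ge0 r : 0 < r < 1 -> 0 <= M r.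
Proof.
move=> hr; apply: Rle_plus_epsilon => eps he.
have [d [hd h]] := M_small eps he.
have hm : 0 < Rmin (d / 2) r by apply: Rmin_glb_lt; lra.
have h1 := h (Rmin (d / 2) r) ltac:(have := Rmin_l (d / 2) r; lra).
have h2 := M_incr (Rmin (d / 2) r) r ltac:(have := Rmin_r (d / 2) r; lra) ltac:(lra).
move: h1 => /Rabs_le_between; lra.
Qed.

Lemma dB r : 0 < r < 1 -> is_derive B r (- (M r ^ 2 / r)).
Proof.
move=> hr; rewrite /B.
have dI : is_derive (fun r => RInt Phi (r ^ 2) 1) r (- Phi (r ^ 2) * (2 * r)).
  evar_last.
    apply: (is_derive_comp (fun t => RInt Phi t 1) (fun r => r ^ 2)).
      apply: (is_derive_RInt' Phi _ (r ^ 2) 1); last exact: cPhi.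
      apply: filter_forall => s; apply: RInt_correct; exact: ex_RInt_cont.
    auto_derive; [done | reflexivity].
  rewrite /scal /= /mult /opp /=; ring.
evar_last.
  apply: (is_derive_plus (V := R_NormedModule)).
    apply: (is_derive_mult (K := R_AbsRing) M U); [exact: dM | exact: (dU r hr) | move=> *; exact: Rmult_comm].
  apply: is_derive_scal; exact: dI.
rewrite /plus /mult /= PhiF // /M; field; lra.
Qed.

Lemma B_decr s r : 0 < s <= r -> r < 1 -> B r <= B s.
Proof.
move=> hs hr.
have := incr_from_derive (fun r => - B r) (fun r => M r ^ 2 / r) _ _ s r hs hr.
suff h1 : forall r, 0 < r < 1 -> is_derive (fun r => - B r) r (M r ^ 2 / r).
  suff h2 : forall r, 0 < r < 1 -> 0 <= M r ^ 2 / r by move=> /(_ h1 h2); lra.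
  move=> t ht; apply: Rdiv_le_0_compat; [exact: pow2_ge_0 | lra].
move=> t ht; evar_last; first by apply: (is_derive_opp (V := R_NormedModule)); exact: dB.
rewrite /opp /=; ring.
Qed.

Lemma RInt_Phi_tail s : 0 <= s <= 1 -> 0 <= RInt Phi s 1 <= RInt Phi 0 1.
Proof.
move=> hs; have ei : forall a b, ex_RInt Phi a b by move=> x y; exact: ex_RInt_cont.
split; first by apply: RInt_ge_0 => //; [lra | move=> t ht; apply: Phi0; lra].
rewrite (RInt_split Phi 0 s 1) //.
have : 0 <= RInt Phi 0 s by apply: RInt_ge_0 => //; [lra | move=> t ht; apply: Phi0; lra].
lra.
Qed.

Lemma B_ge0 r : 0 < r < 1 -> 0 <= B r.
Proof.
move=> hr; have h := RInt_Phi_tail (r ^ 2) ltac:(nra).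
have := Rmult_le_pos _ _ (M_ge0 r hr) (U0 r); rewrite /B; lra.
Qed.

Lemma B_le r : 0 < r < 1 -> B r <= b.
Proof.
move=> hr; apply: Rle_plus_epsilon => eps he.
have [K [hK hb]] := cont_bounded U 0 1 ltac:(lra) cU.
have [d [hd h]] := M_small (eps / (K + 1)) ltac:(apply: Rdiv_lt_0_compat; lra).
pose s := Rmin (d / 2) r.
have hs : 0 < s by apply: Rmin_glb_lt; lra.
have sl := Rmin_l (d / 2) r; have sr := Rmin_r (d / 2) r; rewrite -/s in sl sr.
apply: Rle_trans (B_decr s r ltac:(lra) ltac:(lra)) _.
have h1 := h s ltac:(lra); have h2 := hb s ltac:(lra).
have h3 := RInt_Phi_tail (s ^ 2) ltac:(nra).
have h4 := M_ge0 s ltac:(lra); have h5 := U0 s.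
rewrite Rabs_right in h1; first lra. rewrite Rabs_right in h2; first lra.
have e1 : eps / (K + 1) * (K + 1) = eps by field; lra.
have : M s * U s <= eps / (K + 1) * (K + 1) by apply: Rmult_le_compat; lra.
rewrite /B /b; lra.
Qed.

(* For fixed [c], the defect in [U <= c B / 2 + ln (1/r) / (2 c)] is monotone by completing the square. *)
Lemma U_bound_c c r : 0 < c -> 0 < r < 1 -> U r <= c * b / 2 + - ln r / (2 * c).
Proof.
move=> hc hr.
pose Z r := c / 2 * B r + (/ (2 * c)) * - ln r - U r.
have dZ : forall r, 0 < r < 1 -> is_derive (fun r => - Z r) r ((c * M r - 1) ^ 2 / (2 * c * r)).
  move=> t ht; rewrite /Z; evar_last.
    apply: (is_derive_opp (V := R_NormedModule)).
    apply: (is_derive_minus (V := R_NormedModule)); last exact: (dU t ht).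
    apply: (is_derive_plus (V := R_NormedModule)).
      apply: is_derive_scal; exact: dB.
    apply: is_derive_scal; apply: (is_derive_opp (V := R_NormedModule)); apply: is_derive_ln; lra.
  rewrite /minus /opp /plus /= /M; field; lra.
have Zd : forall s, r <= s < 1 -> Z s <= Z r.
  move=> s hs; have := incr_from_derive _ _ dZ _ r s ltac:(lra) ltac:(lra).
  suff h : forall t, 0 < t < 1 -> 0 <= (c * M t - 1) ^ 2 / (2 * c * t) by move=> /(_ h); lra.
  move=> t ht; apply: Rdiv_le_0_compat; [exact: pow2_ge_0 | nra].
have Z0 : 0 <= Z r.
  apply: Rle_plus_epsilon => eps he.
  have := cU 1 => /filterlim_locally /(_ (mkposreal _ he)) [d hd]; have dp := cond_pos d.
  pose s := Rmax r (1 - d / 2).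
  have hs : r <= s /\ 1 - d / 2 <= s /\ s < 1.
    rewrite /s; split; [exact: Rmax_l | split; [exact: Rmax_r | apply: Rmax_lub_lt; lra]].
  have hus : U s < eps.
    have := hd s; rewrite /ball /= /AbsRing_ball /abs /minus /plus /opp /= U1.
    have hb : Rabs (s + - 1) < d by apply: Rabs_def1; lra.
    move=> /(_ hb) /Rabs_lt_between; lra.
  have h1 := Zd s ltac:(lra); have h2 := B_ge0 s ltac:(lra).
  have h3 : ln s <= 0 by rewrite -ln_1; apply: ln_le; lra.
  have h4 : 0 < / (2 * c) by apply: Rinv_0_lt_compat; lra.
  have : 0 <= c / 2 * B s by apply: Rmult_le_pos; lra.
  have : 0 <= / (2 * c) * - ln s by apply: Rmult_le_pos; lra.
  rewrite /Z in h1 |- *; lra.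
have h1 := B_le r hr.
have h2 : c / 2 * B r <= c / 2 * b by apply: Rmult_le_compat_l; lra.
rewrite /Z in Z0; lra.
Qed.

Lemma U_sq_bound r : 0 < r < 1 -> 0 < b -> U r ^ 2 <= b * - ln r.
Proof.
move=> hr hb.
have hl : 0 < - ln r by have := ln_increasing r 1 ltac:(lra) ltac:(lra); rewrite ln_1; lra.
set l := - ln r; rewrite -/l in hl.
(* The value of [c] minimising [c b / 2 + l / (2 c)]; the minimum is [sqrt (b l)]. *)
pose c := sqrt (l / b).
have hlb : 0 < l / b by apply: Rdiv_lt_0_compat.
have hc : 0 < c by apply: sqrt_lt_R0.
have c2 : c * c = l / b by apply: sqrt_sqrt; lra.
have h := U_bound_c c r hc hr; rewrite -/l in h.
have el : l = b * (c * c) by rewrite c2; field; lra.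
have e1 : c * b / 2 + l / (2 * c) = b * c by rewrite el; field; lra.
rewrite e1 in h; have h0 := U0 r.
have -> : b * l = (b * c) ^ 2 by rewrite el; ring.
apply: pow_incr; lra.
Qed.

End RadialODE.

(** * Radial solutions: norm bound *)

Lemma is_derive_id_mult (k : R -> R) : continuous k 0 -> is_derive (fun y => y * k y) 0 (k 0).
Proof.
move=> hk; apply/is_derive_Reals => eps he.
have := hk => /filterlim_locally /(_ (mkposreal _ he)) [d hd].
exists d => h hne hlt.
have -> : ((0 + h) * k (0 + h) - 0 * k 0) / h - k 0 = k h - k 0 by rewrite Rplus_0_l; field.
have := hd h; rewrite /ball /= /AbsRing_ball /abs /minus /plus /opp /= Ropp_0 Rplus_0_r.
by apply.
Qed.

(** Along the vertical line through [(r, 0)], the tangential derivative of a radial function is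
    [y k(y)] with [k] continuous and [k(0)] the radial derivative over [r]; differentiating at
    [y = 0] uses only continuity of [k]. *)
Lemma radial_tangential (u : pt -> R) (d : bool -> pt -> R) (l r : R) :
  (forall i x, q2 x < 1 -> continuous (d i) x) -> (forall i x, q2 x < 1 -> pd i u x (d i x)) ->
  (forall x, u x = u (sqrt (q2 x), 0)) -> 0 < r < 1 -> pd false (d false) (r, 0) l -> l = d true (r, 0) / r.
Proof.
move=> hc hd hrad hr hl.
pose s y := sqrt (r ^ 2 + y ^ 2).
have hpos : forall y, 0 < r ^ 2 + y ^ 2 by move=> y; nra.
have spos : forall y, 0 < s y by move=> y; apply: sqrt_lt_R0.
have s0 : s 0 = r.
  have e : r ^ 2 + 0 ^ 2 = r ^ 2 by ring.
  rewrite /s e sqrt_pow2; lra.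
have ssq : forall y, s y ^ 2 = r ^ 2 + y ^ 2 by move=> y; rewrite /s pow2_sqrt //; have := hpos y; lra.
have loc : locally 0 (fun y => r ^ 2 + y ^ 2 < 1).
  have hq : q2 (r, 0) < 1 by rewrite /q2 /=; nra.
  exact: (locally_line false (r, 0) (fun y => q2 y < 1) (locally_disc _ hq)).
have dsq : forall y, is_derive s y (y / s y).
  move=> y; rewrite /s; auto_derive; first by have := hpos y; simpl; lra.
  have := spos y; rewrite /s /= => h; field; lra.
have eqd : forall y, r ^ 2 + y ^ 2 < 1 -> d false (r, y) = y * (d true (s y, 0) / s y).
  move=> y hy.
  have h1 := hd false (r, y) hy; rewrite /pd /= in h1.
  have h2 : is_derive (fun t => u (r, t)) y (y / s y * d true (s y, 0)).
    apply: (is_derive_ext (fun t => u (s t, 0))).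
      move=> t; by rewrite (hrad (r, t)).
    apply: (is_derive_comp (fun z => u (z, 0)) s); last exact: dsq.
    apply: (hd true (s y, 0)); rewrite /q2 /= -ssq in hy |- *; nra.
  have e := is_derive_unique _ _ _ h1; rewrite (is_derive_unique _ _ _ h2) in e.
  rewrite -e; have := spos y => h; field; lra.
have hk : continuous (fun y => d true (s y, 0) / s y) 0.
  apply: (continuous_mult (K := R_AbsRing)).
    apply: (continuous_comp (fun y => (s y, 0)) (d true)).
      apply: continuous_pair; last exact: continuous_const.
      apply: (ex_derive_continuous (V := R_NormedModule)); eexists; exact: dsq.
    apply: hc; rewrite s0 /q2 /=; nra.
  apply: (continuous_comp s Rinv).
    apply: (ex_derive_continuous (V := R_NormedModule)); eexists; exact: dsq.
  apply: continuous_Rinv; have := spos 0; lra.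
have h3 := is_derive_id_mult _ hk.
have h4 : is_derive (fun y => d false (r, y)) 0 (d true (s 0, 0) / s 0).
  apply: (is_derive_ext_loc (fun y => y * (d true (s y, 0) / s y))); last exact: h3.
  apply: filter_imp loc => y hy; by rewrite eqd.
rewrite /pd /= in hl.
have e := is_derive_unique _ _ _ hl; rewrite (is_derive_unique _ _ _ h4) s0 in e.
by rewrite -e.
Qed.

(** With [k = 1 + al/4], the maximum over [t] of [(- ln t)^m t^k] is [(m / (e k))^m], by
    [1 + ln z <= z]. The remaining [t^(al/4 - 1)] keeps part of the weight back for
    integrability. *)
Lemma log_power_bound al m t : 0 < al -> 0 < m -> 0 < t < 1 ->
  Rpower (- ln t) m * Rpower t (al / 2) <= Rpower (m / (exp 1 * (1 + al / 4))) m * Rpower t (al / 4 - 1).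
Proof.
move=> hal hm ht.
have hl : 0 < - ln t by have := ln_increasing t 1 ltac:(lra) ltac:(lra); rewrite ln_1; lra.
have he := exp_pos 1.
set k := 1 + al / 4; have hk : 0 < k by rewrite /k; lra.
rewrite /Rpower -!exp_plus; apply: exp_le.
rewrite ln_div; [lra | nra |]. rewrite ln_mult // ln_exp.
have hz : 0 < k * (- ln t) / m by apply: Rdiv_lt_0_compat => //; apply: Rmult_lt_0_compat.
have h := exp_ineq1_le (ln (k * (- ln t) / m)); rewrite exp_ln // in h.
rewrite ln_div // in h; first by apply: Rmult_lt_0_compat.
rewrite ln_mult // in h.
have h2 := Rmult_le_compat_r m _ _ (Rlt_le _ _ hm) h.
have e : k * (- ln t) / m * m = k * - ln t by field; lra.
rewrite e /k in h2; rewrite /k; lra.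
Qed.

Section RB.
Variables (al p : R).
Hypotheses (hal : 0 < al) (hp : 1 < p).
Local Notation Wt := (wgt al).
Local Notation fs := (hrhs al p).
Local Notation En := (energy al p).
Local Notation nn := (pnorm al p).
Let m := (p + 1) / 2.

(** The pointwise bound with [b / 2 = nn u / (4 PI)] gives [nn u] to the power [2 m] at most [nn u]
    to the power [m] times an explicit constant; one factor cancels. *)
Theorem radial_bound u : ok al p u -> (forall x, 1 <= q2 x -> u x = 0) ->
  poisson u (fun x => / pw p (nn u) * fs u x) -> (exists g : R -> R, forall x, q2 x < 1 -> u x = g (q2 x)) ->
  pw m (nn u) <= 4 * PI / al * pw m (m / (exp 1 * (1 + al / 4)) * / (4 * PI)).
Proof.
move=> oku uz [d [h [hdc [hhc [hd [hh hf]]]]]] [g hg].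
have cu := ok_cont al p u oku; have u0 := ok_ge0 al p u oku; have n1 := ok_nnp al p u oku.
have hA : 0 < nn u by case: oku => _ [].
have hm : 1 < m by rewrite /m; lra.
have hpi := PI_RGT_0.
have hrad : forall x, u x = u (sqrt (q2 x), 0).
  move=> x; have e : q2 (sqrt (q2 x), 0) = q2 x.
    rewrite /q2 /= -/(q2 x); have := sqrt_sqrt (q2 x) (q2_ge0 x); rewrite /q2 /=; lra.
  case: (Rlt_dec (q2 x) 1) => hx; first by rewrite !hg ?e.
  rewrite !uz ?e; lra.
have q2r : forall r, q2 (r, 0) = r ^ 2 by move=> r; rewrite /q2 /=; ring.
pose U r := u (r, 0).
pose F r := / pw p (nn u) * fs u (r, 0).
pose Phi t := F (sqrt t) * U (sqrt t).
have cU : cont U by rewrite /U; ctac.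
have cF : cont F.
  apply: cont_mult; first exact: cont_const.
  have := cont_fs al p hal hp u cu => c; ctac.
have csq : cont sqrt by move=> z; exact: continuous_sqrt.
have cPhi : cont Phi by apply: cont_mult; apply: cont_comp.
have U1 : forall r, 1 <= r -> U r = 0 by move=> r hr; rewrite /U uz // q2r; nra.
have Phi1 : forall t, 1 <= t -> Phi t = 0.
  move=> t ht; rewrite /Phi U1; last by ring. rewrite -sqrt_1; exact: sqrt_le_1_alt.
have ip : 0 < / pw p (nn u) by apply: Rinv_0_lt_compat.
have F0 : forall r, 0 <= F r by move=> r; apply: Rmult_le_pos; [lra | exact: fs_ge0].
have Wsq : forall x, Wt (sqrt (q2 x), 0) = Wt x.
  move=> x; rewrite /wgt q2r pow2_sqrt //; exact: q2_ge0.
have Phiq : forall x, Phi (q2 x) = / pw p (nn u) * (Wt x * pw (p + 1) (u x)).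
  move=> x; rewrite /Phi /F /U /hrhs Wsq -hrad -(pw_split p) //; ring.
(* The equation tested with [u]: the multiplier [nn u] to the power [- p] times the energy [nn u] to
   the power [p + 1]. *)
have iPhi : PI * RInt Phi 0 1 = nn u.
  rewrite -(radial_integral Phi cPhi Phi1).
  rewrite (I2_ext _ (fun x => / pw p (nn u) * (Wt x * pw (p + 1) (u x)))); first by move=> x _.
  rewrite I2_scal; first by apply: cont_Wpw => //; lra.
  rewrite -/(En u) -(nn_pow al p hal hp u cu) -(pw_split p); first lra. field; lra.
pose H2 t := pw (al / 2) t * pw (p + 1) (U (sqrt t)).
have cH2 : cont H2.
  apply: cont_mult; first by apply: cont_pw1; lra.
  apply: cont_pw; first lra. exact: cont_comp.
have H21 : forall t, 1 <= t -> H2 t = 0.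
  move=> t ht; rewrite /H2 U1 ?pw_0; last by ring. rewrite -sqrt_1; exact: sqrt_le_1_alt.
have iH2 : PI * RInt H2 0 1 = pw (p + 1) (nn u).
  rewrite -(radial_integral H2 cH2 H21) (nn_pow al p hal hp u cu).
  apply: I2_ext => x _; by rewrite /H2 /U -hrad.
set b := / 2 * RInt Phi 0 1.
have eb : b = nn u / (2 * PI) by rewrite /b -iPhi; field; lra.
have hb : 0 < b by rewrite eb; apply: Rdiv_lt_0_compat; lra.
have hdisc : forall r, 0 < r < 1 -> q2 (r, 0) < 1 by move=> r hr; rewrite q2r; nra.
have Ub : forall r, 0 < r < 1 -> U r ^ 2 <= b * - ln r.
  move=> r hr; apply: (U_sq_bound U (fun r => d true (r, 0)) F Phi) => //.
  - apply: U1; lra.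
  - move=> s hs; exact: (hd true (s, 0) (hdisc s hs)).
  - move=> s hs.
    have h1 := hh true true (s, 0) (hdisc s hs).
    have h2 := radial_tangential u d _ s hdc hd hrad hs (hh false false (s, 0) (hdisc s hs)).
    have h3 := hf (s, 0) (hdisc s hs).
    have -> : - F s - d true (s, 0) / s = h true true (s, 0) by rewrite /F -h3 h2; ring.
    exact: h1.
  - have q0 : q2 (0, 0) < 1 by rewrite /q2 /=; lra.
    have p1 : 0 < 1 by lra.
    have := hdc true (0, 0) q0 => /filterlim_locally /(_ (mkposreal 1 p1)) [e he].
    exists (Rabs (d true (0, 0)) + 1), (Rmin e (/ 2)); have ep := cond_pos e.
    split; first by split; [apply: Rmin_glb_lt; lra | apply: Rle_lt_trans (Rmin_r _ _) _; lra].
    move=> s hs; have hs1 := Rmin_l e (/ 2).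
    have hbl : ball (0, 0) e (s, 0).
      split; rewrite /ball /= /AbsRing_ball /abs /minus /plus /opp /=; rewrite Ropp_0 Rplus_0_r.
        rewrite Rabs_right; lra.
      rewrite Rabs_R0; lra.
    have := he _ hbl; rewrite /ball /= /AbsRing_ball /abs /minus /plus /opp /= => hq.
    have e1 : d true (s, 0) = (d true (s, 0) + - d true (0, 0)) + d true (0, 0) by ring.
    rewrite e1; apply: Rle_trans (Rabs_triang _ _) _; lra.
  - move=> s; exact: (u0 (s, 0)).
  - move=> t _; apply: Rmult_le_pos; [exact: F0 | exact: (u0 (_, _))].
  - move=> s hs; rewrite /Phi sqrt_pow2; [lra | done].
have pb := pw_ge0 m (b / 2).
have ek : 0 < exp 1 * (1 + al / 4) by apply: Rmult_lt_0_compat; [exact: exp_pos | lra].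
have hbound : RInt H2 0 1 <= (pw m (b / 2) * Rpower (m / (exp 1 * (1 + al / 4))) m) / (al / 4).
  apply: RInt_power_bound => //; first lra.
    apply: Rmult_le_pos => //; exact: Rlt_le (Rpower_pos _ _).
  move=> t ht; rewrite /H2.
  have hs : 0 < sqrt t < 1.
    split; first by apply: sqrt_lt_R0; lra. rewrite -sqrt_1; apply: sqrt_lt_1_alt; lra.
  have h1 := Ub (sqrt t) hs.
  have hl : 0 < - ln t by have := ln_increasing t 1 ltac:(lra) ltac:(lra); rewrite ln_1; lra.
  have lsq : ln t = 2 * ln (sqrt t) by rewrite -{1}(sqrt_sqrt t) ?ln_mult; lra.
  have e2 : b * - ln (sqrt t) = b / 2 * - ln t by rewrite lsq; field.
  rewrite e2 in h1.
  have e3 : pw (p + 1) (U (sqrt t)) = pw m (U (sqrt t) ^ 2).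
    have -> : U (sqrt t) ^ 2 = U (sqrt t) * U (sqrt t) by ring.
    rewrite pw_mult; try exact: u0. by rewrite -pw_plus; congr pw; rewrite /m; field.
  rewrite e3.
  have h2 : pw m (U (sqrt t) ^ 2) <= pw m (b / 2) * Rpower (- ln t) m.
    rewrite -(pw_pos m (- ln t)) // -pw_mult; try lra. apply: pw_mono => //; lra.
  rewrite (pw_pos (al / 2)); first lra.
  have h3 := log_power_bound al m t hal ltac:(lra) ht.
  have h4 := Rpower_pos t (al / 2).
  apply: (Rle_trans _ (Rpower t (al / 2) * (pw m (b / 2) * Rpower (- ln t) m))).
    apply: Rmult_le_compat_l; lra.
  have -> : Rpower t (al / 2) * (pw m (b / 2) * Rpower (- ln t) m) = pw m (b / 2) * (Rpower (- ln t) m * Rpower t (al / 2)) by ring.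
  rewrite (Rmult_assoc (pw m (b / 2))); exact: Rmult_le_compat_l.
have mA := pw_gt0 m (nn u) hA.
have e5 : pw (p + 1) (nn u) = pw m (nn u) * pw m (nn u) by rewrite -pw_plus; congr pw; rewrite /m; field.
have i4 : 0 < / (4 * PI) by apply: Rinv_0_lt_compat; lra.
have e6 : pw m (b / 2) = pw m (nn u) * pw m (/ (4 * PI)).
  rewrite -pw_mult; try lra. congr pw; rewrite eb; field; lra.
have mk : 0 < m / (exp 1 * (1 + al / 4)) by apply: Rdiv_lt_0_compat; lra.
rewrite pw_mult; try lra. rewrite (pw_pos m (m / _)) //.
apply: (Rmult_le_reg_l (pw m (nn u))) => //.
rewrite -e5 -iH2.
apply: (Rle_trans _ (PI * ((pw m (b / 2) * Rpower (m / (exp 1 * (1 + al / 4))) m) / (al / 4)))).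
  apply: Rmult_le_compat_l; lra.
apply: Req_le; rewrite e6; field; lra.
Qed.

End RB.

(** * Nonradial competitor *)

Lemma RInt_ge_sub (f : R -> R) a b c d k : a <= c <= d -> d <= b -> cont f -> (forall t, a <= t <= b -> 0 <= f t) ->
  (forall t, c <= t <= d -> k <= f t) -> k * (d - c) <= RInt f a b.
Proof.
move=> h1 h2 hf f0 hk.
have ei : forall u v, ex_RInt f u v by move=> u v; exact: ex_RInt_cont.
rewrite (RInt_split f a c b hf) (RInt_split f c d b hf).
have q1 : 0 <= RInt f a c by apply: RInt_ge_0; [lra | exact: ei | move=> y hy; apply: f0; lra].
have q2 : 0 <= RInt f d b by apply: RInt_ge_0; [lra | exact: ei | move=> y hy; apply: f0; lra].
have q3 : RInt (fun _ => k) c d <= RInt f c d.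
  apply: RInt_le; [lra | exact: ex_RInt_const | exact: ei | move=> t ht; apply: hk; lra].
rewrite RInt_const /scal /= /mult /= in q3; lra.
Qed.

Lemma I2_ge_box (F : pt -> R) a b c d k : cont F -> (forall z, inQ z -> 0 <= F z) ->
  -1 <= a <= b -> b <= 1 -> -1 <= c <= d -> d <= 1 -> 
  (forall z, a <= fst z <= b -> c <= snd z <= d -> k <= F z) -> k * (d - c) * (b - a) <= I2 F.
Proof.
move=> cF F0 h1 h2 h3 h4 hk.
Transparent I2. rewrite /I2. Opaque I2.
apply: RInt_ge_sub => //.
- exact: cont_inner.
- move=> t ht; apply: RInt_ge_0; [lra | apply: ex_RInt_cont; exact: cont_slice |].
  move=> s hs; apply: F0; split => /=; lra.
- move=> t ht; apply: RInt_ge_sub => //; first exact: cont_slice.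
    move=> s hs; apply: F0; split => /=; lra.
  move=> s hs; exact: hk.
Qed.

Definition bump_center : pt := (/ 2, 0).
Definition clip (s : R) : R := Rmax 0 (Rmin 1 s).

Lemma clip_val s : (s <= 0 /\ clip s = 0) \/ (0 <= s <= 1 /\ clip s = s) \/ (1 <= s /\ clip s = 1).
Proof.
rewrite /clip /Rmin; case: (Rle_dec 1 s) => h1; rewrite /Rmax; case: Rle_dec => h2; lra.
Qed.

Lemma clip_lip s t : Rabs (clip s - clip t) <= Rabs (s - t).
Proof.
have h1 := Rle_abs (s - t); have h2 := Rle_abs (t - s); rewrite (Rabs_minus_sym t) in h2.
have hs := clip_val s; have ht := clip_val t; apply: Rabs_le; lra.
Qed.

(** A Lipschitz cutoff, equal to 1 for [rho2 <= D / 4] and 0 for [rho2 >= D / 2], so [D] is a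
    squared length. The centre stays away from the origin, where the weight degenerates, and from
    the circle, where the Green function does. *)
Definition bump (D : R) (x : pt) : R := clip (2 - 4 / D * rho2 x bump_center).


Lemma bump_01 D x : 0 <= bump D x <= 1.
Proof. rewrite /bump; have := clip_val (2 - 4 / D * rho2 x bump_center); lra. Qed.

Lemma bump_supp D x : 0 < D -> D / 2 <= rho2 x bump_center -> bump D x = 0.
Proof.
move=> hD h.
have : 2 <= 4 / D * rho2 x bump_center.
  have e : 4 / D * (D / 2) = 2 by field; lra.
  have h4 : 0 < 4 / D by apply: Rdiv_lt_0_compat; lra.
  have := Rmult_le_compat_l (4 / D) _ _ (Rlt_le _ _ h4) h; lra.
rewrite /bump; have := clip_val (2 - 4 / D * rho2 x bump_center); lra.
Qed.

Lemma bump_one D x : 0 < D -> rho2 x bump_center <= D / 4 -> bump D x = 1.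
Proof.
move=> hD h.
have : 4 / D * rho2 x bump_center <= 1.
  have e : 4 / D * (D / 4) = 1 by field; lra.
  have h4 : 0 < 4 / D by apply: Rdiv_lt_0_compat; lra.
  have := Rmult_le_compat_l (4 / D) _ _ (Rlt_le _ _ h4) h; lra.
rewrite /bump; have := clip_val (2 - 4 / D * rho2 x bump_center); lra.
Qed.

Lemma bump_near D x : 0 < D <= / 16 -> rho2 x bump_center <= D / 2 -> / 16 <= q2 x <= 9 / 16.
Proof.
rewrite /rho2 /q2 /bump_center /= => hD h.
have h1 := pow2_ge_0 (fst x - / 2); have h2 := pow2_ge_0 (snd x - 0).
have a : / 4 <= fst x by nra.
split; nra.
Qed.

Lemma bump_good D : 0 < D <= / 16 -> good (bump D) (4 / D * 3) 1.
Proof.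
move=> hD.
have h4 : 0 < 4 / D by apply: Rdiv_lt_0_compat; lra.
have hout : forall x, 1 <= q2 x -> bump D x = 0.
  move=> x hx; apply: bump_supp; first lra.
  case: (Rle_dec (D / 2) (rho2 x bump_center)) => // hn; have := bump_near D x hD ltac:(lra); lra.
split; [|split => //]; first exact: bump_01.
apply: lip_ext => //; first lra.
move=> x y hx hy; apply: Rle_trans (clip_lip _ _) _.
have -> : 2 - 4 / D * rho2 x bump_center - (2 - 4 / D * rho2 y bump_center) = 4 / D * (rho2 y bump_center - rho2 x bump_center) by ring.
rewrite Rabs_mult Rabs_right; first lra. rewrite Rmult_assoc; apply: Rmult_le_compat_l; first lra.
have [[a1 a2] [a3 a4]] := q2_inQ x hx; have [[b1 b2] [b3 b4]] := q2_inQ y hy.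
have -> : rho2 y bump_center - rho2 x bump_center = (1 - fst y - fst x) * (fst x - fst y) + - (snd y + snd x) * (snd x - snd y).
  rewrite /rho2 /bump_center /=; field.
apply: Rle_trans (Rabs_triang _ _) _; rewrite !Rabs_mult /dist1.
have e1 : Rabs (1 - fst y - fst x) <= 3 by apply: Rabs_le; lra.
have e2 : Rabs (- (snd y + snd x)) <= 3 by apply: Rabs_le; lra.
have := Rabs_pos (fst x - fst y); have := Rabs_pos (snd x - snd y); nra.
Qed.

Lemma bump_cone D : 0 < D -> conep (bump D).
Proof.
move=> hD c s hcs hc x hx.
have h4 : 0 < 4 / D by apply: Rdiv_lt_0_compat; lra.
have e : rho2 (refl c s x) bump_center = rho2 x bump_center + 2 * (c * fst x + s * snd x) * c.
  have -> : rho2 (refl c s x) bump_center = q2 (refl c s x) - fst (refl c s x) + / 4 by rewrite /rho2 /q2 /bump_center /=; field.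
  rewrite q2_refl // /rho2 /q2 /bump_center /refl /=; field.
have h : rho2 x bump_center <= rho2 (refl c s x) bump_center by rewrite e; nra.
have h' : 4 / D * rho2 x bump_center <= 4 / D * rho2 (refl c s x) bump_center by apply: Rmult_le_compat_l; lra.
rewrite /bump; have := clip_val (2 - 4 / D * rho2 x bump_center); have := clip_val (2 - 4 / D * rho2 (refl c s x) bump_center); lra.
Qed.

Section Core.
Variables (al p : R).
Hypotheses (hal : 0 < al) (hp : 1 < p).
Local Notation Wt := (wgt al).
Local Notation fs := (hrhs al p).
Local Notation En := (energy al p).
Local Notation nn := (pnorm al p).
Let m := (p + 1) / 2.
(** A lower bound of the weight on the support of the bump, where [q2 >= 1/16] by [bump_near]. *)
Definition om := pw (al / 2) (/ 16).

Lemma om_pos : 0 < om. Proof. apply: pw_gt0; lra. Qed.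

(** A square of half-side [sqrt D / 4], hence of area [D / 4], fits into the disc where the bump
    equals 1. *)
Lemma bump_En D : 0 < D <= / 16 -> om * (D / 4) <= En (bump D).
Proof.
move=> hD; have hg := bump_good D hD; have cb := good_cont _ _ _ hg; have ho := om_pos.
pose s := sqrt D / 4.
have hs2 : s * s = D / 16.
  have := sqrt_sqrt D ltac:(lra); rewrite /s => h; have -> : sqrt D / 4 * (sqrt D / 4) = sqrt D * sqrt D / 16 by field. by rewrite h.
have hs : 0 < s by rewrite /s; have := sqrt_lt_R0 D ltac:(lra); lra.
have hs1 : s <= / 4 by nra.
have -> : om * (D / 4) = om * (s - - s) * ((/ 2 + s) - (/ 2 - s)).
  have -> : D / 4 = 4 * (s * s) by rewrite hs2; field. ring.
apply: I2_ge_box; try lra.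
- by apply: cont_Wpw => //; lra.
- move=> z _; apply: Rmult_le_pos; [exact: Wt_ge0 | exact: pw_ge0].
move=> z h1 h2.
have hr : rho2 z bump_center <= D / 4 by rewrite /rho2 /bump_center /=; nra.
rewrite bump_one //; first lra. rewrite pw_1r Rmult_1_r /om /wgt.
have [n1 n2] := bump_near D z hD ltac:(lra).
apply: pw_mono; lra.
Qed.

Lemma bump_ok D : 0 < D <= / 16 -> ok al p (bump D).
Proof.
move=> hD; have hg := bump_good D hD; have ho := om_pos; have hE := bump_En D hD.
split; first by do 2 eexists; exact: hg.
split; first by apply: bump_cone; lra.
apply: nn_pos => //; first exact: good_cont hg.
apply: Rlt_le_trans hE; apply: Rmult_lt_0_compat; lra.
Qed.

(** The constant is [24 = 3 * 8]: [rho2 + D <= 3 D] by the parallelogram law, and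
    [DD >= (7/16)^2 >= 1/8]. *)
Lemma bump_kernel D x y : 0 < D <= / 16 -> rho2 x bump_center <= D / 2 -> rho2 y bump_center <= D / 2 ->
  ln (/ (24 * D)) <= k0 true D x y - k0 false D x y.
Proof.
move=> hD hx hy.
have nx := bump_near D x hD hx; have ny := bump_near D y hD hy.
have hr : rho2 x y <= 2 * D.
  move: hx hy; rewrite /rho2 => hx hy.
  have t1 := pow2_ge_0 (fst x + fst y - 2 * fst bump_center); have t2 := pow2_ge_0 (snd x + snd y - 2 * snd bump_center).
  nra.
have hr0 := rho2_ge0 x y.
rewrite /k0 /= -ln_div; first by have := DD_ge0 x y; lra. lra.
apply: ln_le; first by apply: Rinv_0_lt_compat; lra.
have hDD : / 8 <= DD x y by rewrite DDrho; nra.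
apply/Rle_div_r; first lra.
apply: (Rle_trans _ (/ (24 * D) * (3 * D))).
  apply: Rmult_le_compat_l; last lra. apply: Rlt_le; apply: Rinv_0_lt_compat; lra.
have -> : / (24 * D) * (3 * D) = / 8 by field; lra.
lra.
Qed.

(** Testing [step h] against [fs h] gives a lower bound through the kernel on the support and an
    upper bound by Hoelder. As [0 <= h <= 1], the integral of [fs h] is at least the energy, so all
    powers reduce to the norm of [h]. *)
Lemma bump_lower D : 0 < D <= / 24 -> / (4 * PI) * ln (/ (24 * D)) * (nn (bump D) * nn (bump D)) <= nn (step al p (bump D)).
Proof.
move=> hD'; have hD : 0 < D <= / 16 by lra.
set h := bump D.
have okh := bump_ok D hD; rewrite -/h in okh.
have [M hM] := ok_src al p hal hp h okh.
have n1 := ok_nnp al p h okh; have ch := ok_cont al p h okh; have h0 := ok_ge0 al p h okh.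
have [_ [_ hn]] := okh.
have oks := step_ok al p hal hp h okh; have [_ [_ hns]] := oks.
have cf : cont (fs h) by case: hM.
have cG := Green_cont _ _ hM.
set l := ln (/ (24 * D)).
have hl : 0 <= l.
  rewrite /l -ln_1; apply: ln_le; first lra. rewrite -{1}Rinv_1; apply: Rinv_le_contravar; lra.
have [p1 p2] := inv4pi.
have hf0 := fs_ge0 al p h.
have fsupp : forall y, D / 2 <= rho2 y bump_center -> fs h y = 0.
  by move=> y hy; rewrite /hrhs /h bump_supp ?pw_0; lra.
have I0 : 0 <= I2 (fs h) by exact: I2_ge0.
have IE : En h <= I2 (fs h).
  apply: I2_le => //; first by apply: cont_Wpw => //; lra.
  move=> x _; apply: Rmult_le_compat_l; first exact: Wt_ge0.
  rewrite -(pw_split p) //. have := bump_01 D x; rewrite -/h => hb; have := pw_ge0 p (h x); nra.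
have Glow : forall x, rho2 x bump_center <= D / 2 -> / (4 * PI) * l * I2 (fs h) <= Green (fs h) x.
  move=> x hx; have nx := bump_near D x hD hx.
  apply: Rle_trans (Green_ge_Ge D _ M x hM hf0 _ _); try lra.
  rewrite Ge_kernel //; first lra.
  rewrite Rmult_assoc; apply: Rmult_le_compat_l; first lra.
  rewrite -I2_scal //; apply: I2_le.
  - apply: cont_mult => //; exact: cont_const.
  - apply: cont_mult => //; apply: cont_minus; apply: cont_k0s; lra.
  move=> y _; case: (Rle_dec (D / 2) (rho2 y bump_center)) => hy; first by rewrite fsupp //; lra.
  apply: Rmult_le_compat_r => //; apply: bump_kernel => //; lra.
have step1 : / (4 * PI) * l * I2 (fs h) * I2 (fs h) <= I2 (fun x => fs h x * Green (fs h) x).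
  rewrite -I2_scal //; apply: I2_le.
  - apply: cont_mult => //; exact: cont_const.
  - exact: cont_mult.
  move=> y _; case: (Rle_dec (D / 2) (rho2 y bump_center)) => hy; first by rewrite fsupp //; lra.
  rewrite Rmult_comm; apply: Rmult_le_compat_l => //; apply: Glow; lra.
have hh := holder_ineq al p hal hp h _ ch (ok_cont al p _ oks) h0 (ok_ge0 al p _ oks) hn hns.
have e1 : I2 (fun x => fs h x * step al p h x) = / pw p (nn h) * I2 (fun x => fs h x * Green (fs h) x).
  rewrite -I2_scal; first exact: cont_mult.
  apply: I2_ext => x _; rewrite /step; ring.
rewrite e1 in hh.
have eE : En h = pw p (nn h) * nn h.
  rewrite -(nn_pow al p hal hp h ch); symmetry; apply: pw_split => //; lra.
have pl : 0 <= / (4 * PI) * l by apply: Rmult_le_pos; lra.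
have ip : 0 < / pw p (nn h) by apply: Rinv_0_lt_compat.
apply: (Rmult_le_reg_l (pw p (nn h))) => //.
apply: Rle_trans hh.
apply: (Rle_trans _ (/ pw p (nn h) * (/ (4 * PI) * l * En h * En h))).
  have hpi := PI_RGT_0; apply: Req_le; rewrite eE; field; lra.
apply: Rmult_le_compat_l; first exact: Rlt_le ip.
apply: Rle_trans step1.
have E0 : 0 <= En h by rewrite eE; apply: Rmult_le_pos; lra.
rewrite !(Rmult_assoc (/ (4 * PI) * l)); apply: Rmult_le_compat_l => //.
apply: Rmult_le_compat => //.
Qed.

Lemma nn_sq w : nn w * nn w = pw (/ m) (En w).
Proof.
rewrite /pnorm -pw_plus; congr pw; rewrite /m; field; lra.
Qed.

(** The scale [exp (- m)] balances [ln (1/D)], which is [m], with [D^(1/m)], which is [1/e]; this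
    yields the leading value [m / (4 PI e)]. *)
Lemma start_lower D : D = exp (- m) -> D <= / 24 ->
  (m - ln 24) / (4 * PI * exp 1) * pw (/ m) (om / 4) <= nn (step al p (bump D)).
Proof.
move=> eD hD.
have D0 : 0 < D by rewrite eD; exact: exp_pos.
have hm : 1 < m by rewrite /m; lra.
have he := exp_pos 1; have hpi := PI_RGT_0; have ho := om_pos.
apply: Rle_trans (bump_lower D (conj D0 hD)).
rewrite nn_sq.
have lD : ln (/ (24 * D)) = m - ln 24.
  rewrite ln_Rinv; first lra. rewrite ln_mult; try lra. rewrite eD ln_exp; ring.
have hl : 0 <= ln (/ (24 * D)).
  rewrite -ln_1; apply: ln_le; first lra. rewrite -{1}Rinv_1; apply: Rinv_le_contravar; lra.
have hE := bump_En D ltac:(lra).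
have eP : pw (/ m) (om * (D / 4)) = pw (/ m) (om / 4) * / exp 1.
  have -> : om * (D / 4) = om / 4 * D by field.
  rewrite pw_mult; try lra. congr (_ * _).
  rewrite pw_pos // eD /Rpower ln_exp -exp_Ropp; congr exp; field; lra.
have hmono : pw (/ m) (om * (D / 4)) <= pw (/ m) (En (bump D)).
  apply: pw_mono => //; apply: Rlt_le; apply: Rinv_0_lt_compat; lra.
have i4 : 0 < / (4 * PI) by apply: Rinv_0_lt_compat; lra.
apply: (Rle_trans _ (/ (4 * PI) * ln (/ (24 * D)) * pw (/ m) (om * (D / 4)))).
  apply: Req_le; rewrite eP lD; field; lra.
apply: Rmult_le_compat_l => //; apply: Rmult_le_pos; lra.
Qed.

End Core.

Theorem core al : 0 < al -> exists p0, 1 <= p0 /\ forall p, p0 < p -> exists (u : pt -> R) (lam : R),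
  0 < lam /\ cont u /\ (forall x, 1 <= q2 x -> u x = 0) /\ (forall x, q2 x < 1 -> 0 < u x) /\ conep u /\
  poisson u (fun x => lam * hrhs al p u x) /\ ~ (exists g : R -> R, forall x, q2 x < 1 -> u x = g (q2 x)).
Proof.
move=> hal.
have hpi := PI_RGT_0; have ho := om_pos al.
(* [eta] is chosen so that [(1 - eta)^2 (1 + a) >= 1 + a/2 > 1], which is the final
   contradiction. *)
pose a := al / 4; pose eta := a / (4 * (1 + a)).
have ha : 0 < a by rewrite /a; lra.
have heta : 0 < eta by apply: Rdiv_lt_0_compat; lra.
have eeta : eta * (4 * (1 + a)) = a by rewrite /eta; field; lra.
have heta1 : eta < / 4 by nra.
(* The quotient of the prefactors of the radial upper bound and of the bump's lower bound, entering
   only through its power [1/m]. *)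
pose K := (4 * PI / al) / (om al / 4).
have hK1 : 0 < 4 * PI / al by apply: Rdiv_lt_0_compat; lra.
have hK : 0 < K by apply: Rdiv_lt_0_compat; lra.
have l24 : 0 < ln 24 by rewrite -ln_1; apply: ln_increasing; lra.
(* Beyond [m0] both corrections are controlled by [eta]: [m - ln 24 >= m (1 - eta)] and
   [K^(1/m) <= exp eta <= 1 / (1 - eta)]. *)
pose m0 := (ln 24 + Rabs (ln K)) / eta.
have hm0 : 0 < m0 by apply: Rdiv_lt_0_compat => //; have := Rabs_pos (ln K); lra.
have em0 : m0 * eta = ln 24 + Rabs (ln K) by rewrite /m0; field; lra.
exists (2 * m0 + 1); split; first lra.
move=> p hp.
have hp1 : 1 < p by lra.
pose m := (p + 1) / 2.
have hm : m0 < m by rewrite /m; lra.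
have hme : ln 24 + Rabs (ln K) <= m * eta by rewrite -em0; apply: Rmult_le_compat_r; lra.
have aK := Rabs_pos (ln K).
pose D := exp (- m).
have hD : D <= / 24.
  rewrite /D -(exp_ln (/ 24)); first lra. apply: exp_le. rewrite ln_Rinv; first lra. nra.
have D0 : 0 < D by exact: exp_pos.
have [u [oku [hnn [upos [uz pu]]]]] := fixed_point al p hal hp1 (bump D) (bump_ok al p hal hp1 D ltac:(lra)).
have n1 := ok_nnp al p u oku.
exists u, (/ pw p (pnorm al p u)).
split; first by apply: Rinv_0_lt_compat.
split; first exact (ok_cont al p u oku).
split; first exact uz.
split; first exact upos.
split; first by case: oku => _ [].
split; first exact pu.
move=> hrad.
have hup := radial_bound al p hal hp1 u oku uz pu hrad.
have hlow := start_lower al p hal hp1 D eq_refl hD.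
rewrite -/m in hup hlow.
set A := pnorm al p u in hup hnn.
have hAlow : (m - ln 24) / (4 * PI * exp 1) * pw (/ m) (om al / 4) <= A by exact (Rle_trans _ _ _ hlow hnn).
have hA : 0 < A by case: oku => _ [].
have mp : 0 < m by lra.
have im : 0 < / m by apply: Rinv_0_lt_compat.
have he := exp_pos 1.
have hA2 : A <= pw (/ m) (4 * PI / al) * (m / (exp 1 * (1 + a)) * / (4 * PI)).
  have h := pw_mono (/ m) _ _ (Rlt_le _ _ im) hup.
  rewrite pw_pw Rinv_r in h; first lra.
  rewrite pw_1l in h; first lra.
  rewrite pw_mult in h; [lra | exact: pw_ge0 |].
  rewrite pw_pw Rinv_r in h; first lra.
  rewrite pw_1l in h => //.
  apply: Rlt_le; apply: Rmult_lt_0_compat; last by apply: Rinv_0_lt_compat; lra.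
  apply: Rdiv_lt_0_compat => //; apply: Rmult_lt_0_compat; lra.
have eK : pw (/ m) (4 * PI / al) = pw (/ m) K * pw (/ m) (om al / 4).
  rewrite -pw_mult; try lra. congr pw; rewrite /K; field; lra.
have po : 0 < pw (/ m) (om al / 4) by apply: pw_gt0; lra.
have key : (m - ln 24) * (1 + a) <= pw (/ m) K * m.
  have h := Rle_trans _ _ _ hAlow hA2.
  rewrite eK in h.
  have hq : 0 < 4 * PI * exp 1 by apply: Rmult_lt_0_compat; lra.
  have e1 : (m - ln 24) / (4 * PI * exp 1) * pw (/ m) (om al / 4) = ((m - ln 24) * (1 + a)) * (pw (/ m) (om al / 4) / ((4 * PI * exp 1) * (1 + a))).
    field; lra.
  have e2 : pw (/ m) K * pw (/ m) (om al / 4) * (m / (exp 1 * (1 + a)) * / (4 * PI)) = (pw (/ m) K * m) * (pw (/ m) (om al / 4) / ((4 * PI * exp 1) * (1 + a))).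
    field; lra.
  rewrite e1 e2 in h.
  apply: (Rmult_le_reg_r (pw (/ m) (om al / 4) / ((4 * PI * exp 1) * (1 + a)))) => //.
  apply: Rdiv_lt_0_compat => //; apply: Rmult_lt_0_compat; lra.
have hpK : pw (/ m) K <= / (1 - eta).
  rewrite pw_pos // /Rpower.
  have hexp : exp (/ m * ln K) <= exp eta.
    apply: exp_le; apply: (Rmult_le_reg_l m) => //.
    rewrite -Rmult_assoc Rinv_r; first lra.
    have := Rle_abs (ln K); lra.
  apply: Rle_trans hexp _.
  have h1 := exp_ineq1_le (- eta).
  rewrite -(Ropp_involutive eta) exp_Ropp Ropp_involutive.
  apply: Rinv_le_contravar; lra.
have h1 : (m - ln 24) >= m * (1 - eta) by lra.
have h2 : m * (1 - eta) * (1 + a) <= / (1 - eta) * m.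
  apply: (Rle_trans _ ((m - ln 24) * (1 + a))); first by apply: Rmult_le_compat_r; lra.
  apply: Rle_trans key _; apply: Rmult_le_compat_r; lra.
have h3 : (1 - eta) * ((1 - eta) * (1 + a)) <= 1.
  apply: (Rmult_le_reg_l m) => //.
  have := Rmult_le_compat_l (1 - eta) _ _ ltac:(lra) h2.
  have -> : (1 - eta) * (/ (1 - eta) * m) = m by field; lra.
  lra.
nra.
Qed.

(** * Lifting along powers of z *)

Fixpoint Cpow (n : nat) (z : pt) : pt :=
  match n with
  | O => (1, 0)
  | S k => (fst z * fst (Cpow k z) - snd z * snd (Cpow k z), fst z * snd (Cpow k z) + snd z * fst (Cpow k z))
  end.

Lemma q2_Cpow n z : q2 (Cpow n z) = q2 z ^ n.
Proof.
elim: n => [|n IH] /=; first by rewrite /q2 /=; ring.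
rewrite -IH /q2 /=; ring.
Qed.

Lemma cont_Cpow n : cont (fun z => fst (Cpow n z)) /\ cont (fun z => snd (Cpow n z)).
Proof.
elim: n => [|n [h1 h2]] /=; first by split; exact: cont_const.
have c1 : cont (fun z : pt => fst z) by move=> z; exact: continuous_fst.
have c2 : cont (fun z : pt => snd z) by move=> z; exact: continuous_snd.
split; [apply: cont_minus | apply: cont_plus]; exact: cont_mult.
Qed.

Lemma continuous_Cpow n z : continuous (Cpow n) z.
Proof.
have [h1 h2] := cont_Cpow n.
apply: (continuous_ext (fun z => (fst (Cpow n z), snd (Cpow n z)))); first by move=> y; rewrite -surjective_pairing.
apply: continuous_pair; [exact: h1 | exact: h2].
Qed.

Lemma pd_mult j F G x l k : pd j F x l -> pd j G x k -> pd j (fun x => F x * G x) x (l * G x + F x * k).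
Proof.
move=> h h'; rewrite /pd; evar_last.
  apply: (is_derive_mult (K := R_AbsRing) (fun t => F (upc j x t)) (fun t => G (upc j x t)) _ _ _ h h').
  move=> *; exact: Rmult_comm.
by rewrite /plus /mult /= !up_co.
Qed.

Lemma pd_co j i x : pd j (co i) x (if Bool.eqb i j then 1 else 0).
Proof. by rewrite /pd; case: i; case: j => /=; auto_derive. Qed.

Lemma pd_Cpow n z :
  pd true (fun z => fst (Cpow n z)) z (INR n * fst (Cpow (pred n) z)) /\
  pd true (fun z => snd (Cpow n z)) z (INR n * snd (Cpow (pred n) z)) /\
  pd false (fun z => fst (Cpow n z)) z (- (INR n * snd (Cpow (pred n) z))) /\
  pd false (fun z => snd (Cpow n z)) z (INR n * fst (Cpow (pred n) z)).
Proof.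
elim: n => [|n [h1 [h2 [h3 h4]]]].
  rewrite /= !Rmult_0_l Ropp_0; split; [|split; [|split]]; exact: is_derive_const.
have x1 := pd_co true true z; have x2 := pd_co false true z.
have y1 := pd_co true false z; have y2 := pd_co false false z; rewrite /= in x1 x2 y1 y2.
have e : INR n = 0 \/ exists k, n = S k by case: (n) => [|k]; [left | right; exists k].
split; [|split; [|split]].
- have h := pd_minus _ _ _ _ _ _ (pd_mult _ _ _ _ _ _ x1 h1) (pd_mult _ _ _ _ _ _ y1 h2).
  evar_last; first exact: h.
  rewrite S_INR /=; case: e => [->|[k ->]] /=; ring.
- have h := pd_plus _ _ _ _ _ _ (pd_mult _ _ _ _ _ _ x1 h2) (pd_mult _ _ _ _ _ _ y1 h1).
  evar_last; first exact: h.
  rewrite S_INR /=; case: e => [->|[k ->]] /=; ring.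
- have h := pd_minus _ _ _ _ _ _ (pd_mult _ _ _ _ _ _ x2 h3) (pd_mult _ _ _ _ _ _ y2 h4).
  evar_last; first exact: h.
  rewrite S_INR /=; case: e => [->|[k ->]] /=; ring.
- have h := pd_plus _ _ _ _ _ _ (pd_mult _ _ _ _ _ _ x2 h4) (pd_mult _ _ _ _ _ _ y2 h3).
  evar_last; first exact: h.
  rewrite S_INR /=; case: e => [->|[k ->]] /=; ring.
Qed.

Lemma Cpow_disc n z : q2 z < 1 -> q2 (Cpow (S n) z) < 1.
Proof.
move=> h; rewrite q2_Cpow; have h0 := q2_ge0 z.
have h1 : 0 <= q2 z ^ n <= 1.
  split; first exact: pow_le. rewrite -(pow1 n); apply: pow_incr; lra.
rewrite /=; nra.
Qed.

Lemma cts_plus (f g : pt -> R) x : continuous f x -> continuous g x -> continuous (fun z => f z + g z) x.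
Proof. exact: (continuous_plus (V := R_NormedModule)). Qed.
Lemma cts_mult (f g : pt -> R) x : continuous f x -> continuous g x -> continuous (fun z => f z * g z) x.
Proof. exact: (continuous_mult (K := R_AbsRing)). Qed.

(* [z -> z^n] is conformal, so it multiplies the Laplacian by [|n z^(n-1)|^2]. *)
Lemma poisson_Cpow k v f : poisson v f ->
  poisson (fun z => v (Cpow (S k) z)) (fun z => INR (S k) ^ 2 * q2 z ^ k * f (Cpow (S k) z)).
Proof.
move=> [d [h [hdc [hhc [hd [hh hf]]]]]].
set C := Cpow (S k); set a := INR (S k); set e := INR k.
pose Ai (i : bool) z := if i then a * fst (Cpow k z) else - (a * snd (Cpow k z)).
pose Bi (i : bool) z := if i then a * snd (Cpow k z) else a * fst (Cpow k z).
pose Aij (i j : bool) z := match i, j with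
  | true, true => a * (e * fst (Cpow (pred k) z)) | true, false => a * (- (e * snd (Cpow (pred k) z)))
  | false, true => - (a * (e * snd (Cpow (pred k) z))) | false, false => - (a * (e * fst (Cpow (pred k) z))) end.
pose Bij (i j : bool) z := match i, j with
  | true, true => a * (e * snd (Cpow (pred k) z)) | true, false => a * (e * fst (Cpow (pred k) z))
  | false, true => a * (e * fst (Cpow (pred k) z)) | false, false => a * (- (e * snd (Cpow (pred k) z))) end.
have pA : forall i z, pd i (fun z => fst (C z)) z (Ai i z).
  by move=> i z; have [h1 [_ [h3 _]]] := pd_Cpow (S k) z; case: i.
have pB : forall i z, pd i (fun z => snd (C z)) z (Bi i z).
  by move=> i z; have [_ [h2 [_ h4]]] := pd_Cpow (S k) z; case: i.
have pAi : forall i j z, pd j (Ai i) z (Aij i j z).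
  move=> i j z; have [h1 [h2 [h3 h4]]] := pd_Cpow k z.
  case: i; case: j; rewrite /Ai /Aij; try (apply: pd_scal => //).
    apply: (is_derive_opp (V := R_NormedModule)); exact: (pd_scal _ _ _ _ a h2).
  apply: (is_derive_opp (V := R_NormedModule)); exact: (pd_scal _ _ _ _ a h4).
have pBi : forall i j z, pd j (Bi i) z (Bij i j z).
  move=> i j z; have [h1 [h2 [h3 h4]]] := pd_Cpow k z.
  by case: i; case: j; rewrite /Bi /Bij; apply: pd_scal.
have [cP cQ] := cont_Cpow k; have [cP' cQ'] := cont_Cpow (pred k).
have cA : forall i, cont (Ai i).
  case; rewrite /Ai; first by apply: cont_mult => //; exact: cont_const.
  apply: cont_opp; apply: cont_mult => //; exact: cont_const.
have cB : forall i, cont (Bi i).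
  case; rewrite /Bi; by apply: cont_mult => //; exact: cont_const.
have cAB : forall c, cont (fun z => a * (e * fst (Cpow (pred k) z))) /\ cont (fun z => a * (e * snd (Cpow (pred k) z))) /\ cont (fun _ : pt => c : R).
  move=> c; split; [|split; [|exact: cont_const]]; do 2 (apply: cont_mult; first exact: cont_const); done.
have [c1 [c2 _]] := cAB 0.
have c3 : cont (fun z => a * (- (e * snd (Cpow (pred k) z)))).
  apply: cont_mult; first exact: cont_const. apply: cont_opp; apply: cont_mult => //; exact: cont_const.
have cAij : forall i j, cont (Aij i j).
  by case; case; rewrite /Aij //; exact: cont_opp.
have cBij : forall i j, cont (Bij i j) by case; case; rewrite /Bij.
have hC : forall z, q2 z < 1 -> q2 (C z) < 1 by move=> z; exact: Cpow_disc.
have ctsC : forall (g : pt -> R), (forall y, q2 y < 1 -> continuous g y) -> forall z, q2 z < 1 -> continuous (fun z => g (C z)) z.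
  move=> g hg z hz; apply: (continuous_comp C g); [exact: continuous_Cpow | apply: hg; exact: hC].
have chain : forall (w : pt -> R) (dw : bool -> pt -> R), (forall i y, q2 y < 1 -> continuous (dw i) y) ->
   (forall i y, q2 y < 1 -> pd i w y (dw i y)) -> forall i z, q2 z < 1 ->
   pd i (fun z => w (C z)) z (dw true (C z) * Ai i z + dw false (C z) * Bi i z).
  move=> w dw hw1 hw2 i z hz.
  have := chain_pd i w dw _ _ _ _ z hw1 hw2 (pA i z) (pB i z).
  by rewrite -surjective_pairing; apply; apply: hC.
exists (fun i z => d true (C z) * Ai i z + d false (C z) * Bi i z).
exists (fun i j z => ((h true true (C z) * Ai j z + h true false (C z) * Bi j z) * Ai i z + d true (C z) * Aij i j z)
   + ((h false true (C z) * Ai j z + h false false (C z) * Bi j z) * Bi i z + d false (C z) * Bij i j z)).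
have cd : forall i z, q2 z < 1 -> continuous (fun z => d i (C z)) z by move=> i; apply: ctsC; exact: hdc.
have ch : forall i j z, q2 z < 1 -> continuous (fun z => h i j (C z)) z by move=> i j; apply: ctsC; exact: hhc.
split; [|split; [|split; [|split]]].
- move=> i z hz; apply: cts_plus; apply: cts_mult; try exact: cd; [exact: cA | exact: cB].
- move=> i j z hz; apply: cts_plus; apply: cts_plus; apply: cts_mult; try exact: cd; try exact: cA; try exact: cB; try exact: cAij; try exact: cBij;
    apply: cts_plus; apply: cts_mult; try exact: ch; try exact: cA; exact: cB.
- move=> i z hz; exact: chain.
- move=> i j z hz; apply: pd_plus; apply: pd_mult; try exact: pAi; try exact: pBi;
    apply: (chain _ (h _)) => //; move=> j' y hy; [exact: hhc | exact: hh | exact: hhc | exact: hh].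
- move=> z hz; rewrite -(hf (C z) (hC z hz)) -q2_Cpow /q2 /Ai /Bi /Aij /Bij; ring.
Qed.

(** * Polar coordinates and angular monotonicity in the cone *)

Definition pol (r t : R) : pt := (r * cos t, r * sin t).

Lemma q2_pol r t : q2 (pol r t) = r ^ 2.
Proof.
rewrite /q2 /pol /=; have := sin2_cos2 t; rewrite /Rsqr => h.
have -> : r * cos t * (r * cos t * 1) + r * sin t * (r * sin t * 1) = r * (r * 1) * (sin t * sin t + cos t * cos t) by ring.
rewrite h; ring.
Qed.

Lemma pol_exists z : exists t, - PI <= t <= PI /\ z = pol (sqrt (q2 z)) t.
Proof.
have hq := q2_ge0 z; have hpi := PI_RGT_0.
case: (Req_dec (q2 z) 0) => h0.
  exists 0; split; first lra.
  have a := pow2_ge_0 (fst z); have b := pow2_ge_0 (snd z).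
  have a0 : fst z = 0 by move: h0; rewrite /q2 => h0; nra.
  have b0 : snd z = 0 by move: h0; rewrite /q2 => h0; nra.
  rewrite h0 sqrt_0 /pol !Rmult_0_l (surjective_pairing z) a0 b0 //.
set r := sqrt (q2 z).
have hr : 0 < r by apply: sqrt_lt_R0; lra.
have rr : r * r = q2 z by apply: sqrt_sqrt.
set c := fst z / r; set s := snd z / r.
have cs : c ^ 2 + s ^ 2 = 1.
  have -> : c ^ 2 + s ^ 2 = (fst z ^ 2 + snd z ^ 2) / (r * r) by rewrite /c /s; field; lra.
  rewrite rr /q2; field; rewrite /q2 in h0; lra.
have hc : -1 <= c <= 1 by have := pow2_ge_0 s; split; nra.
have ec : fst z = r * c by rewrite /c; field; lra.
have es : snd z = r * s by rewrite /s; field; lra.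
have hb := acos_bound c.
have e1 : cos (acos c) = c by exact: cos_acos.
have e2 : sin (acos c) = sqrt (1 - Rsqr c) by exact: sin_acos.
have e3 : 1 - Rsqr c = s ^ 2 by rewrite /Rsqr; lra.
case: (Rle_dec 0 s) => hs.
  exists (acos c); split; first lra.
  rewrite /pol e1 e2 e3 sqrt_pow2 // -ec -es -surjective_pairing //.
exists (- acos c); split; first lra.
have e4 : sqrt (s ^ 2) = - s.
  have -> : s ^ 2 = (- s) ^ 2 by ring.
  by apply: sqrt_pow2; lra.
rewrite /pol cos_neg sin_neg e1 e2 e3 e4 Ropp_involutive -ec -es -surjective_pairing //.
Qed.

Lemma Cpow_pol n r t : Cpow n (pol r t) = pol (r ^ n) (INR n * t).
Proof.
elim: n => [|n IH].
  rewrite /= /pol Rmult_0_l cos_0 sin_0; congr pair; ring.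
rewrite /= -/(INR (S n)) IH S_INR Rmult_plus_distr_r Rmult_1_l /pol cos_plus sin_plus /=; congr pair; ring.
Qed.

Lemma refl_pol r s phi : refl (sin phi) (- cos phi) (pol r s) = pol r (2 * phi - s).
Proof.
have h := sin2_cos2 phi; rewrite /Rsqr in h.
have e1 : cos (2 * phi - s) = cos phi * cos phi * cos s - sin phi * sin phi * cos s + 2 * sin phi * cos phi * sin s.
  rewrite cos_minus cos_2a sin_2a; ring.
have e2 : sin (2 * phi - s) = 2 * sin phi * cos phi * cos s - (cos phi * cos phi - sin phi * sin phi) * sin s.
  rewrite sin_minus cos_2a sin_2a; ring.
rewrite /refl /pol e1 e2 /=; congr pair.
  have -> : r * cos s = r * cos s * (sin phi * sin phi + cos phi * cos phi) by rewrite h; ring.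
  have -> : sin phi * (r * cos s * (sin phi * sin phi + cos phi * cos phi)) = sin phi * (r * cos s) by rewrite h; ring.
  ring.
have -> : r * sin s = r * sin s * (sin phi * sin phi + cos phi * cos phi) by rewrite h; ring.
have -> : - cos phi * (r * sin s * (sin phi * sin phi + cos phi * cos phi)) = - cos phi * (r * sin s) by rewrite h; ring.
ring.
Qed.

Lemma pol_2pi r t : pol r (t + 2 * PI) = pol r t.
Proof. rewrite /pol cos_plus sin_plus cos_2PI sin_2PI; congr pair; ring. Qed.

(** The mirror is the line at the mean angle [phi]. The condition on [s + t] makes its normal
    [(sin phi, - cos phi)] admissible, and the one on [t - s] puts [pol r s] on the side of the
    larger values. *)
Lemma conep_pol v r s t : conep v -> 0 <= r -> s <= t -> t - s <= 2 * PI -> 0 <= s + t <= 2 * PI ->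
  v (pol r t) <= v (pol r s).
Proof.
move=> hv hr hst h1 h2.
pose phi := (s + t) / 2.
have et : t = 2 * phi - s by rewrite /phi; field.
rewrite et -refl_pol; apply: hv.
- have := sin2_cos2 phi; rewrite /Rsqr /=; lra.
- apply: sin_ge_0; rewrite /phi; lra.
have -> : sin phi * fst (pol r s) + - cos phi * snd (pol r s) = r * sin (phi - s) by rewrite /pol sin_minus /=; ring.
apply: Rmult_le_pos => //; apply: sin_ge_0; rewrite /phi; lra.
Qed.

Lemma conep_even v r s : conep v -> 0 <= r -> 0 <= s <= PI -> v (pol r (- s)) = v (pol r s).
Proof.
move=> hv hr hs; apply: Rle_antisym.
  rewrite -(pol_2pi r (- s)); apply: conep_pol => //; lra.
apply: conep_pol => //; lra.
Qed.

(* Monotonicity in the angle on [0, PI] together with a second period forces radiality. *)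
Lemma conep_periodic_radial v psi : conep v -> 0 < psi < 2 * PI ->
  (forall r s, 0 <= r < 1 -> v (pol r (s + psi)) = v (pol r s)) ->
  exists g : R -> R, forall x, q2 x < 1 -> v x = g (q2 x).
Proof.
move=> hv hpsi hper.
have hpi := PI_RGT_0.
(* A period beyond [PI] is replaced by its complement to [2 PI], so that one period fits into the
   range of monotonicity. *)
have [ps [hps hp2]] : exists ps, 0 < ps <= PI /\ forall r s, 0 <= r < 1 -> v (pol r (s + ps)) = v (pol r s).
  case: (Rle_dec psi PI) => hc; first by exists psi; split => //; lra.
  exists (2 * PI - psi); split; first lra.
  move=> r s hr; rewrite -(hper r (s + (2 * PI - psi)) hr).
  have -> : s + (2 * PI - psi) + psi = s + 2 * PI by ring. by rewrite pol_2pi.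
(* Within the first period [v] is squeezed between its equal values at the angles 0 and [ps];
   further angles are shifted back. *)
have V0 : forall r k t, 0 <= r < 1 -> 0 <= t <= INR k * ps -> v (pol r t) = v (pol r 0).
  move=> r; elim=> [|k IH] t hr ht.
    rewrite /= Rmult_0_l in ht; have -> : t = 0 by lra. done.
  rewrite S_INR in ht.
  case: (Rle_dec ps t) => hc.
    have -> : t = (t - ps) + ps by ring. rewrite hp2 //; apply: IH => //; lra.
  apply: Rle_antisym; first by apply: conep_pol => //; lra.
  rewrite -(hp2 r 0 hr) Rplus_0_l; apply: conep_pol => //; lra.
have V1 : forall r t, 0 <= r < 1 -> - PI <= t <= PI -> v (pol r t) = v (pol r 0).
  move=> r t hr ht.
  have [k hk] := INR_unbounded (PI / ps).
  have hk' : PI <= INR k * ps by apply/Rle_div_l; lra.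
  case: (Rle_dec 0 t) => hc; first by apply: (V0 r k) => //; lra.
  have -> : t = - - t by ring. rewrite conep_even; try lra; first exact: hv.
  apply: (V0 r k) => //; lra.
exists (fun s => v (pol (sqrt s) 0)) => x hx.
have [t [ht e]] := pol_exists x; rewrite {1}e; apply: V1 => //.
split; first exact: sqrt_pos. rewrite -sqrt_1; apply: sqrt_lt_1_alt; split => //; exact: q2_ge0.
Qed.

(** * Lifted solutions: equation, nonradiality and inequivalence *)

Definition nroot (n : nat) (r : R) : R := pw (/ INR n) r.

Lemma nroot_pow n r : (0 < n)%nat -> 0 <= r -> nroot n r ^ n = r.
Proof.
move=> hn; have hn' : 0 < INR n by apply: lt_0_INR.
rewrite /nroot => - [hr|<-]; last by rewrite pw_0 pow_i.
rewrite -Rpower_pow; first exact: pw_gt0.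
rewrite pw_pos // Rpower_mult Rinv_l; [lra | exact: Rpower_1].
Qed.

Lemma nroot_bd n r : (0 < n)%nat -> 0 <= r < 1 -> 0 <= nroot n r < 1.
Proof.
move=> hn hr; split; first exact: pw_ge0.
have h := nroot_pow n r hn (proj1 hr).
case: (Rlt_dec (nroot n r) 1) => // hc.
have : 1 <= nroot n r ^ n by rewrite -(pow1 n); apply: pow_incr; lra.
lra.
Qed.

Lemma weight_pw al x y : 0 < al -> weight al x y = wgt al (x, y).
Proof.
move=> ha; rewrite /weight /wgt.
have -> : q2 (x, y) = x ^ 2 + y ^ 2 by [].
have hq := q2_ge0 (x, y); rewrite /q2 /= in hq.
case: Req_EM_T => h.
  by rewrite pw_npos //; have := sqrt_eq_0 _ _ h; rewrite /=; move=> -> //; lra.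
have hp : 0 < x ^ 2 + y ^ 2.
  case: (Req_dec (x ^ 2 + y ^ 2) 0) => e; last by rewrite /= in e *; lra.
  by exfalso; apply: h; rewrite e sqrt_0.
rewrite pw_pos // -Rpower_sqrt // Rpower_mult; congr Rpower; field.
Qed.

Lemma nonlin_pw p u : 0 <= u -> nonlin p u = pw p u.
Proof.
move=> hu; rewrite /nonlin; case: Req_EM_T => [->|h]; first by rewrite pw_0.
have hp : 0 < u by lra.
rewrite Rabs_right; first lra. rewrite pw_pos // -{2}(Rpower_1 u) // -Rpower_plus; congr Rpower; ring.
Qed.

Lemma cont2_of (D : R -> R -> Prop) (F : pt -> R) : (forall x y, D x y -> continuous F (x, y)) -> cont2_on D (fun x y => F (x, y)).
Proof.
move=> h x y hD eps he.
have := h x y hD => /filterlim_locally /(_ (mkposreal _ he)) [d hd].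
have dp := cond_pos d.
exists d; split => // x' y' _ hxy.
have a := pow2_ge_0 (x' - x); have b := pow2_ge_0 (y' - y).
apply: (hd (x', y')); split; rewrite /ball /= /AbsRing_ball /abs /minus /plus /opp /=; apply: Rabs_def1; nra.
Qed.

Lemma poisson_henon al p u lam : 0 < al -> 1 < p -> cont u -> (forall x, 1 <= q2 x -> u x = 0) -> (forall x, 0 <= u x) ->
  poisson u lam -> (forall x, q2 x < 1 -> lam x = wgt al x * pw p (u x)) ->
  henon_solution al p (fun x y => u (x, y)).
Proof.
move=> ha hp cu uz u0 [d [h [hdc [hhc [hd [hh hf]]]]]] hl.
have q2E : forall x y, q2 (x, y) = x ^ 2 + y ^ 2 by [].
split; [|split].
- by apply: cont2_of => x y _; exact: cu.
- move=> x y hxy; apply: uz; rewrite q2E hxy; lra.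
exists (fun x y => d true (x, y)), (fun x y => d false (x, y)),
  (fun x y => h true true (x, y)), (fun x y => h true false (x, y)), (fun x y => h false true (x, y)), (fun x y => h false false (x, y)).
do 6 (split; first by apply: cont2_of => x y hxy; first [exact: hdc | exact: hhc]).
move=> x y hxy; have hq : q2 (x, y) < 1 by [].
split; first by apply/is_derive_Reals; exact: (hd true (x, y) hq).
split; first by apply/is_derive_Reals; exact: (hd false (x, y) hq).
split; first by apply/is_derive_Reals; exact: (hh true true (x, y) hq).
split; first by apply/is_derive_Reals; exact: (hh true false (x, y) hq).
split; first by apply/is_derive_Reals; exact: (hh false true (x, y) hq).
split; first by apply/is_derive_Reals; exact: (hh false false (x, y) hq).
by rewrite (hf (x, y) hq) hl // weight_pw // nonlin_pw.
Qed.

Definition core_sol al p (v : pt -> R) (lam : R) : Prop :=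
  0 < lam /\ cont v /\ (forall x, 1 <= q2 x -> v x = 0) /\ (forall x, q2 x < 1 -> 0 < v x) /\ conep v /\
  poisson v (fun x => lam * hrhs al p v x) /\ ~ (exists g : R -> R, forall x, q2 x < 1 -> v x = g (q2 x)).

(** Its power [p - 1] is [n^2 lam]: it absorbs both the conformal factor of [z -> z^n] and the
    multiplier of the core solution. *)
Definition kappa p lam (n : nat) : R := Rpower (INR n ^ 2 * lam) (/ (p - 1)).
Definition lift (k : nat) (c : R) (v : pt -> R) (x y : R) : R := c * v (Cpow (S k) (x, y)).

Lemma INR_S_pos k : 0 < INR (S k).
Proof. apply: lt_0_INR; lia. Qed.

Lemma core_sol_ge0 al p v lam x : core_sol al p v lam -> 0 <= v x.
Proof.
move=> [_ [_ [vz [vp _]]]]; case: (Rlt_dec (q2 x) 1) => h; [exact: Rlt_le (vp x h) | rewrite vz; lra].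
Qed.

Lemma lift_henon al p k v lam : 0 < al -> 1 < p -> core_sol ((al + 2) / INR (S k) - 2) p v lam ->
  henon_solution al p (lift k (kappa p lam (S k)) v).
Proof.
move=> ha hp hs; have v0 := fun x => core_sol_ge0 _ _ _ _ x hs.
have [hl [cv [vz [vp [hv [pv _]]]]]] := hs.
have hn := INR_S_pos k; set n := INR (S k) in hn *.
set c := kappa p lam (S k).
have hb : 0 < n ^ 2 * lam by apply: Rmult_lt_0_compat => //; apply: pow_lt.
have hc : 0 < c by exact: Rpower_pos.
have hcp : pw p c = c * (n ^ 2 * lam).
  have -> : p = 1 + (p - 1) by ring.
  rewrite pw_plus pw_1l; first lra. congr (_ * _).
  rewrite pw_pos // /c /kappa Rpower_mult Rinv_l; [lra | exact: Rpower_1].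
apply: (poisson_henon al p (fun z => c * v (Cpow (S k) z)) (fun z => c * (n ^ 2 * q2 z ^ k * (lam * hrhs ((al + 2) / n - 2) p v (Cpow (S k) z))))) => //.
- apply: cont_mult; first exact: cont_const. apply: cont_comp => // z; exact: continuous_Cpow.
- move=> x hx; rewrite vz; last by ring. rewrite q2_Cpow -(pow1 (S k)); apply: pow_incr; lra.
- move=> x; apply: Rmult_le_pos; [lra | exact: v0].
- apply: poisson_scal; exact: (poisson_Cpow k v _ pv).
move=> x hx; rewrite pw_mult; [lra | exact: v0 |].
rewrite hcp /hrhs.
(* In powers of the modulus, with [n = k + 1]: [2 (n - 1) + n ((al + 2) / n - 2) = al]. *)
have eW : q2 x ^ k * wgt ((al + 2) / n - 2) (Cpow (S k) x) = wgt al x.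
  rewrite /wgt q2_Cpow; case: (q2_ge0 x) => [hq|hq]; last first.
    rewrite -hq (pow_i (S k)); [lia | rewrite !pw_0; ring].
  rewrite !pw_pos //; first exact: pow_lt.
  rewrite -(Rpower_pow k) // -(Rpower_pow (S k)) // Rpower_mult -Rpower_plus; congr Rpower.
  rewrite -/n /n S_INR; rewrite /n S_INR in hn; field; lra.
rewrite -eW; ring.
Qed.

Lemma lift_pos al p k v lam c : 0 < c -> core_sol al p v lam -> positive_in_B (lift k c v).
Proof.
move=> hc [_ [_ [_ [vp _]]]] x y hxy; apply: Rmult_lt_0_compat => //; apply: vp; exact: Cpow_disc.
Qed.

Lemma lift_pol k c v r t : lift k c v (r * cos t) (r * sin t) = c * v (pol (r ^ (S k)) (INR (S k) * t)).
Proof. by rewrite /lift -/(pol r t) Cpow_pol. Qed.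

Lemma pol_inB r t : 0 <= r < 1 -> inB (r * cos t) (r * sin t).
Proof. move=> hr; have := q2_pol r t; rewrite /q2 /pol /inB /fst /snd => ->; nra. Qed.

(** Every point of the disc is an [(S k)]-th power, of the point at the root of its radius and at
    its angle divided by [S k]; so a radial lift would make [v] radial. *)
Lemma lift_nonradial al p k v lam c : 0 < c -> core_sol al p v lam -> ~ radial (lift k c v).
Proof.
move=> hc [_ [_ [_ [_ [_ [_ hnr]]]]]] [f hf]; apply: hnr.
exists (fun s => f (nroot (S k) (sqrt s) ^ 2) / c) => x hx.
have [t [_ e]] := pol_exists x.
have hr : 0 <= sqrt (q2 x) < 1.
  split; first exact: sqrt_pos. rewrite -sqrt_1; apply: sqrt_lt_1_alt; split => //; exact: q2_ge0.
set r := sqrt (q2 x); rewrite -/r in hr e.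
have hn := INR_S_pos k.
have hb := nroot_bd (S k) r ltac:(lia) hr.
have h := hf _ _ (pol_inB _ (t / INR (S k)) hb).
rewrite lift_pol nroot_pow in h; [lia | lra |].
have e1 : INR (S k) * (t / INR (S k)) = t by field; lra.
rewrite e1 -e in h.
have e2 := q2_pol (nroot (S k) r) (t / INR (S k)); rewrite /q2 /pol /fst /snd in e2.
rewrite e2 in h; rewrite -h; field; lra.
Qed.

(** The lift with index [j] has angular period [2 PI / (j + 1)]. A rotation would pass it on to the
    lift with index [i], giving [v] the period [2 PI (i + 1) / (j + 1) < 2 PI] and making it
    radial. *)
Lemma lift_not_equiv al p al' p' i j v v' lam lam' c c' : (i < j)%nat -> 0 < c -> core_sol al p v lam -> core_sol al' p' v' lam' ->
  ~ rotation_equiv (lift i c v) (lift j c' v').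
Proof.
move=> hij hc [_ [_ [_ [_ [hv [_ hnr]]]]]] _ [th h]; apply: hnr.
have hpi := PI_RGT_0.
have hi := INR_S_pos i; have hj := INR_S_pos j.
have hlt : INR (S i) < INR (S j) by apply: lt_INR; lia.
apply: (conep_periodic_radial v (2 * PI * (INR (S i) / INR (S j)))) => //.
  have h1 : 0 < INR (S i) / INR (S j) by apply: Rdiv_lt_0_compat.
  have h2 : INR (S i) / INR (S j) < 1 by apply/Rlt_div_l; lra.
  split; nra.
move=> r s hr.
pose rho := nroot (S i) r.
have hb : 0 <= rho < 1 by apply: nroot_bd => //; lia.
have key : forall t, c * v (pol r (INR (S i) * t)) = c' * v' (pol (rho ^ S j) (INR (S j) * (t + th))).
  move=> t; have := h _ _ (pol_inB rho t hb).
  have -> : rho * cos t * cos th - rho * sin t * sin th = rho * cos (t + th) by rewrite cos_plus; ring.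
  have -> : rho * cos t * sin th + rho * sin t * cos th = rho * sin (t + th) by rewrite sin_plus; ring.
  rewrite !lift_pol {1}/rho nroot_pow; [lia | lra | done].
have k1 := key (s / INR (S i)); have k2 := key (s / INR (S i) + 2 * PI / INR (S j)).
have e1 : INR (S j) * (s / INR (S i) + 2 * PI / INR (S j) + th) = INR (S j) * (s / INR (S i) + th) + 2 * PI by field; lra.
rewrite e1 pol_2pi -k1 in k2.
have e2 : INR (S i) * (s / INR (S i) + 2 * PI / INR (S j)) = s + 2 * PI * (INR (S i) / INR (S j)) by field; lra.
have e3 : INR (S i) * (s / INR (S i)) = s by field; lra.
rewrite e2 e3 in k2.
by apply: (Rmult_eq_reg_l c) => //; lra.
Qed.

Lemma ceil_nat_lt x i : (i < ceil_nat x)%nat -> INR (S i) < x + 1.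
Proof.
rewrite /ceil_nat => h.
have [h1 h2] := base_Int_part (- x).
have h3 : (Z.of_nat (S i) <= - Int_part (- x))%Z by lia.
have h4 := IZR_le _ _ h3; rewrite opp_IZR -INR_IZR_INZ in h4; lra.
Qed.

Lemma uniform_threshold (Q : nat -> R -> Prop) N :
  (forall i, (i < N)%nat -> exists p0, 1 <= p0 /\ forall p, p0 < p -> Q i p) ->
  exists P, 1 <= P /\ forall p, P < p -> forall i, (i < N)%nat -> Q i p.
Proof.
elim: N => [|N IH] h; first by exists 1; split; [lra | move=> p _ i hi; lia].
have [P [hP1 hP]] := IH (fun i hi => h i ltac:(lia)).
have [p0 [hp1 hp]] := h N ltac:(lia).
exists (Rmax P p0); split; first by apply: Rle_trans (Rmax_l _ _).
move=> p hpp i hi; have a := Rmax_l P p0; have b := Rmax_r P p0.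
case: (Nat.eq_dec i N) => [->|hne]; first by apply: hp; lra.
apply: hP; [lra | lia].
Qed.

Theorem theorem1p5 :
  forall alpha : R, 0 < alpha ->
  exists pstar : R, forall p : R, pstar < p ->
    exists sol : nat -> (R -> R -> R),
      (forall i, (i < ceil_nat (alpha / 2))%nat ->
         henon_solution alpha p (sol i) /\ positive_in_B (sol i) /\
         ~ radial (sol i)) /\
      (forall i j, (i < j)%nat -> (j < ceil_nat (alpha / 2))%nat ->
         ~ rotation_equiv (sol i) (sol j)).
Proof.
move=> al hal; set N := ceil_nat (al / 2).
(* Indices start at 0, so the power used is [n = i + 1], and [ceil_nat_lt] gives [n < al / 2 + 1],
   that is, [an i > 0]. *)
pose an i := (al + 2) / INR (S i) - 2.
have han : forall i, (i < N)%nat -> 0 < an i.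
  move=> i hi; have h := ceil_nat_lt _ _ hi; have hn := INR_S_pos i.
  have : 2 < (al + 2) / INR (S i) by apply/Rlt_div_r; lra.
  rewrite /an; lra.
have [P [hP1 hP]] := uniform_threshold (fun i p => exists vl : (pt -> R) * R, core_sol (an i) p (fst vl) (snd vl)) N
  ltac:(move=> i hi; have [p0 [h1 h2]] := core (an i) (han i hi);
        exists p0; split => // p hp; have [u [lam hu]] := h2 p hp; exists (u, lam); exact hu).
exists P => p hp.
(* The bound on [i] moves inside the existential so that choice yields a total function; indices
   from [N] on get a dummy pair. *)
have hex : forall i, exists vl : (pt -> R) * R, (i < N)%nat -> core_sol (an i) p (fst vl) (snd vl).
  move=> i; case: (Nat.lt_ge_cases i N) => hi.
    have [vl hvl] := hP p hp i hi; by exists vl.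
  exists (fun _ => 0, 0) => hi'; lia.
pose vl i := proj1_sig (constructive_indefinite_description _ (hex i)).
have hvl : forall i, (i < N)%nat -> core_sol (an i) p (fst (vl i)) (snd (vl i)).
  by move=> i; rewrite /vl; case: constructive_indefinite_description.
have hk : forall i, 0 < kappa p (snd (vl i)) (S i) by move=> i; exact: Rpower_pos.
exists (fun i => lift i (kappa p (snd (vl i)) (S i)) (fst (vl i))); split.
- move=> i hi; have h := hvl i hi; split; [|split].
  + apply: lift_henon => //; lra.
  + exact: lift_pos (hk i) h.
  + exact: lift_nonradial (hk i) h.
- move=> i j hij hj; have h := hvl i ltac:(lia); have h' := hvl j hj.
  exact: lift_not_equiv hij (hk i) h h'.
Qed.
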